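(* Let $A=(A_1,\ldots,A_N)$ be an $N$-tuple of complex $n\times m$ matrices with $\bigcap_{\ell}\ker A_\ell=\{0\}$ and $\bigcap_\ell\ker A_\ell^\dagger=\{0\}$, and suppose that $A$ is not $(\mathbf{1}/n,\mathbf{1}/m)$-scalable. With $(p^*,q^* )$, $C_A$, $(G^*,H^* )$, $\varDelta_A$, $f_A^\infty$ defined in the context: (1) $(p^*,q^* )$ is the minimum-norm point of the moment polytope $\varDelta_A$, and (2) $(G^*,H^* )/\|(G^*,H^* )\|$ is the unique minimizer of $f^{\infty}_A$ over the unit sphere $S_{I,I}$ of $\mathfrak{p}_n^1\times\mathfrak{p}_m^1$, where it holds $$\|(p^*,q^* )\|^2 = - f^{\infty}_A (G^*,H^* ) = \frac{1}{C_A} - \frac{1}{n}- \frac{1}{m}.$$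
   Context: $n,m,N\ge1$; $\dagger$ is conjugate transpose; $gBh^\dagger:=(gB_1h^\dagger,\ldots,gB_Nh^\dagger)$; $\|B\|^2:=\sum_\ell\mathrm{tr}\,B_\ell B_\ell^\dagger$; norms of pairs of matrices/vectors are Frobenius/Euclidean. $\mathbf 1$ is the all-ones vector and $\mathbf{1}_X$ the indicator vector of $X$. $A$ is $(\mathbf{1}/n,\mathbf{1}/m)$-scalable if for every $\epsilon>0$ there are $g\in GL_n(\mathbb C),h\in GL_m(\mathbb C)$ with $\|\sum_\ell gA_\ell h^\dagger hA_\ell^\dagger g^\dagger-\frac1nI\|_{\rm F}^2+\|\sum_\ell hA_\ell^\dagger g^\dagger gA_\ell h^\dagger-\frac1mI\|_{\rm F}^2\le\epsilon^2$. Moment map and polytope: for $B\ne0$, $\mu(B)=\frac{1}{\|B\|^2}\bigl(\sum_\ell B_\ell B_\ell^\dagger,\sum_\ell B_\ell^\dagger B_\ell\bigr)-\bigl(\frac1nI,\frac1mI\bigr)$. For a pair $(X,Y)$ of Hermitian matrices, $\mathrm{spec}(X,Y)=(p,q)\in\mathbb{R}^n\times\mathbb{R}^m$ with $p$ the eigenvalues of $X$ in nonincreasing order and $q$ the eigenvalues of $Y$ in nondecreasing order. $\varDelta_A$ is the closure of $\{\mathrm{spec}\,\mu(gAh^\dagger)\mid g\in SL_n(\mathbb C),h\in SL_m(\mathbb C)\}$ (a convex polytope). Kempf–Ness function: $\mathfrak{p}_n^1$ is the real space of traceless $n\times n$ Hermitian matrices. For positive definite $x,y$ of determinant one, $f_A(x,y):=\log\mathrm{tr}\sum_\ell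 xA_\ell yA_\ell^\dagger$; $f_A^\infty(G,H):=\lim_{t\to\infty}f_A(e^{tG},e^{tH})/t$ for $(G,H)\in\mathfrak{p}_n^1\times\mathfrak{p}_m^1$. Coarse DM-flag: $\mathcal{S}_A$ is the set of pairs of subspaces $X\subseteq\mathbb{C}^n,Y\subseteq\mathbb{C}^m$ with $u^\top A_\ell\bar v=0$ for all $u\in X,v\in Y,\ell$. $\phi(X,Y):=(\dim X,\dim Y)$. $\mathcal{E}_A$ is the set of $(X,Y)\in\mathcal{S}_A$ such that $\phi(X,Y)$ is an extreme point, other than $(0,0)$, of $\mathrm{Conv}\,\phi(\mathcal{S}_A)$. It is finite and can be arranged as $\mathcal{E}_A=\{(X_\alpha,Y_\alpha)\}_{\alpha=0}^\theta$ with $\mathbb{C}^n=X_0\supset X_1\supset\cdots\supset X_\theta=\{0\}$ and $\{0\}=Y_0\subset Y_1\subset\cdots\subset Y_\theta=\mathbb{C}^m$ (strict inclusions). For $\alpha\in\{1,\ldots,\theta\}$ let $n_\alpha:=\dim X_{\alpha-1}-\dim X_\alpha$, $m_\alpha:=\dim Y_\alpha-\dim Y_{\alpha-1}$, and let $I_1,\ldots,I_\theta$ (resp. $J_1,\ldots,J_\theta$) be the partition of $\{1,\ldots,n\}$ (resp. $\{1,\ldots,m\}$) into consecutive intervals, in this order, with $|I_\alpha|=n_\alpha$ (resp. $|J_\alpha|=m_\alpha$). Put $C_A:=\sum_{\alpha}\frac{n_\alpha m_\alpha}{n_\alpha+m_\alpha}$ and $$p^*:=-\frac1n\mathbf{1}+\frac1{C_A}\sum_{\alpha}\frac{m_\alpha}{n_\alpha+m_\alpha}\mathbf{1}_{I_\alpha},\qquad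 q^*:=-\frac1m\mathbf{1}+\frac1{C_A}\sum_{\alpha}\frac{n_\alpha}{n_\alpha+m_\alpha}\mathbf{1}_{J_\alpha}.$$ Let $\sigma^*$ be a unitary $n\times n$ matrix whose last $\dim X_\alpha$ rows form a basis of $X_\alpha$ for every $\alpha$, and $\tau^*$ a unitary $m\times m$ matrix whose first $\dim Y_\alpha$ rows form a basis of $Y_\alpha$ for every $\alpha$. Put $G^*:=(\sigma^* )^\dagger\,\mathrm{diag}(-p^* )\,\sigma^*$ and $H^*:=(\tau^* )^\dagger\,\mathrm{diag}(-q^* )\,\tau^*$. *)

(* Defs.v *)
From HB Require Import structures.
From mathcomp Require Import all_boot all_order all_algebra.
From mathcomp Require Import complex.
From mathcomp Require Import all_classical all_reals all_analysis.

Set Implicit Arguments.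
Unset Strict Implicit.
Unset Printing Implicit Defensive.

Import Order.TTheory GRing.Theory Num.Theory.
Import numFieldNormedType.Exports.

Local Open Scope classical_set_scope.
Local Open Scope ring_scope.
Local Open Scope complex_scope.
Local Open Scope sesquilinear_scope.

Section MatrixTuples.
Context {R : realType}.
Local Notation C := R[i].

Definition fnormsq n m (M : 'M[C]_(n, m)) : R := complex.Re (\tr (M *m M^t*)).

Definition pair_normsq n m (Z : 'M[C]_n * 'M[C]_m) : R :=
  fnormsq Z.1 + fnormsq Z.2.

Definition pair_norm n m (Z : 'M[C]_n * 'M[C]_m) : R :=
  Num.sqrt (pair_normsq Z).

Definition vec_normsq n m (x : 'rV[R]_n * 'rV[R]_m) : R :=
  \sum_(i < n) (x.1 0 i) ^+ 2 + \sum_(j < m) (x.2 0 j) ^+ 2.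

Definition tuple_normsq n m N (B : 'I_N -> 'M[C]_(n, m)) : R :=
  \sum_(l < N) fnormsq (B l).

Definition tuple_act n m N (g : 'M[C]_n) (h : 'M[C]_m)
    (B : 'I_N -> 'M[C]_(n, m)) : 'I_N -> 'M[C]_(n, m) :=
  fun l => g *m B l *m h^t*.

Definition row_gram n m N (B : 'I_N -> 'M[C]_(n, m)) : 'M[C]_n :=
  \sum_(l < N) B l *m (B l)^t*.

Definition col_gram n m N (B : 'I_N -> 'M[C]_(n, m)) : 'M[C]_m :=
  \sum_(l < N) (B l)^t* *m B l.

Definition is_scalable n m N (A : 'I_N -> 'M[C]_(n, m)) : Prop :=
  forall eps : R, 0 < eps ->
    exists (g : 'M[C]_n) (h : 'M[C]_m),
      [/\ g \in unitmx, h \in unitmx &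
          pair_normsq (row_gram (tuple_act g h A) - (n%:R^-1)%:M,
                       col_gram (tuple_act g h A) - (m%:R^-1)%:M)
            <= eps ^+ 2].

(* Meaningful only when [tuple_normsq B != 0]. *)
Definition moment_map n m N (B : 'I_N -> 'M[C]_(n, m)) : 'M[C]_n * 'M[C]_m :=
  ((tuple_normsq B)^-1%:C *: row_gram B - (n%:R^-1)%:M,
   (tuple_normsq B)^-1%:C *: col_gram B - (m%:R^-1)%:M).

(* Eigenvalues are counted with multiplicity, as roots of the characteristic
   polynomial; [p] is nonincreasing while [q] is nondecreasing. *)
Definition is_spec n m (Z : 'M[C]_n * 'M[C]_m) (x : 'rV[R]_n * 'rV[R]_m)
    : Prop :=
  [/\ char_poly Z.1 = \prod_(i < n) ('X - ((x.1 0 i)%:C)%:P),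
      char_poly Z.2 = \prod_(j < m) ('X - ((x.2 0 j)%:C)%:P),
      forall i i' : 'I_n, (i <= i')%N -> x.1 0 i' <= x.1 0 i &
      forall j j' : 'I_m, (j <= j')%N -> x.2 0 j <= x.2 0 j'].

Definition moment_polytope n m N (A : 'I_N -> 'M[C]_(n, m))
    : set ('rV[R]_n * 'rV[R]_m) :=
  closure [set x | exists (g : 'M[C]_n) (h : 'M[C]_m),
    [/\ \det g = 1, \det h = 1 & is_spec (moment_map (tuple_act g h A)) x]].

Definition is_min_norm_point n m (S : set ('rV[R]_n * 'rV[R]_m))
    (x : 'rV[R]_n * 'rV[R]_m) : Prop :=
  S x /\ forall y, S y -> y <> x -> vec_normsq x < vec_normsq y.

(* The power series of the exponential, summed separately in the real and
   imaginary parts of each entry, since [C] carries no canonical topology. *)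
Definition expmx n (X : 'M[C]_n) : 'M[C]_n :=
  \matrix_(i, j)
    (limn (series (fun k => complex.Re ((X ^+ k) i j) / k`!%:R))
     +i* limn (series (fun k => complex.Im ((X ^+ k) i j) / k`!%:R))).

Definition kempf_ness n m N (A : 'I_N -> 'M[C]_(n, m))
    (x : 'M[C]_n) (y : 'M[C]_m) : R :=
  ln (complex.Re (\tr (\sum_(l < N) x *m A l *m y *m (A l)^t*))).

Definition kempf_ness_oo n m N (A : 'I_N -> 'M[C]_(n, m))
    (Z : 'M[C]_n * 'M[C]_m) : R :=
  lim (kempf_ness A (expmx (t%:C *: Z.1)) (expmx (t%:C *: Z.2)) / t
       @[t --> +oo]).

Definition traceless_herm n : set 'M[C]_n :=
  [set G | G \is hermsymmx /\ \tr G = 0].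

Definition unit_sphere n m : set ('M[C]_n * 'M[C]_m) :=
  [set Z | [/\ traceless_herm Z.1, traceless_herm Z.2 & pair_norm Z = 1]].

Definition is_unique_minimizer T (f : T -> R) (S : set T) (x : T) : Prop :=
  S x /\ forall y, S y -> y <> x -> f x < f y.

(* Vectors of C^n are rows, so [u *m A l *m v^t*] is u^T A_l \bar v. *)
Definition SA n m N (A : 'I_N -> 'M[C]_(n, m))
    : set ({vspace 'rV[C]_n} * {vspace 'rV[C]_m}) :=
  [set XY : {vspace 'rV[C]_n} * {vspace 'rV[C]_m} |
    forall (u : 'rV[C]_n) (v : 'rV[C]_m) l,
      u \in XY.1 -> v \in XY.2 -> u *m A l *m v^t* = 0].

Definition dim_pair n m (XY : {vspace 'rV[C]_n} * {vspace 'rV[C]_m})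
    : R^o * R^o :=
  ((\dim XY.1)%:R, (\dim XY.2)%:R).

Definition conv_hull (M : lmodType R) (S : set M) : set M :=
  smallest (@convex_set R M) S.

Definition is_extreme_point (M : lmodType R) (K : set M) (x : M) : Prop :=
  K x /\ forall (y z : M) (t : R), K y -> K z -> 0 < t < 1 ->
    x = t *: y + (1 - t) *: z -> y = x /\ z = x.

Definition EA n m N (A : 'I_N -> 'M[C]_(n, m))
    : set ({vspace 'rV[C]_n} * {vspace 'rV[C]_m}) :=
  [set XY | [/\ SA A XY,
                is_extreme_point (conv_hull (@dim_pair n m @` SA A)) (dim_pair XY) &
                dim_pair XY <> 0]].

(* Only the values of [X] and [Y] at indices [0 <= a <= theta] matter, here and
   in everything below. *)
Definition is_coarse_DM_flag n m N (A : 'I_N -> 'M[C]_(n, m)) (theta : nat)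
    (X : nat -> {vspace 'rV[C]_n}) (Y : nat -> {vspace 'rV[C]_m}) : Prop :=
  [/\ EA A = [set (X a, Y a) | a in [set a | (a <= theta)%N]],
      X 0%N = fullv /\ X theta = 0%VS,
      Y 0%N = 0%VS /\ Y theta = fullv,
      forall a, (a < theta)%N -> (X a.+1 <= X a)%VS /\ X a.+1 <> X a &
      forall a, (a < theta)%N -> (Y a <= Y a.+1)%VS /\ Y a <> Y a.+1].

Section Flag.
Context {n m : nat} (theta : nat).
Variables (X : nat -> {vspace 'rV[C]_n}) (Y : nat -> {vspace 'rV[C]_m}).

Definition nblock (a : nat) : nat := \dim (X a.-1) - \dim (X a).
Definition mblock (a : nat) : nat := \dim (Y a) - \dim (Y a.-1).

(* [k] (counted from 0) lies in the [a]-th of the consecutive intervals of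
   lengths [d 1], [d 2], ... *)
Definition in_block (d : nat -> nat) (a k : nat) : bool :=
  (\sum_(1 <= b < a) d b <= k < \sum_(1 <= b < a.+1) d b)%N.

Definition C_A : R :=
  \sum_(1 <= a < theta.+1)
    (nblock a * mblock a)%:R / (nblock a + mblock a)%:R.

Definition pstar : 'rV[R]_n :=
  \row_(i < n) (- n%:R^-1 + C_A^-1 *
    \sum_(1 <= a < theta.+1 | in_block nblock a i)
      (mblock a)%:R / (nblock a + mblock a)%:R).

Definition qstar : 'rV[R]_m :=
  \row_(j < m) (- m%:R^-1 + C_A^-1 *
    \sum_(1 <= a < theta.+1 | in_block mblock a j)
      (nblock a)%:R / (nblock a + mblock a)%:R).

Definition adapted_left (sigma : 'M[C]_n) : Prop :=
  sigma \is unitarymx /\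
  forall a, (a <= theta)%N ->
    basis_of (X a)
      [seq row i sigma | i : 'I_n <- enum 'I_n & (n - \dim (X a) <= i)%N].

Definition adapted_right (tau : 'M[C]_m) : Prop :=
  tau \is unitarymx /\
  forall a, (a <= theta)%N ->
    basis_of (Y a) [seq row j tau | j : 'I_m <- enum 'I_m & (j < \dim (Y a))%N].

End Flag.

Definition conj_diag n (s : 'M[C]_n) (p : 'rV[R]_n) : 'M[C]_n :=
  s^t* *m diag_mx (map_mx (fun r => (- r)%:C) p) *m s.

Definition pair_normalize n m (Z : 'M[C]_n * 'M[C]_m) : 'M[C]_n * 'M[C]_m :=
  ((pair_norm Z)^-1%:C *: Z.1, (pair_norm Z)^-1%:C *: Z.2).

End MatrixTuples.

(* Main.v *)
(** Write [z = (p, q)] for a pair of sorted vectors, attached to unitary frames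
    [s], [t].  By Ky Fan's inequality, a lower bound [c] of [p_i + q_j] over the
    support of the tuple [s A t^t*] is a lower bound of [<z, x>] over the moment
    polytope; moreover [- c], for the best [c], is the value of [f_A^oo] at the
    corresponding pair of Hermitian matrices.  In frames adapted to the DM-flag
    the tuple is block upper triangular and the slopes of the flag decrease, so
    that [c = |x*|^2] for [z = x*], whence [<x*, x> >= |x*|^2] on the polytope.

    That [x*] belongs to the polytope then only requires points of the orbit
    whose moment map has norm close to [|x*|].  Each diagonal block is
    semistable, because no point of [phi (S_A)] lies above the edge between two
    consecutive extreme points; on a semistable tuple the logarithm of the
    capacity is bounded below (compactness of the unitary groups), and a
    near-minimiser is nearly doubly balanced by stability in AM-GM.  A
    one-parameter group makes the off-diagonal blocks negligible.

    Finally [f_A^oo (Z) >= - <z, x*> >= - |x*|] on the unit sphere, and equality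
    forces [z = x* / |x*|] together with a support that makes the eigenspaces of
    [Z] elements of [E_A], hence those of the flag. *)
Require Import Defs.
From mathcomp Require Import all_boot all_order all_algebra.
From mathcomp Require Import complex.
From mathcomp Require Import all_classical all_reals all_analysis.
From mathcomp Require Import perm lra ring zify.

Set Implicit Arguments.
Unset Strict Implicit.
Unset Printing Implicit Defensive.

Import Order.TTheory GRing.Theory Num.Theory.
Import numFieldNormedType.Exports.
Local Open Scope ring_scope.
Local Open Scope complex_scope.
Local Open Scope sesquilinear_scope.

(** * Adjoints, Frobenius norms and spectra *)

(** The constant [C_A] comes from a small optimisation. For a block diagonal tuple whose blocks are
    doubly balanced with squared norms T_a, the quantity |mu|^2 + 1/n + 1/m equals sum_a T_a^2
    (1/n_a + 1/m_a) / (sum_a T_a)^2; it is least for T_a proportional to n_a m_a / (n_a + m_a), with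
    value 1/C_A. Scaling each block to T_a = n_a m_a / (n_a + m_a) makes its squared Gram norm equal
    to T_a as well, so both quantities simply add up along the flag.

    The inequality <x*, x> >= |x*|^2 also turns small norm into closeness, since it gives |x - x*|^2
    <= |x|^2 - |x*|^2; and duality evaluated at x* itself shows that the bound on the support is
    attained.

    Frames adapted to [A] are not adapted to the other points of its orbit. Gram-Schmidt moves them
    by upper triangular factors on the left and lower triangular ones on the right, matching the
    opposite orders of p and q. Non-scalability enters through |x*| > 0, which gives the
    normalisation a meaning. *)

Section ComplexSquares.
Context {R : realType}.
Local Notation C := R[i].
Local Notation Re := complex.Re.
Local Notation Im := complex.Im.

Definition nsq (z : C) : R := Re z ^+ 2 + Im z ^+ 2.

Lemma mul_conjC_nsq (z : C) : z * conjc z = (nsq z)%:C.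
Proof.
by case: z => a b; apply/eqP; rewrite eq_complex /nsq /=; apply/andP; split;
  apply/eqP; ring.
Qed.

Lemma nsq_ge0 (z : C) : 0 <= nsq z.
Proof. by rewrite addr_ge0 ?sqr_ge0. Qed.

Lemma nsq_eq0 (z : C) : (nsq z == 0) = (z == 0).
Proof.
case: z => a b; rewrite /nsq /= paddr_eq0 ?sqr_ge0 // !sqrf_eq0.
by rewrite eq_complex.
Qed.

Lemma nsq_gt0 (z : C) : (0 < nsq z) = (z != 0).
Proof. by rewrite lt_neqAle nsq_ge0 andbT eq_sym nsq_eq0. Qed.

Lemma nsqM (x y : C) : nsq (x * y) = nsq x * nsq y.
Proof. by case: x => a b; case: y => c d; rewrite /nsq /=; ring. Qed.

Lemma nsqR (x : R) : nsq x%:C = x ^+ 2.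
Proof. by rewrite /nsq /= expr0n addr0. Qed.

Lemma nsqJ (x : C) : nsq (conjc x) = nsq x.
Proof. by case: x => a b; rewrite /nsq /= sqrrN. Qed.

Lemma ReD (x y : C) : Re (x + y) = Re x + Re y.
Proof. by case: x => a b; case: y. Qed.

Lemma ImD (x y : C) : Im (x + y) = Im x + Im y.
Proof. by case: x => a b; case: y. Qed.

Lemma ReN (x : C) : Re (- x) = - Re x.
Proof. by case: x. Qed.

Lemma Re_sum I (r : seq I) P (F : I -> C) :
  Re (\sum_(i <- r | P i) F i) = \sum_(i <- r | P i) Re (F i).
Proof. by apply: (big_morph _ ReD). Qed.

Lemma Im_sum I (r : seq I) P (F : I -> C) :
  Im (\sum_(i <- r | P i) F i) = \sum_(i <- r | P i) Im (F i).
Proof. by apply: (big_morph _ ImD). Qed.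

Lemma RC_sum I (r : seq I) P (F : I -> R) :
  (\sum_(i <- r | P i) F i)%:C = \sum_(i <- r | P i) (F i)%:C.
Proof. exact: (rmorph_sum (real_complex R)). Qed.

Lemma RC_mulE (x : R) (z : C) : x%:C * z = (x * Re z) +i* (x * Im z).
Proof. by case: z => a b; apply/eqP; rewrite eq_complex /= !mul0r subr0 addr0 !eqxx. Qed.

Lemma ReZ (x : R) (z : C) : Re (x%:C * z) = x * Re z.
Proof. by rewrite RC_mulE. Qed.

Lemma conjC_RC (x : R) : conjc (x%:C : C) = x%:C.
Proof. exact: conjc_real. Qed.

End ComplexSquares.

Section AdjointMatrices.
Context {R : realType}.
Local Notation C := R[i].
Local Notation Re := complex.Re.

Lemma adjmxM n m p (M : 'M[C]_(n, m)) (K : 'M[C]_(m, p)) :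
  (M *m K)^t* = K^t* *m M^t*.
Proof. by rewrite trmx_mul map_mxM. Qed.

Lemma adjmxE n m (M : 'M[C]_(n, m)) i j : M^t* i j = conjc (M j i).
Proof. by rewrite !mxE. Qed.

Lemma adjmxD n m (M K : 'M[C]_(n, m)) : (M + K)^t* = M^t* + K^t*.
Proof. by apply/matrixP => i j; rewrite !mxE rmorphD. Qed.

Lemma adjmxZ n m (c : C) (M : 'M[C]_(n, m)) : (c *: M)^t* = conjc c *: M^t*.
Proof. by apply/matrixP => i j; rewrite !mxE rmorphM. Qed.

Lemma adjmxN n m (M : 'M[C]_(n, m)) : (- M)^t* = - M^t*.
Proof. by apply/matrixP => i j; rewrite !mxE rmorphN. Qed.

Lemma adjmx_scalar n (c : C) : (c%:M : 'M[C]_n)^t* = (conjc c)%:M.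
Proof.
apply/matrixP => i j; rewrite !mxE eq_sym.
by case: eqP => _; rewrite ?mulr1n ?mulr0n ?rmorph0.
Qed.

Lemma adjmx_sum n m I (r : seq I) P (F : I -> 'M[C]_(n, m)) :
  (\sum_(i <- r | P i) F i)^t* = \sum_(i <- r | P i) (F i)^t*.
Proof.
apply: (big_morph (fun M : 'M[C]_(n, m) => M^t*)); first exact: adjmxD.
by apply/matrixP => i j; rewrite !mxE rmorph0.
Qed.

Lemma fnormsqE n m (M : 'M[C]_(n, m)) :
  fnormsq M = \sum_i \sum_j nsq (M i j).
Proof.
rewrite /fnormsq /mxtrace Re_sum; apply: eq_bigr => i _.
rewrite mxE Re_sum; apply: eq_bigr => j _.
by rewrite adjmxE mul_conjC_nsq.
Qed.

Lemma fnormsq_trC n m (M : 'M[C]_(n, m)) :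
  \tr (M *m M^t*) = (fnormsq M)%:C.
Proof.
rewrite fnormsqE RC_sum; apply: eq_bigr => i _.
rewrite mxE RC_sum; apply: eq_bigr => j _.
by rewrite adjmxE mul_conjC_nsq.
Qed.

Lemma fnormsq_ge0 n m (M : 'M[C]_(n, m)) : 0 <= fnormsq M.
Proof. by rewrite fnormsqE !sumr_ge0 // => i _; rewrite sumr_ge0 // => j _; exact: nsq_ge0. Qed.

Lemma fnormsq_eq0 n m (M : 'M[C]_(n, m)) : fnormsq M = 0 -> M = 0.
Proof.
rewrite fnormsqE => /eqP; rewrite psumr_eq0; last first.
  by move=> i _; rewrite sumr_ge0 // => j _; exact: nsq_ge0.
move=> /allP M0; apply/matrixP => i j; rewrite mxE.
have := M0 i (mem_index_enum _); rewrite implyTb psumr_eq0; last first.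
  by move=> k _; exact: nsq_ge0.
move=> /allP /(_ j (mem_index_enum _)).
by rewrite implyTb nsq_eq0 => /eqP.
Qed.

Lemma fnormsq0 n m : fnormsq (0 : 'M[C]_(n, m)) = 0.
Proof. by rewrite /fnormsq mul0mx linear0. Qed.

Lemma fnormsqZ n m (c : C) (M : 'M[C]_(n, m)) : fnormsq (c *: M) = nsq c * fnormsq M.
Proof.
rewrite !fnormsqE mulr_sumr; apply: eq_bigr => i _.
by rewrite mulr_sumr; apply: eq_bigr => j _; rewrite mxE nsqM.
Qed.

Lemma unitary_adjK n (s : 'M[C]_n) : s \is unitarymx -> s^t* *m s = 1%:M.
Proof. by move=> su; rewrite -trmxC_unitary in su; move/unitarymxP: su; rewrite trmxCK. Qed.

Lemma unitary_adj n (s : 'M[C]_n) : s \is unitarymx -> s^t* \is unitarymx.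
Proof. by rewrite trmxC_unitary. Qed.

Lemma fnormsq_unitaryl n m (s : 'M[C]_n) (M : 'M[C]_(n, m)) :
  s \is unitarymx -> fnormsq (s *m M) = fnormsq M.
Proof.
move=> su; rewrite /fnormsq adjmxM mulmxA mxtrace_mulC !mulmxA.
by rewrite unitary_adjK // mul1mx.
Qed.

Lemma fnormsq_unitaryr n m (s : 'M[C]_m) (M : 'M[C]_(n, m)) :
  s \is unitarymx -> fnormsq (M *m s^t*) = fnormsq M.
Proof.
by move=> su; rewrite /fnormsq adjmxM trmxCK mulmxA -(mulmxA M (s^t*)) unitary_adjK // mulmx1.
Qed.

Definition rdiag n (a : 'rV[R]_n) : 'M[C]_n := diag_mx (map_mx (fun r => r%:C) a).

Lemma rdiagE n (a : 'rV[R]_n) i j : rdiag a i j = (a 0 i)%:C *+ (i == j).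
Proof. by rewrite !mxE. Qed.

Lemma conj_diagE n (s : 'M[C]_n) (p : 'rV[R]_n) :
  conj_diag s p = s^t* *m rdiag (- p) *m s.
Proof.
rewrite /conj_diag /rdiag.
suff -> : map_mx (fun r => (- r)%:C) p = map_mx (fun r => r%:C) (- p) by [].
by apply/rowP => j; rewrite !mxE.
Qed.

Lemma rdiag_adj n (a : 'rV[R]_n) : (rdiag a)^t* = rdiag a.
Proof.
apply/matrixP => i j; rewrite adjmxE !rdiagE eq_sym.
by case: eqP => [->|_]; rewrite ?mulr1n ?mulr0n ?rmorph0 ?conjC_RC.
Qed.

Lemma mulmx_rdiag n m (M : 'M[C]_(m, n)) (a : 'rV[R]_n) i j :
  (M *m rdiag a) i j = M i j * (a 0 j)%:C.
Proof. by rewrite /rdiag mul_mx_diag !mxE. Qed.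

Lemma rdiag_mulmx n m (M : 'M[C]_(n, m)) (a : 'rV[R]_n) i j :
  (rdiag a *m M) i j = (a 0 i)%:C * M i j.
Proof. by rewrite /rdiag mul_diag_mx !mxE. Qed.

Lemma tr_rdiag n (a : 'rV[R]_n) : \tr (rdiag a) = (\sum_i a 0 i)%:C.
Proof. by rewrite RC_sum; apply: eq_bigr => i _; rewrite rdiagE eqxx. Qed.

Lemma fnormsq_rdiag n (a : 'rV[R]_n) : fnormsq (rdiag a) = \sum_i a 0 i ^+ 2.
Proof.
rewrite fnormsqE; apply: eq_bigr => i _; rewrite (bigD1 i) //= rdiagE eqxx nsqR.
by rewrite big1 ?addr0 // => j /negPf; rewrite rdiagE eq_sym => ->; rewrite nsqR expr0n.
Qed.

Lemma hermsymmxP n (G : 'M[C]_n) : (G \is hermsymmx) <-> G^t* = G.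
Proof.
split => [/is_hermitianmxP|] GE.
  by move: GE; rewrite expr0 scale1r => {2}->.
by apply/is_hermitianmxP; rewrite expr0 scale1r GE.
Qed.

Lemma conj_rdiag_herm n (s : 'M[C]_n) (a : 'rV[R]_n) :
  s^t* *m rdiag a *m s \is hermsymmx.
Proof. by apply/hermsymmxP; rewrite !adjmxM trmxCK rdiag_adj mulmxA. Qed.

Lemma conj_rdiag_tr n (s : 'M[C]_n) (a : 'rV[R]_n) : s \is unitarymx ->
  \tr (s^t* *m rdiag a *m s) = (\sum_i a 0 i)%:C.
Proof.
by move=> su; rewrite mxtrace_mulC mulmxA (unitarymxP su) mul1mx tr_rdiag.
Qed.

Lemma conj_rdiag_fnormsq n (s : 'M[C]_n) (a : 'rV[R]_n) : s \is unitarymx ->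
  fnormsq (s^t* *m rdiag a *m s) = \sum_i a 0 i ^+ 2.
Proof.
move=> su; rewrite -fnormsq_rdiag -mulmxA.
rewrite fnormsq_unitaryl ?trmxC_unitary //.
rewrite -[X in _ *m X]trmxCK.
by rewrite fnormsq_unitaryr ?trmxC_unitary.
Qed.

Lemma row_perm_unitary n (s : 'M[C]_n) (pi : {perm 'I_n}) :
  s \is unitarymx -> row_perm pi s \is unitarymx.
Proof.
move=> /unitarymxP su; apply/unitarymxP/matrixP => i j.
have := congr1 (fun M : 'M[C]_n => M (pi i) (pi j)) su.
rewrite !mxE (inj_eq perm_inj) => <-.
by apply: eq_bigr => k _; rewrite !mxE.
Qed.

(** The spectral theorem yields eigenvalues in no prescribed order; sorting them amounts to
    permuting the rows of the eigenbasis. The order [r] is a parameter because left spectra are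
    nonincreasing and right spectra nondecreasing. *)
Lemma herm_spectral n (r : rel R) (G : 'M[C]_n) :
  total r -> transitive r -> reflexive r -> G \is hermsymmx ->
  exists (s : 'M[C]_n) (a : 'rV[R]_n),
    [/\ s \is unitarymx, G = s^t* *m rdiag a *m s &
        forall i j : 'I_n, (i <= j)%N -> r (a 0 i) (a 0 j)].
Proof.
move=> rtot rtr rrefl Gh.
have /orthomx_spectralP := hermitian_normalmx Gh.
have := hermitian_spectral_diag_real Gh.
set P := spectralmx G; set d := spectral_diag G => /mxOverP dreal GE.
have Pu : P \is unitarymx by exact: spectral_unitarymx.
rewrite invmx_unitary // in GE.
pose f (i : 'I_n) := Re (d 0 i).
have fd i : (f i)%:C = d 0 i by rewrite RRe_real.
pose t := [tuple of sort r [tuple f i | i < n]].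
have : perm_eq t [tuple f i | i < n] by rewrite perm_sort.
move=> /tuple_permP [pi tE].
have tnE i : tnth t i = f (pi i).
  by rewrite (tnth_nth 0) tE -tnth_nth !tnth_mktuple.
exists (row_perm pi P), (\row_i tnth t i); split.
- exact: row_perm_unitary.
- rewrite GE; apply/matrixP => i j; rewrite !mxE.
  rewrite (reindex_inj (@perm_inj _ pi)) /=; apply: eq_bigr => k _.
  rewrite mul_mx_diag mulmx_rdiag !mxE tnE fd //.
- move=> i j ij; rewrite !mxE !(tnth_nth 0).
  apply: (sorted_leq_nth rtr rrefl) => //; rewrite ?inE ?size_tuple //.
  exact: sort_sorted.
Qed.

End AdjointMatrices.

(** * Ky Fan's inequality and weak duality *)

Section Rearrangement.
Context {R : realType}.

(* Cyclical monotonicity: the potential [v] is a discrete Stieltjes integral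
   of [p] against [l]. *)
Lemma sorted_potential n (p l : 'I_n -> R) :
  (forall i j : 'I_n, (i <= j)%N -> p j <= p i) ->
  (forall i j : 'I_n, (i <= j)%N -> l j <= l i) ->
  exists v : 'I_n -> R, forall i k, p i * (l k - l i) <= v k - v i.
Proof.
case: n p l => [p l _ _|n p l pS lS]; first by exists (fun=> 0) => -[].
pose P a := p (inord a); pose L a := l (inord a).
have PS a b : (a <= b)%N -> (b <= n)%N -> P b <= P a.
  by move=> ab bn; apply: pS; rewrite !inordK ?ltnS // (leq_trans ab).
have LS a b : (a <= b)%N -> (b <= n)%N -> L b <= L a.
  by move=> ab bn; apply: lS; rewrite !inordK ?ltnS // (leq_trans ab).
pose V k := \sum_(0 <= b < k) P b * (L b.+1 - L b).
have VS i d : (i + d <= n)%N ->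
    P i * (L (i + d)%N - L i) <= V (i + d)%N - V i /\
    P (i + d)%N * (L i - L (i + d)%N) <= V i - V (i + d)%N.
  elim: d => [|d IH] idn; first by rewrite addn0 !subrr !mulr0.
  have [|IH1 IH2] := IH; first by rewrite (leq_trans _ idn) // leq_add2l.
  rewrite addnS in idn *.
  have -> : V (i + d).+1 = V (i + d)%N + P (i + d)%N * (L (i + d).+1 - L (i + d)%N).
    by rewrite /V big_nat_recr.
  have h1 : P (i + d)%N <= P i by apply: PS; rewrite ?leq_addr // ltnW.
  have h2 : P (i + d).+1 <= P (i + d)%N by apply: PS.
  have h3 : L (i + d).+1 <= L (i + d)%N by apply: LS.
  have h4 : L (i + d)%N <= L i by apply: LS; rewrite ?leq_addr // ltnW.
  by split; nra.
exists (fun k : 'I_n.+1 => V k) => i k.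
have /orP [ik|ki] := leq_total i k.
  have [] := VS i (k - i)%N; first by rewrite subnKC // -ltnS.
  by rewrite subnKC // /P /L !inord_val.
have [] := VS k (i - k)%N; first by rewrite subnKC // -ltnS.
by rewrite subnKC // /P /L !inord_val.
Qed.

(** [S] is doubly stochastic, so the [S]-average of [v k - v i] vanishes for every potential [v];
    summing the bound of [sorted_potential] against [S] leaves the claim. *)
Lemma rearrangement n (S : 'I_n -> 'I_n -> R) (p l : 'I_n -> R) :
  (forall i k, 0 <= S i k) ->
  (forall i, \sum_k S i k = 1) -> (forall k, \sum_i S i k = 1) ->
  (forall i j : 'I_n, (i <= j)%N -> p j <= p i) ->
  (forall i j : 'I_n, (i <= j)%N -> l j <= l i) ->
  \sum_i \sum_k S i k * (p i * l k) <= \sum_i p i * l i.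
Proof.
move=> S0 Sr Sc pS lS; have [v vP] := sorted_potential pS lS.
have : \sum_i \sum_k S i k * (p i * (l k - l i)) <=
       \sum_i \sum_k S i k * (v k - v i).
  by apply: ler_sum => i _; apply: ler_sum => k _; apply: ler_wpM2l.
have -> : \sum_i \sum_k S i k * (v k - v i) = 0.
  under eq_bigr do (under eq_bigr do rewrite mulrBr; rewrite sumrB -mulr_suml Sr mul1r).
  rewrite sumrB exchange_big /= -sumrB big1 // => i _.
  by rewrite -mulr_suml Sc mul1r subrr.
under eq_bigr do (under eq_bigr do rewrite !mulrBr; rewrite sumrB -mulr_suml Sr mul1r).
by rewrite sumrB subr_le0.
Qed.

End Rearrangement.

Section KyFan.
Context {R : realType}.
Local Notation C := R[i].
Local Notation Re := complex.Re.

Lemma char_poly_conj_rdiag n (s : 'M[C]_n) (a : 'rV[R]_n) : s \is unitarymx ->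
  char_poly (s^t* *m rdiag a *m s) = \prod_(i < n) ('X - ((a 0 i)%:C)%:P).
Proof.
move=> su; have sK := unitary_adjK su.
have -> : \prod_(i < n) ('X - ((a 0 i)%:C)%:P) = char_poly (rdiag a).
  rewrite char_poly_trig; last by rewrite diag_mx_is_trig.
  by apply: eq_bigr => i _; rewrite rdiagE eqxx.
rewrite /char_poly.
have -> : char_poly_mx (s^t* *m rdiag a *m s) =
    map_mx polyC (s^t*) *m char_poly_mx (rdiag a) *m map_mx polyC s.
  rewrite /char_poly_mx mulmxBr mulmxBl -!map_mxM; congr (_ - _).
  by rewrite scalar_mxC -mulmxA -map_mxM sK map_mx1 mulmx1.
rewrite !det_mulmx mulrAC -det_mulmx -map_mxM sK map_mx1 det1 mul1r //.
Qed.

(** Two sorted lists with the same multiset of roots coincide, so a vector known only through the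
    characteristic polynomial, as in [is_spec], is realised by an orthonormal eigenbasis in that
    very order. *)
Lemma sorted_eigenvalues n (r : rel R) (G : 'M[C]_n) (l : 'rV[R]_n) :
  total r -> transitive r -> reflexive r -> antisymmetric r ->
  G \is hermsymmx ->
  char_poly G = \prod_(i < n) ('X - ((l 0 i)%:C)%:P) ->
  (forall i j : 'I_n, (i <= j)%N -> r (l 0 i) (l 0 j)) ->
  exists2 s : 'M[C]_n, s \is unitarymx & G = s^t* *m rdiag l *m s.
Proof.
move=> rtot rtr rrefl ranti Gh Gl lS.
have [s [a [su GE aS]]] := herm_spectral rtot rtr rrefl Gh.
exists s; first exact: su.
suff <- : a = l by exact: GE.
move: Gl; rewrite GE char_poly_conj_rdiag // => Gl.
pose t (b : 'rV[R]_n) := [seq b 0 i | i <- enum 'I_n].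
have tS (b : 'rV[R]_n) : (forall i j : 'I_n, (i <= j)%N -> r (b 0 i) (b 0 j)) -> sorted r (t b).
  move=> bS; rewrite /t sorted_map.
  apply: (@sub_sorted _ (fun i j : 'I_n => (i <= j)%N)) => [i j|]; first exact: bS.
  rewrite -(@sorted_map _ _ val leq) val_enum_ord; exact: iota_sorted.
have : t a = t l.
  apply: (sorted_eq rtr ranti); [exact: tS|exact: tS|].
  apply: (perm_map_inj (@complexI R)); apply: prod_XsubC_eq.
  rewrite !big_map -enumT !big_enum.
  exact: Gl.
move=> /eq_in_map al; apply/rowP => i; apply: al; exact: mem_enum.
Qed.

Lemma unitary_nsq_row n (s : 'M[C]_n) i : s \is unitarymx -> \sum_k nsq (s i k) = 1.
Proof.
move=> /unitarymxP /matrixP /(_ i i); rewrite !mxE eqxx => sE.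
apply: (@complexI R); rewrite RC_sum rmorph1 -[RHS]sE.
by apply: eq_bigr => k _; rewrite adjmxE mul_conjC_nsq.
Qed.

Lemma unitary_nsq_col n (s : 'M[C]_n) k : s \is unitarymx -> \sum_i nsq (s i k) = 1.
Proof.
rewrite -trmxC_unitary => /(@unitary_nsq_row _ _ k) <-.
by apply: eq_bigr => i _; rewrite adjmxE nsqJ.
Qed.

Lemma conj_rdiag_diag n m (s : 'M[C]_(m, n)) (l : 'rV[R]_n) i :
  (s *m rdiag l *m s^t*) i i = (\sum_k nsq (s i k) * l 0 k)%:C.
Proof.
rewrite mxE RC_sum; apply: eq_bigr => k _.
by rewrite mulmx_rdiag adjmxE mulrAC mul_conjC_nsq -rmorphM.
Qed.

(** The squared moduli of the entries of the unitary matrix [s *m u^t*] form a doubly stochastic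
    matrix, through which the diagonal of the conjugated matrix is an average of the eigenvalues
    [l]. *)
Lemma ky_fan_rdiag n (s u : 'M[C]_n) (p l : 'rV[R]_n) :
  s \is unitarymx -> u \is unitarymx ->
  (forall i j : 'I_n, (i <= j)%N -> p 0 j <= p 0 i) ->
  (forall i j : 'I_n, (i <= j)%N -> l 0 j <= l 0 i) ->
  \sum_i p 0 i * Re ((s *m (u^t* *m rdiag l *m u) *m s^t*) i i) <= \sum_i p 0 i * l 0 i.
Proof.
move=> su uu pS lS; set v := s *m u^t*.
have vu : v \is unitarymx by apply: (mul_unitarymx su); exact: unitary_adj.
have -> : s *m (u^t* *m rdiag l *m u) *m s^t* = v *m rdiag l *m v^t*.
  by rewrite /v adjmxM trmxCK !mulmxA.
apply: le_trans (rearrangement (S := fun i k => nsq (v i k)) _ _ _ pS lS).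
- apply: ler_sum => i _; rewrite conj_rdiag_diag /= mulr_sumr.
  by apply: ler_sum => k _; rewrite mulrCA.
- by move=> i k; exact: nsq_ge0.
- by move=> i; exact: unitary_nsq_row.
- by move=> k; exact: unitary_nsq_col.
Qed.

Lemma ky_fan_noninc n (s G : 'M[C]_n) (p l : 'rV[R]_n) :
  s \is unitarymx -> G \is hermsymmx ->
  char_poly G = \prod_(i < n) ('X - ((l 0 i)%:C)%:P) ->
  (forall i j : 'I_n, (i <= j)%N -> p 0 j <= p 0 i) ->
  (forall i j : 'I_n, (i <= j)%N -> l 0 j <= l 0 i) ->
  \sum_i p 0 i * Re ((s *m G *m s^t*) i i) <= \sum_i p 0 i * l 0 i.
Proof.
move=> su Gh Gl pS lS.
have [||||u uu ->] := sorted_eigenvalues (r := >=%O) _ _ _ _ Gh Gl lS.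
- exact: ge_total.
- exact: ge_trans.
- exact: lexx.
- exact: ge_anti.
exact: ky_fan_rdiag.
Qed.

Lemma ky_fan_nondec n (s G : 'M[C]_n) (p l : 'rV[R]_n) :
  s \is unitarymx -> G \is hermsymmx ->
  char_poly G = \prod_(i < n) ('X - ((l 0 i)%:C)%:P) ->
  (forall i j : 'I_n, (i <= j)%N -> p 0 i <= p 0 j) ->
  (forall i j : 'I_n, (i <= j)%N -> l 0 i <= l 0 j) ->
  \sum_i p 0 i * Re ((s *m G *m s^t*) i i) <= \sum_i p 0 i * l 0 i.
Proof.
move=> su Gh Gl pS lS.
have [||||u uu GE] := sorted_eigenvalues (r := <=%O) _ _ _ _ Gh Gl lS.
- exact: le_total.
- exact: le_trans.
- exact: lexx.
- exact: le_anti.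
have rN : rdiag (- l) = - rdiag l by apply/matrixP => i j; rewrite !mxE rmorphN mulNrn.
(* Negating both vectors makes them nonincreasing and leaves both sides unchanged. *)
have := @ky_fan_rdiag _ s u (- p) (- l) su uu.
rewrite rN mulmxN mulNmx mulmxN mulNmx -GE.
move: (s *m G *m s^t*) => M H.
have -> : \sum_i p 0 i * Re (M i i) = \sum_i (- p) 0 i * Re ((- M) i i).
  by apply: eq_bigr => i _; rewrite !mxE ReN mulrNN.
have -> : \sum_i p 0 i * l 0 i = \sum_i (- p) 0 i * (- l) 0 i.
  by apply: eq_bigr => i _; rewrite !mxE mulrNN.
apply: H => i j; first by move=> /pS; rewrite !mxE lerN2.
by move=> /lS; rewrite !mxE lerN2.
Qed.

End KyFan.

(** * Weights in unitary frames, transport along the orbit, weak duality *)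

Section Tuples.
Context {R : realType}.
Local Notation C := R[i].
Local Notation Re := complex.Re.

(** The mass of the tuple at position [(i, j)] in the frames [s], [t]: it is nonzero exactly on the
    support, and its row and column sums are the diagonals of the two Gram matrices. *)
Definition wgt n m k r N (s : 'M[C]_(k, n)) (t : 'M[C]_(r, m)) (A : 'I_N -> 'M[C]_(n, m))
  (i : 'I_k) (j : 'I_r) : R := \sum_(l < N) nsq ((s *m A l *m t^t*) i j).

Lemma wgt_ge0 n m k r N (s : 'M[C]_(k, n)) (t : 'M[C]_(r, m)) (A : 'I_N -> 'M[C]_(n, m)) i j :
  0 <= wgt s t A i j.
Proof. by apply: sumr_ge0 => l _; exact: nsq_ge0. Qed.

Lemma wgt_eq0P n m k r N (s : 'M[C]_(k, n)) (t : 'M[C]_(r, m)) (A : 'I_N -> 'M[C]_(n, m)) i j :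
  reflect (forall l, (s *m A l *m t^t*) i j = 0) (wgt s t A i j == 0).
Proof.
rewrite psumr_eq0; last by move=> l _; exact: nsq_ge0.
apply: (iffP allP) => [H l|H l _]; last by rewrite H implyTb nsq_eq0.
by have := H l (mem_index_enum _); rewrite implyTb nsq_eq0 => /eqP.
Qed.

Section Fixed.
Variables (n m N : nat).
Implicit Types (A B : 'I_N -> 'M[C]_(n, m)) (g s : 'M[C]_n) (h t : 'M[C]_m).

Lemma tuple_actM g h s t A :
  tuple_act s t (tuple_act g h A) = tuple_act (s *m g) (t *m h) A.
Proof. by apply/funext => l; rewrite /tuple_act adjmxM !mulmxA. Qed.

Lemma tuple_act1 A : tuple_act 1%:M 1%:M A = A.
Proof. by apply/funext => l; rewrite /tuple_act trmx1 map_mx1 mulmx1 mul1mx. Qed.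

Lemma tuple_normsqE s t A : tuple_normsq (tuple_act s t A) = \sum_i \sum_j wgt s t A i j.
Proof.
rewrite /tuple_normsq.
under eq_bigr do rewrite fnormsqE.
rewrite exchange_big /=; apply: eq_bigr => i _; rewrite exchange_big /=.
by apply: eq_bigr.
Qed.

Lemma row_gram_diag s t A i : (row_gram (tuple_act s t A)) i i = (\sum_j wgt s t A i j)%:C.
Proof.
rewrite summxE /wgt exchange_big /= RC_sum; apply: eq_bigr => l _.
rewrite mxE RC_sum; apply: eq_bigr => j _.
by rewrite adjmxE mul_conjC_nsq.
Qed.

Lemma col_gram_diag s t A j : (col_gram (tuple_act s t A)) j j = (\sum_i wgt s t A i j)%:C.
Proof.
rewrite summxE /wgt exchange_big /= RC_sum; apply: eq_bigr => l _.
rewrite mxE RC_sum; apply: eq_bigr => i _.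
by rewrite adjmxE mulrC mul_conjC_nsq.
Qed.

Lemma row_gram_tr A : \tr (row_gram A) = (tuple_normsq A)%:C.
Proof.
rewrite -(tuple_act1 A) tuple_normsqE RC_sum; apply: eq_bigr => i _.
by rewrite row_gram_diag.
Qed.

Lemma col_gram_tr A : \tr (col_gram A) = (tuple_normsq A)%:C.
Proof.
rewrite -(tuple_act1 A) tuple_normsqE exchange_big RC_sum; apply: eq_bigr => j _.
by rewrite col_gram_diag.
Qed.

Lemma tuple_normsq_ge0 A : 0 <= tuple_normsq A.
Proof. by apply: sumr_ge0 => l _; exact: fnormsq_ge0. Qed.

Lemma row_gram_act s t A : t \is unitarymx ->
  row_gram (tuple_act s t A) = s *m row_gram A *m s^t*.
Proof.
move=> tu; rewrite /row_gram mulmx_sumr mulmx_suml; apply: eq_bigr => l _.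
rewrite /tuple_act !adjmxM trmxCK !mulmxA -(mulmxA _ (t^t*)).
by rewrite (unitary_adjK tu) mulmx1.
Qed.

Lemma col_gram_act s t A : s \is unitarymx ->
  col_gram (tuple_act s t A) = t *m col_gram A *m t^t*.
Proof.
move=> su; rewrite /col_gram mulmx_sumr mulmx_suml; apply: eq_bigr => l _.
rewrite /tuple_act !adjmxM trmxCK !mulmxA -(mulmxA _ (s^t*)).
by rewrite (unitary_adjK su) mulmx1.
Qed.

Lemma row_gram_adj A : (row_gram A)^t* = row_gram A.
Proof.
by rewrite /row_gram adjmx_sum; apply: eq_bigr => l _; rewrite adjmxM trmxCK.
Qed.

Lemma col_gram_adj A : (col_gram A)^t* = col_gram A.
Proof.
by rewrite /col_gram adjmx_sum; apply: eq_bigr => l _; rewrite adjmxM trmxCK.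
Qed.

End Fixed.

(** Forward substitution: the diagonal entries of [L] are nonzero because their product is its
    determinant, and strong induction on the row index clears the entries to the right of the
    diagonal. *)
Lemma trig_inverse n (L K : 'M[C]_n) : L *m K = 1%:M ->
  (forall i j : 'I_n, (i < j)%N -> L i j = 0) ->
  forall i j : 'I_n, (i < j)%N -> K i j = 0.
Proof.
move=> LK Ltr.
have Lii i : L i i != 0.
  have : \det L != 0.
    apply/eqP => L0; have := congr1 determinant LK.
    by rewrite det_mulmx L0 mul0r det1 => /eqP; rewrite eq_sym oner_eq0.
  rewrite det_trig; last by apply/is_trig_mxP.
  by move=> /prodf_neq0; apply.
move=> i; have [d] := ubnP (val i); elim: d i => // d IH i id j ij.
have := congr1 (fun M : 'M[C]_n => M i j) LK; rewrite !mxE.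
rewrite (bigD1 i) //= big1 ?addr0; last first.
  move=> k ki; case: (ltngtP k i) => [lt|lt|eq].
  - rewrite (IH k) ?mulr0 //; first by rewrite (leq_trans lt).
    exact: ltn_trans lt ij.
  - by rewrite Ltr ?mul0r.
  - by move: ki; rewrite (val_inj eq) eqxx.
by rewrite -val_eqE ltn_eqF // => /eqP; rewrite mulf_eq0 (negPf (Lii i)) => /eqP.
Qed.

(** Row [i] of [K] lies in the span of the rows of [U] of index at most [i], so [K *m U^t*] is lower
    triangular; [L] is its inverse. *)
Lemma gram_schmidt_lower n (K : 'M[C]_n) : K \in unitmx ->
  exists U L : 'M[C]_n, [/\ U \is unitarymx, U = L *m K &
    forall i j : 'I_n, (i < j)%N -> L i j = 0].
Proof.
move=> Ku; pose U := schmidt K.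
have Uu : U \is unitarymx by apply: schmidt_unitarymx.
pose M := K *m U^t*.
have KE : K = M *m U by rewrite /M -mulmxA unitary_adjK // mulmx1.
have Mtr (i k : 'I_n) : (i < k)%N -> M i k = 0.
  move=> ik; have : (row i K <= kermx ((row k U)^t*))%MS.
    apply: submx_trans (row_schmidt_sub K i) _.
    apply/sumsmx_subP => k' k'i; rewrite genmxE; apply/sub_kermxP.
    apply/matrixP => a b; rewrite !ord1 [RHS]mxE.
    have /unitarymxP/matrixP/(_ k' k) := Uu; rewrite [in RHS]mxE.
    rewrite -val_eqE ltn_eqF ?(leq_ltn_trans k'i) // => UU0; rewrite -[RHS]UU0 !mxE.
    by apply: eq_bigr => c _; rewrite !mxE.
  move=> /sub_kermxP /matrixP /(_ 0 0); rewrite !mxE => E0.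
  by rewrite -[RHS]E0; apply: eq_bigr => c _; rewrite !mxE.
have Mu : M \in unitmx.
  by rewrite unitmx_mul Ku; apply: unitarymx_unit; exact: unitary_adj.
exists U, (invmx M); split => //.
  by rewrite -[LHS](mulKmx Mu) -KE.
by apply: (trig_inverse (mulmxV Mu)) Mtr.
Qed.

(** Gram-Schmidt run from the last row upwards, by reversing the order of the rows. The left frame
    calls for it because the spaces [X a] are spanned by trailing rows. *)
Lemma gram_schmidt_upper n (K : 'M[C]_n) : K \in unitmx ->
  exists U L : 'M[C]_n, [/\ U \is unitarymx, U = L *m K &
    forall i j : 'I_n, (j < i)%N -> L i j = 0].
Proof.
move=> Ku; pose pi : {perm 'I_n} := perm (@rev_ord_inj n).
have [|U [L [Uu UE Ltr]]] := @gram_schmidt_lower _ (row_perm pi K).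
  by rewrite row_permE unitmx_mul unitmx_perm.
exists (row_perm pi U), (row_perm pi (col_perm pi L)); split.
- exact: row_perm_unitary.
- apply/matrixP => i j; rewrite [LHS]mxE UE !mxE (reindex_inj (@perm_inj _ pi)).
  apply: eq_bigr => k _ /=; rewrite !mxE !permE rev_ordK //.
- move=> i j ji; rewrite !mxE; apply: Ltr; rewrite !permE /=.
  have := ltn_ord i; lia.
Qed.

(* Moving [A] along its orbit transports the flags adapted to [sigma], [tau];
   in bases adapted to the transported flags the matrix entries change only by
   triangular factors, which preserve lower bounds on a monotone weight over
   the support. *)
Lemma support_transport n m N (A : 'I_N -> 'M[C]_(n, m)) (s g : 'M[C]_n) (t h : 'M[C]_m)
    (z1 : 'rV[R]_n) (z2 : 'rV[R]_m) (c : R) :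
  s \is unitarymx -> t \is unitarymx -> g \in unitmx -> h \in unitmx ->
  (forall i j : 'I_n, (i <= j)%N -> z1 0 j <= z1 0 i) ->
  (forall i j : 'I_m, (i <= j)%N -> z2 0 i <= z2 0 j) ->
  (forall i j, wgt s t A i j != 0 -> c <= z1 0 i + z2 0 j) ->
  exists s' t', [/\ s' \is unitarymx, t' \is unitarymx &
    forall i j, wgt s' t' (tuple_act g h A) i j != 0 -> c <= z1 0 i + z2 0 j].
Proof.
move=> su tu gu hu z1S z2S supp.
have [|s' [L [s'u s'E Ltr]]] := @gram_schmidt_upper _ (s *m invmx g).
  by rewrite unitmx_mul unitmx_inv gu andbT unitarymx_unit.
have [|t' [M [t'u t'E Mtr]]] := @gram_schmidt_lower _ (t *m invmx h).
  by rewrite unitmx_mul unitmx_inv hu andbT unitarymx_unit.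
exists s', t'; split; [exact: s'u|exact: t'u|] => i j; apply: contraNT; rewrite -ltNge => zc.
apply/wgt_eq0P => l; rewrite /tuple_act.
have -> : s' *m (g *m A l *m h^t*) *m t'^t* = L *m (s *m A l *m t^t*) *m M^t*.
  have sE : s' *m g = L *m s by rewrite s'E -!mulmxA (mulVmx gu) mulmx1.
  have tE : t' *m h = M *m t by rewrite t'E -!mulmxA (mulVmx hu) mulmx1.
  transitivity ((s' *m g) *m A l *m (t' *m h)^t*); first by rewrite adjmxM !mulmxA.
  by rewrite sE tE adjmxM !mulmxA.
(* [L] leaves only indices [a >= i] and [M] only [b <= j]. By the two sort orders, [z1 + z2] at
   [(a, b)] is at most its value at [(i, j)], hence below [c], so [(a, b)] lies outside the
   support. *)
rewrite mxE big1 // => b _; rewrite mxE.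
case: (ltnP j b) => [jb|bj]; first by rewrite adjmxE Mtr // rmorph0 mulr0.
rewrite big1 ?mul0r // => a _.
case: (ltnP a i) => [ai|ia]; first by rewrite Ltr // mul0r.
have /wgt_eq0P -> : wgt s t A a b == 0; last by rewrite mulr0.
apply: contraT => /supp cz; have := z1S _ _ ia; have := z2S _ _ bj.
by move: zc cz; lra.
Qed.

Lemma natC_inv n : (n%:R^-1 : C) = (n%:R^-1 : R)%:C.
Proof. by rewrite fmorphV rmorph_nat. Qed.

Lemma row_moment_herm n m N (B : 'I_N -> 'M[C]_(n, m)) : (moment_map B).1 \is hermsymmx.
Proof.
apply/hermsymmxP; rewrite /moment_map /= adjmxD adjmxN adjmxZ adjmx_scalar.
by rewrite row_gram_adj natC_inv !conjC_RC.
Qed.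

Lemma col_moment_herm n m N (B : 'I_N -> 'M[C]_(n, m)) : (moment_map B).2 \is hermsymmx.
Proof.
apply/hermsymmxP; rewrite /moment_map /= adjmxD adjmxN adjmxZ adjmx_scalar.
by rewrite col_gram_adj natC_inv !conjC_RC.
Qed.

Lemma tuple_normsq_act n m N (B : 'I_N -> 'M[C]_(n, m)) s t :
  s \is unitarymx -> t \is unitarymx ->
  tuple_normsq (tuple_act s t B) = tuple_normsq B.
Proof.
move=> su tu; apply: eq_bigr => l _.
by rewrite /tuple_act (fnormsq_unitaryr _ tu) (fnormsq_unitaryl _ su).
Qed.

Lemma row_moment_diag n m N (B : 'I_N -> 'M[C]_(n, m)) (s : 'M[C]_n) (t : 'M[C]_m) i :
  s \is unitarymx -> t \is unitarymx ->
  Re ((s *m (moment_map B).1 *m s^t*) i i) =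
  (tuple_normsq B)^-1 * \sum_j wgt s t B i j - n%:R^-1.
Proof.
move=> su tu; rewrite /moment_map mulmxBr mulmxBl -scalemxAr -scalemxAl.
rewrite -(row_gram_act s B tu) scalar_mxC -mulmxA (unitarymxP su) mulmx1.
rewrite 3!mxE row_gram_diag ReD ReN ReZ natC_inv mxE eqxx.
by rewrite mulr1n.
Qed.

Lemma col_moment_diag n m N (B : 'I_N -> 'M[C]_(n, m)) (s : 'M[C]_n) (t : 'M[C]_m) j :
  s \is unitarymx -> t \is unitarymx ->
  Re ((t *m (moment_map B).2 *m t^t*) j j) =
  (tuple_normsq B)^-1 * \sum_i wgt s t B i j - m%:R^-1.
Proof.
move=> su tu; rewrite /moment_map mulmxBr mulmxBl -scalemxAr -scalemxAl.
rewrite -(col_gram_act t B su) scalar_mxC -mulmxA (unitarymxP tu) mulmx1.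
rewrite 3!mxE col_gram_diag ReD ReN ReZ natC_inv mxE eqxx.
by rewrite mulr1n.
Qed.

(** Ky Fan bounds the pairing with the spectrum from below by the pairing with the diagonal of the
    moment map in the frames [s], [t]. The scalar parts disappear because [z1] and [z2] sum to zero;
    what remains is an average of [z1 + z2] with weights [wgt / tuple_normsq B], carried by the
    support. *)
Lemma weak_duality n m N (B : 'I_N -> 'M[C]_(n, m)) (s : 'M[C]_n) (t : 'M[C]_m)
    (z1 : 'rV[R]_n) (z2 : 'rV[R]_m) (c : R) x :
  s \is unitarymx -> t \is unitarymx ->
  (forall i j : 'I_n, (i <= j)%N -> z1 0 j <= z1 0 i) ->
  (forall i j : 'I_m, (i <= j)%N -> z2 0 i <= z2 0 j) ->
  \sum_i z1 0 i = 0 -> \sum_j z2 0 j = 0 ->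
  (forall i j, wgt s t B i j != 0 -> c <= z1 0 i + z2 0 j) ->
  0 < tuple_normsq B ->
  is_spec (moment_map B) x ->
  c <= \sum_i z1 0 i * x.1 0 i + \sum_j z2 0 j * x.2 0 j.
Proof.
move=> su tu z1S z2S z10 z20 supp B0 [xr xc x1S x2S].
have := ky_fan_noninc su (row_moment_herm B) xr z1S x1S.
have := ky_fan_nondec tu (col_moment_herm B) xc z2S x2S.
under eq_bigr do rewrite (col_moment_diag _ _ su tu) mulrBr.
rewrite sumrB -mulr_suml z20 mul0r subr0 => le2.
under eq_bigr do rewrite (row_moment_diag _ _ su tu) mulrBr.
rewrite sumrB -mulr_suml z10 mul0r subr0 => le1.
apply: le_trans (lerD le1 le2).
have TE := tuple_normsqE s t B; rewrite (tuple_normsq_act _ su tu) in TE.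
set T := tuple_normsq B in B0 TE le1 le2 *.
rewrite -(ler_pM2l B0); apply: (@le_trans _ _
  (\sum_i \sum_j (z1 0 i + z2 0 j) * wgt s t B i j)).
  rewrite TE mulr_suml; apply: ler_sum => i _.
  rewrite mulr_suml; apply: ler_sum => j _.
  have [->|/supp cz] := eqVneq (wgt s t B i j) 0; first by rewrite mul0r mulr0.
  by rewrite mulrC ler_wpM2r // wgt_ge0.
have Tn : T != 0 by rewrite gt_eqF.
rewrite mulrDr !mulr_sumr.
rewrite (eq_bigr (fun i => \sum_j z1 0 i * wgt s t B i j +
    \sum_j z2 0 j * wgt s t B i j)); last first.
  by move=> i _; rewrite -big_split /=; apply: eq_bigr => j _; rewrite mulrDl.
rewrite big_split /= lerD //.
  by apply: ler_sum => i _; rewrite -mulr_sumr mulrCA mulVKf.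
rewrite exchange_big /=.
by apply: ler_sum => i _; rewrite -mulr_sumr mulrCA mulVKf.
Qed.

End Tuples.

(** * Scalability of semistable tuples *)

Section ComplexContinuity.
Context {R : realType}.
Local Notation C := R[i].
Local Notation Re := complex.Re.
Local Notation Im := complex.Im.
Variable T : topologicalType.

(** The source [T] is arbitrary because it will be both the real parameter of a one-parameter group
    and the coordinate space of pairs of matrices. *)
Definition ccont (f : T -> C) : Prop :=
  continuous (fun x => Re (f x)) /\ continuous (fun x => Im (f x)).

Lemma ccont_cst c : ccont (fun=> c).
Proof. by split; exact: cst_continuous. Qed.

Lemma continuous_addR (f g : T -> R) :
  continuous f -> continuous g -> continuous (fun x => f x + g x).
Proof. by move=> fc gc x; apply: cvgD; [exact: fc|exact: gc]. Qed.

Lemma continuous_sumR (I : Type) (r : seq I) P (F : I -> T -> R) :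
  (forall i, continuous (F i)) -> continuous (fun x => \sum_(i <- r | P i) F i x).
Proof.
move=> Fc; elim: r => [|i r IH] x.
  under eq_fun do rewrite big_nil; exact: cvg_cst.
under eq_fun do rewrite big_cons.
by case: (P i); [apply: cvgD; [exact: Fc|exact: IH]|exact: IH].
Qed.

Lemma ccontD f g : ccont f -> ccont g -> ccont (fun x => f x + g x).
Proof.
move=> [fr fi] [gr gi]; split => x.
  by under eq_fun do rewrite ReD; apply: cvgD; [exact: fr|exact: gr].
by under eq_fun do rewrite ImD; apply: cvgD; [exact: fi|exact: gi].
Qed.

Lemma ccontM f g : ccont f -> ccont g -> ccont (fun x => f x * g x).
Proof.
move=> [fr fi] [gr gi]; split => x.
  rewrite (_ : (fun _ => _) = fun x => Re (f x) * Re (g x) - Im (f x) * Im (g x)); last first.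
    by apply/funext => y; case: (f y); case: (g y).
  by apply: cvgB; apply: cvgM; [exact: fr|exact: gr|exact: fi|exact: gi].
rewrite (_ : (fun _ => _) = fun x => Re (f x) * Im (g x) + Im (f x) * Re (g x)); last first.
  by apply/funext => y; case: (f y); case: (g y).
by apply: cvgD; apply: cvgM; [exact: fr|exact: gi|exact: fi|exact: gr].
Qed.

Lemma ccont_sum (I : Type) (r : seq I) P (F : I -> T -> C) :
  (forall i, ccont (F i)) -> ccont (fun x => \sum_(i <- r | P i) F i x).
Proof.
move=> Fc; split.
  by under eq_fun do rewrite Re_sum; apply: continuous_sumR => i; case: (Fc i).
by under eq_fun do rewrite Im_sum; apply: continuous_sumR => i; case: (Fc i).
Qed.

Lemma ccontJ f : ccont f -> ccont (fun x => conjc (f x)).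
Proof.
move=> [fr fi]; split => x.
  rewrite (_ : (fun _ => _) = fun x => Re (f x)); first exact: fr.
  by apply/funext => y; case: (f y).
rewrite (_ : (fun _ => _) = fun x => - Im (f x)); first by apply: cvgN; exact: fi.
by apply/funext => y; case: (f y).
Qed.

Lemma nsq_continuous f : ccont f -> continuous (fun x => nsq (f x)).
Proof.
move=> [fr fi] x; rewrite /nsq.
by apply: cvgD; apply: cvgM; [exact: fr|exact: fr|exact: fi|exact: fi].
Qed.

Definition mcont n m (F : T -> 'M[C]_(n, m)) : Prop :=
  forall i j, ccont (fun x => F x i j).

Lemma mcont_cst n m (M : 'M[C]_(n, m)) : mcont (fun=> M).
Proof. by move=> i j; exact: ccont_cst. Qed.

Lemma mcontD n m (F G : T -> 'M[C]_(n, m)) :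
  mcont F -> mcont G -> mcont (fun x => F x + G x).
Proof.
by move=> Fc Gc i j; under eq_fun do rewrite mxE; exact: ccontD.
Qed.

Lemma mcontM n m p (F : T -> 'M[C]_(n, m)) (G : T -> 'M[C]_(m, p)) :
  mcont F -> mcont G -> mcont (fun x => F x *m G x).
Proof.
move=> Fc Gc i j; under eq_fun do rewrite mxE.
by apply: ccont_sum => k; exact: ccontM.
Qed.

Lemma mcontJ n m (F : T -> 'M[C]_(n, m)) : mcont F -> mcont (fun x => (F x)^t*).
Proof. by move=> Fc i j; under eq_fun do rewrite adjmxE; exact: ccontJ. Qed.

Lemma mcont_sum n m (I : Type) (r : seq I) P (F : I -> T -> 'M[C]_(n, m)) :
  (forall i, mcont (F i)) -> mcont (fun x => \sum_(i <- r | P i) F i x).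
Proof.
move=> Fc i j; under eq_fun do rewrite summxE.
by apply: ccont_sum => k; exact: Fc.
Qed.

Lemma fnormsq_continuous n m (F : T -> 'M[C]_(n, m)) :
  mcont F -> continuous (fun x => fnormsq (F x)).
Proof.
move=> Fc; under eq_fun do rewrite fnormsqE.
apply: continuous_sumR => i; apply: continuous_sumR => j.
exact: nsq_continuous.
Qed.

End ComplexContinuity.

Section UnitaryCompactness.
Context {R : realType}.
Local Notation C := R[i].

Lemma unitary_entry n (s : 'M[C]_n) i j : s \is unitarymx ->
  - 1 <= complex.Re (s i j) <= 1 /\ - 1 <= complex.Im (s i j) <= 1.
Proof.
move=> /(@unitary_nsq_row _ _ s i); rewrite (bigD1 j) //= => nsq1.
have : nsq (s i j) <= 1.
  by rewrite -nsq1 lerDl sumr_ge0 // => k _; exact: nsq_ge0.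
case: (s i j) => a b; rewrite /nsq /= => ab.
by split; apply/andP; split; nra.
Qed.

Section Decode.
Variables n m : nat.

(** Real coordinates of a pair of matrices: the summand selects the matrix, the boolean selects the
    real part ([true]) or the imaginary part ([false]). *)
Let I : finType := ('I_n * 'I_n * bool + 'I_m * 'I_m * bool)%type.

Let dl (v : 'rV[R]_#|I|) : 'M[C]_n :=
  \matrix_(i, j) (v 0 (enum_rank (inl (i, j, true) : I)) +i*
                  v 0 (enum_rank (inl (i, j, false) : I))).
Let dr (v : 'rV[R]_#|I|) : 'M[C]_m :=
  \matrix_(i, j) (v 0 (enum_rank (inr (i, j, true) : I)) +i*
                  v 0 (enum_rank (inr (i, j, false) : I))).
Let enc (s : 'M[C]_n) (t : 'M[C]_m) : 'rV[R]_#|I| :=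
  \row_k match enum_val k with
    | inl (i, j, b) => if b then complex.Re (s i j) else complex.Im (s i j)
    | inr (i, j, b) => if b then complex.Re (t i j) else complex.Im (t i j)
    end.

Let dlK s t : dl (enc s t) = s.
Proof. by apply/matrixP => i j; rewrite !mxE !enum_rankK; case: (s i j). Qed.

Let drK s t : dr (enc s t) = t.
Proof. by apply/matrixP => i j; rewrite !mxE !enum_rankK; case: (t i j). Qed.

Let dlc : mcont dl.
Proof.
by move=> i j; under eq_fun do rewrite mxE; split => x; exact: coord_continuous.
Qed.

Let drc : mcont dr.
Proof.
by move=> i j; under eq_fun do rewrite mxE; split => x; exact: coord_continuous.
Qed.

(* Rather than the unitary group itself, minimise over a compact cube
   containing it, with a penalty vanishing exactly on unitary pairs. *)
Lemma unitary_pair_min (f : 'M[C]_n -> 'M[C]_m -> R) :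
  (forall (T : topologicalType) (F : T -> 'M[C]_n) (G : T -> 'M[C]_m),
     mcont F -> mcont G -> continuous (fun x => f (F x) (G x))) ->
  (forall s t, 0 <= f s t) ->
  (forall s t, s \is unitarymx -> t \is unitarymx -> 0 < f s t) ->
  exists2 c, 0 < c & forall s t, s \is unitarymx -> t \is unitarymx -> c <= f s t.
Proof.
move=> fc f0 fpos.
pose F v := f (dl v) (dr v) + fnormsq (dl v *m (dl v)^t* - 1%:M)
                            + fnormsq (dr v *m (dr v)^t* - 1%:M).
have Fc : continuous F.
  have defect_cont k (G : 'rV[R]_#|I| -> 'M[C]_k) :
      mcont G -> continuous (fun v => fnormsq (G v *m (G v)^t* - 1%:M)).
    move=> Gc; apply: fnormsq_continuous; apply: mcontD; last exact: mcont_cst.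
    by apply: mcontM => //; exact: mcontJ.
  have fdc := fc _ _ _ dlc drc.
  by apply: continuous_addR (defect_cont _ _ drc); apply: continuous_addR (defect_cont _ _ dlc).
(* If all three terms vanished, the decoded pair would be unitary, and there [f] is positive. *)
have Fpos v : 0 < F v.
  rewrite lt_neqAle addr_ge0 ?addr_ge0 ?fnormsq_ge0 // andbT eq_sym.
  rewrite !paddr_eq0 ?addr_ge0 ?fnormsq_ge0 //; apply/negP => /andP[/andP[/eqP fv /eqP sv] /eqP tv].
  have := fpos (dl v) (dr v); rewrite fv ltxx => /(_ _ _)/negP; apply; rewrite ?negbK //.
    by apply/unitarymxP/subr0_eq; exact: fnormsq_eq0.
  by apply/unitarymxP/subr0_eq; exact: fnormsq_eq0.
pose A : set 'rV[R]_#|I| := [set v | forall i, `[(- 1 : R), 1] (v ord0 i)]%classic.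
have Ac : compact A.
  exact: (@rV_compact R _ (fun=> `[(- 1 : R), 1]%classic) (fun=> @segment_compact R _ _)).
have [|v Av vmin] := compact_EVT_min _ Ac (continuous_subspaceT Fc).
  by exists 0 => i /=; rewrite in_itv /= mxE; apply/andP; split; lra.
exists (F v) => // s t su tu.
have : F (enc s t) = f s t.
  rewrite /F dlK drK (unitarymxP su) (unitarymxP tu) !subrr !fnormsq0 !addr0 //.
move=> <-; apply: vmin; rewrite inE => i /=; rewrite in_itv /= mxE.
case: (enum_val i) => -[[a b] c].
  by have := unitary_entry a b su; case: c => -[].
by have := unitary_entry a b tu; case: c => -[].
Qed.

End Decode.

End UnitaryCompactness.

(** * Averaging and stability of the AM-GM inequality *)

Section RealLemmas.
Context {R : realType}.

Lemma sum_divn (n m : nat) (a : nat -> R) : (0 < m)%N ->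
  \sum_(0 <= k < n * m) a (k %/ m)%N = m%:R * \sum_(0 <= i < n) a i.
Proof.
move=> m0; rewrite big_nat_mul mulr_sumr; apply: eq_bigr => i _.
rewrite (eq_big_nat _ _ (F2 := fun=> a i)); last first.
  move=> k /andP [lk ku]; congr a; apply/eqP; rewrite eqn_leq -ltnS.
  by rewrite ltn_divLR // ku leq_divRL.
by rewrite sumr_const_nat mulSn addnK mulr_natl.
Qed.

(* Evaluate both sequences, as step functions on [0, 1], at [x] and [1 - x],
   for the midpoint [x] of one of the [n * m] cells. *)
Lemma exists_above_average (n m : nat) (a : 'I_n -> R) (b : 'I_m -> R) :
  (0 < n)%N -> (0 < m)%N ->
  exists (i : 'I_n) (j : 'I_m), (n * m < i.+1 * m + j.+1 * n)%N /\
    n%:R^-1 * \sum_i a i + m%:R^-1 * \sum_j b j <= a i + b j.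
Proof.
case: n a => // n a _; case: m b => // m b _.
pose A i := a (inord i); pose B j := b (inord j).
set n1 := n.+1; set m1 := m.+1.
(* Cell [k] sees the value of [a] at its midpoint and that of [b] at the mirrored midpoint, which
   lies in cell [n1 * m1 - k.+1]. *)
pose F k := A (k %/ m1)%N + B ((n1 * m1 - k.+1) %/ n1)%N.
set c := _ + _.
have n0 : (n1%:R : R) != 0 by rewrite pnatr_eq0.
have m0 : (m1%:R : R) != 0 by rewrite pnatr_eq0.
have FE : \sum_(0 <= k < n1 * m1) F k = \sum_(0 <= k < n1 * m1) c.
  rewrite big_split /= sum_divn //.
  have -> : \sum_(0 <= k < n1 * m1) B ((n1 * m1 - k.+1) %/ n1)%N =
            n1%:R * \sum_(0 <= j < m1) B j.
    rewrite (mulnC n1) -(sum_divn m1 B (ltn0Sn n)) [RHS]big_nat_rev.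
    by apply: eq_bigr => k _; rewrite add0n.
  rewrite sumr_const_nat subn0 -[c *+ _]mulr_natr natrM /c.
  have -> : \sum_(0 <= i < n1) A i = \sum_i a i.
    by rewrite big_mkord; apply: eq_bigr => i _; rewrite /A inord_val.
  have -> : \sum_(0 <= j < m1) B j = \sum_j b j.
    by rewrite big_mkord; apply: eq_bigr => j _; rewrite /B inord_val.
  by field; rewrite n0 m0.
have [k [kn ck]] : exists k, (k < n1 * m1)%N /\ c <= F k.
  apply: contrapT => H.
  suff : \sum_(0 <= k < n1 * m1) F k < \sum_(0 <= k < n1 * m1) c by rewrite FE ltxx.
  apply: ltr_sum_nat => [|k /andP[_ kn]]; first by rewrite muln_gt0.
  by rewrite ltNge; apply/negP => ck; apply: H; exists k.
have kn' : (k %/ m1 < n1)%N by rewrite ltn_divLR.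
have km' : ((n1 * m1 - k.+1) %/ n1 < m1)%N by rewrite ltn_divLR // mulnC; lia.
exists (inord (k %/ m1)), (inord ((n1 * m1 - k.+1) %/ n1)); split; last exact: ck.
rewrite !inordK //.
(* With [i], [j] the two quotients, [k < (i + 1) m] and [n m - k - 1 < (j + 1) n]; added as
   integers, these give the strict inequality on the indices. *)
have h1 := ltn_ceil k (ltn0Sn m).
have h2 := ltn_ceil (n1 * m1 - k.+1) (ltn0Sn n).
rewrite -/n1 -/m1 in h1 h2.
lia.
Qed.

(** With [s] the square root of [x], [ln x = 2 ln s <= 2 (s - 1)], and [s^2 - 1 - 2 (s - 1)] is the
    square [(s - 1)^2]. *)
Lemma amgm_defect (x : R) : 0 < x -> (Num.sqrt x - 1) ^+ 2 <= x - 1 - ln x.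
Proof.
move=> x0; have s0 : 0 < Num.sqrt x by rewrite sqrtr_gt0.
have sE : Num.sqrt x ^+ 2 = x by rewrite sqr_sqrtr // ltW.
have : ln x = ln (Num.sqrt x) *+ 2 by rewrite -lnXn // sE.
have : ln (1 + (Num.sqrt x - 1)) <= Num.sqrt x - 1 by apply: le_ln1Dx; lra.
rewrite addrC subrK mulr2n => h1 ->.
rewrite -{2}sE; nra.
Qed.

(** Each [x i] is at most [n], so with [s] its square root [(x - 1)^2 = (s + 1)^2 (s - 1)^2] is at
    most [4 n] times the defect [x - 1 - ln x]; the defects add up to at most [d]. *)
Lemma amgm_stability (n : nat) (x : 'I_n -> R) (d : R) :
  (forall i, 0 < x i) -> \sum_i x i = n%:R -> - d <= \sum_i ln (x i) ->
  \sum_i x i ^+ 2 <= n%:R + 4 * n%:R * d.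
Proof.
move=> x0 xs xl.
have sq i : (x i - 1) ^+ 2 <= 4 * n%:R * (x i - 1 - ln (x i)).
  have xn : x i <= n%:R.
    by rewrite -xs (bigD1 i) //= lerDl sumr_ge0 // => j _; rewrite ltW.
  have n1 : 1 <= n%:R :> R.
    by rewrite (ler_nat R 1 n); case: n i {x0 xs xl xn} x => // -[].
  have := amgm_defect (x0 i); set s := Num.sqrt (x i).
  have s0 : 0 <= s by apply: sqrtr_ge0.
  have sE : s ^+ 2 = x i by rewrite sqr_sqrtr // ltW.
  have sb : (s + 1) ^+ 2 <= 4 * n%:R.
    have : (s - 1) ^+ 2 >= 0 by apply: sqr_ge0.
    move: sE xn n1; nra.
  move=> h; rewrite -sE.
  have -> : (s ^+ 2 - 1) ^+ 2 = (s + 1) ^+ 2 * (s - 1) ^+ 2 by ring.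
  rewrite sE; apply: ler_pM => //; exact: sqr_ge0.
have : \sum_i (x i - 1) ^+ 2 <= \sum_i 4 * n%:R * (x i - 1 - ln (x i)).
  by apply: ler_sum => i _; exact: sq.
rewrite -mulr_sumr !sumrB xs sumr_const card_ord subrr sub0r.
under eq_bigr do rewrite sqrrB1.
rewrite big_split /= sumrB sumrMnl xs sumr_const card_ord.
have : 0 <= 4 * n%:R :> R by rewrite mulr_ge0.
move: xl; nra.
Qed.

Lemma finite_lower_bound (I : finType) (P : I -> R -> Prop) :
  (forall i c c', c <= c' -> P i c' -> P i c) ->
  (forall i, exists2 c, 0 < c & P i c) -> exists2 c, 0 < c & forall i, P i c.
Proof.
move=> Pd Pe.
have /choice [f fP] : forall i, exists c, 0 < c /\ P i c.
  by move=> i; have [c] := Pe i; exists c.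
exists (\big[Num.min/1]_i f i); first by apply: lt_bigmin => // i _; case: (fP i).
move=> i; apply: Pd (proj2 (fP i)); exact: bigmin_le.
Qed.

End RealLemmas.

(** * Semistability and the lower bound on the capacity *)

Section Capacity.
Context {R : realType}.
Local Notation C := R[i].
Local Notation Re := complex.Re.

(** Fraction-free form of [dim V / n + dim W / m <= 1] for all pairs of subspaces annihilated by the
    tuple, the subspaces being row spaces of matrices of arbitrary height. *)
Definition semistable n m N (B : 'I_N -> 'M[C]_(n, m)) : Prop :=
  forall k r (V : 'M[C]_(k, n)) (W : 'M[C]_(r, m)),
    (forall l, V *m B l *m W^t* = 0) -> (\rank V * m + \rank W * n <= n * m)%N.

(** In spectral frames the trace under the logarithm of [kempf_ness] becomes a weighted sum of
    [wgt]; the same identity computes norms along the orbit. *)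
Lemma rdiag_energy n m N (s : 'M[C]_n) (t : 'M[C]_m) (a : 'rV[R]_n) (b : 'rV[R]_m)
    (A : 'I_N -> 'M[C]_(n, m)) :
  \tr (\sum_(l < N) (s^t* *m rdiag a *m s) *m A l *m (t^t* *m rdiag b *m t) *m (A l)^t*) =
  (\sum_i \sum_j a 0 i * b 0 j * wgt s t A i j)%:C.
Proof.
rewrite raddf_sum /=.
under eq_bigr => l _.
  have -> : (s^t* *m rdiag a *m s) *m A l *m (t^t* *m rdiag b *m t) *m (A l)^t* =
     s^t* *m (rdiag a *m (s *m A l *m t^t*) *m rdiag b *m (t *m (A l)^t*)).
    by rewrite !mulmxA.
  rewrite mxtrace_mulC.
  have -> : rdiag a *m (s *m A l *m t^t*) *m rdiag b *m (t *m (A l)^t*) *m s^t* =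
    rdiag a *m (s *m A l *m t^t*) *m rdiag b *m (s *m A l *m t^t*)^t*.
    by rewrite !adjmxM trmxCK !mulmxA.
  over.
rewrite RC_sum /mxtrace exchange_big /=; apply: eq_bigr => i _.
under eq_bigr do rewrite mxE.
rewrite RC_sum exchange_big /=; apply: eq_bigr => j _.
rewrite /wgt mulr_sumr RC_sum; apply: eq_bigr => l _.
rewrite mulmx_rdiag rdiag_mulmx adjmxE.
rewrite !rmorphM /= -mul_conjC_nsq; move: ((s *m A l *m t^t*) i j) => z.
by rewrite [X in X * _ = _]mulrAC !mulrA.
Qed.

Lemma unitary_rowsub n (s : 'M[C]_n) k (le : (k <= n)%N) : s \is unitarymx ->
  \rank (rowsub (widen_ord le) s) = k.
Proof.
move=> /unitarymxP su; apply: mxrank_unitary; apply/unitarymxP/matrixP => i j.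
have := congr1 (fun M : 'M[C]_n => M (widen_ord le i) (widen_ord le j)) su.
rewrite !mxE => h; rewrite [RHS](_ : _ = (widen_ord le i == widen_ord le j)%:R) // -h.
by apply: eq_bigr => c _; rewrite !mxE.
Qed.

(** If the leading block with [a.+1] rows and [b.+1] columns vanished at some unitary pair, the
    leading rows of [s] and [t] would violate semistability. Compactness turns this into a positive
    lower bound, and there are finitely many [(a, b)]. *)
Lemma semistable_blocks n m N (B : 'I_N -> 'M[C]_(n, m)) : semistable B ->
  exists2 c : R, 0 < c & forall s t, s \is unitarymx -> t \is unitarymx ->
    forall (a : 'I_n) (b : 'I_m), (n * m < a.+1 * m + b.+1 * n)%N ->
    c <= \sum_(i < n | (i <= a)%N) \sum_(j < m | (j <= b)%N) wgt s t B i j.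
Proof.
move=> Bs.
pose blk (a : 'I_n) (b : 'I_m) s t :=
  \sum_(i < n | (i <= a)%N) \sum_(j < m | (j <= b)%N) wgt s t B i j.
pose P (ab : 'I_n * 'I_m) (c : R) :=
  (n * m < ab.1.+1 * m + ab.2.+1 * n)%N ->
  forall s t, s \is unitarymx -> t \is unitarymx -> c <= blk ab.1 ab.2 s t.
have [|[a b]|c c0 cP] := @finite_lower_bound R _ P; last first.
  by exists c => // s t su tu a b ab; exact: (cP (a, b)).
- have [ab|ab] := ltnP (n * m) (a.+1 * m + b.+1 * n); last first.
    by exists 1 => //; rewrite /P /= ltnNge ab.
  have blk0 s t : 0 <= blk a b s t.
    by apply: sumr_ge0 => i _; apply: sumr_ge0 => j _; exact: wgt_ge0.
  have [|||c c0 cP] := @unitary_pair_min R n m (blk a b).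
  + move=> T F G Fc Gc; apply: continuous_sumR => i; apply: continuous_sumR => j.
    apply: continuous_sumR => l; apply: nsq_continuous.
    by apply: mcontM; [apply: mcontM => //; exact: mcont_cst|exact: mcontJ].
  + exact: blk0.
  + move=> s t su tu; rewrite lt_neqAle blk0 andbT eq_sym; apply/negP => blk00.
    have := Bs _ _ (rowsub (widen_ord (ltn_ord a)) s) (rowsub (widen_ord (ltn_ord b)) t).
    rewrite !unitary_rowsub // leqNgt ab => /(_ _)/negP; apply => // l.
    apply/matrixP => i j; rewrite [RHS]mxE.
    move: blk00; rewrite psumr_eq0; last first.
      by move=> k _; apply: sumr_ge0 => k' _; exact: wgt_ge0.
    move=> /allP /(_ (widen_ord (ltn_ord a) i) (mem_index_enum _)) /implyP.
    rewrite /= -ltnS ltn_ord => /(_ isT); rewrite psumr_eq0; last first.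
      by move=> k _; exact: wgt_ge0.
    move=> /allP /(_ (widen_ord (ltn_ord b) j) (mem_index_enum _)) /implyP.
    rewrite /= -ltnS ltn_ord => /(_ isT) /wgt_eq0P /(_ l) <-.
    rewrite !mxE; apply: eq_bigr => k _; rewrite !mxE; congr (_ * _).
    by apply: eq_bigr => k' _; rewrite !mxE.
  + by exists c => // _.
- move=> ab c c' cc' Pc' h s t su tu; apply: le_trans cc' _; exact: Pc'.
Qed.

End Capacity.

Section NearMinimizer.
Context {R : realType}.
Local Notation C := R[i].
Local Notation Re := complex.Re.

Lemma ln_prod (I : Type) (r : seq I) (P : pred I) (f : I -> R) :
  (forall i, P i -> 0 < f i) ->
  ln (\prod_(i <- r | P i) f i) = \sum_(i <- r | P i) ln (f i).
Proof.
move=> f0; elim: r => [|i r IH]; first by rewrite !big_nil ln1.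
rewrite !big_cons; case: ifP => // Pi.
by rewrite lnM ?IH // posrE ?f0 // prodr_gt0.
Qed.

Lemma det_adj n (g : 'M[C]_n) : \det (g^t*) = conjc (\det g).
Proof. by rewrite det_map_mx det_tr. Qed.

Lemma nsq_det_unit n (g : 'M[C]_n) : g \in unitmx -> 0 < nsq (\det g).
Proof. by rewrite unitmxE unitfE nsq_gt0. Qed.

Lemma nsq1 : nsq (1 : C) = 1.
Proof. by rewrite /nsq /= expr1n expr0n addr0. Qed.

Lemma nsq_det_unitary n (s : 'M[C]_n) : s \is unitarymx -> nsq (\det s) = 1.
Proof.
move=> /unitarymxP /(congr1 determinant); rewrite det_mulmx det_adj mul_conjC_nsq det1.
by move=> /(congr1 (@complex.Re R)).
Qed.

Lemma det_rdiag n (a : 'rV[R]_n) : \det (rdiag a) = (\prod_i a 0 i)%:C.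
Proof. by rewrite det_diag rmorph_prod; apply: eq_bigr => i _; rewrite !mxE. Qed.

Lemma posdef_spectral n (g : 'M[C]_n) : g \in unitmx ->
  exists (s : 'M[C]_n) (a : 'rV[R]_n),
    [/\ s \is unitarymx, g^t* *m g = s^t* *m rdiag a *m s,
        forall i j : 'I_n, (i <= j)%N -> a 0 j <= a 0 i,
        forall i, 0 < a 0 i &
        \sum_i ln (a 0 i) = ln (nsq (\det g))].
Proof.
move=> gu; have Gh : g^t* *m g \is hermsymmx by apply/hermsymmxP; rewrite adjmxM trmxCK.
have [s [a [su GE aS]]] := herm_spectral (r := >=%O) ge_total ge_trans lexx Gh.
have a0 i : 0 <= a 0 i.
  have : (s *m (g^t* *m g) *m s^t*) i i = (a 0 i)%:C.
    rewrite GE !mulmxA (unitarymxP su) mul1mx -mulmxA (unitarymxP su) mulmx1.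
    by rewrite rdiagE eqxx.
  have -> : s *m (g^t* *m g) *m s^t* = (s *m g^t*) *m (s *m g^t*)^t*.
    by rewrite adjmxM trmxCK !mulmxA.
  rewrite mxE => aE; have -> : a 0 i = \sum_j nsq ((s *m g^t*) i j).
    apply: (@complexI R); rewrite -aE RC_sum; apply: eq_bigr => j _.
    by rewrite adjmxE mul_conjC_nsq.
  by apply: sumr_ge0 => j _; exact: nsq_ge0.
have detE : \prod_i a 0 i = nsq (\det g).
  apply: (@complexI R); have := congr1 determinant GE.
  rewrite !det_mulmx !det_adj mulrC mul_conjC_nsq => ->.
  by rewrite mulrAC [_ * \det s]mulrC mul_conjC_nsq nsq_det_unitary // mul1r det_rdiag.
have apos i : 0 < a 0 i.
  rewrite lt_neqAle a0 andbT eq_sym; apply/eqP => ai0.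
  have := nsq_det_unit gu; rewrite -detE (bigD1 i) //= ai0 mul0r ltxx //.
exists s, a; split => //.
by rewrite -ln_prod // detE.
Qed.

Lemma tuple_normsq_gram n m N (B : 'I_N -> 'M[C]_(n, m)) g h :
  (tuple_normsq (tuple_act g h B))%:C =
  \tr (\sum_(l < N) (g^t* *m g) *m B l *m (h^t* *m h) *m (B l)^t*).
Proof.
rewrite RC_sum raddf_sum; apply: eq_bigr => l _ /=.
rewrite -fnormsq_trC /tuple_act !adjmxM trmxCK !mulmxA mxtrace_mulC.
by rewrite !mulmxA.
Qed.

(** Invariant under scaling of [g] and of [h]; its infimum over invertible pairs is the logarithm of
    the capacity of [B]. *)
Definition logcap n m N (B : 'I_N -> 'M[C]_(n, m)) g h : R :=
  ln (tuple_normsq (tuple_act g h B)) - n%:R^-1 * ln (nsq (\det g))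
                                      - m%:R^-1 * ln (nsq (\det h)).

(** Let [a], [b] be the nonincreasing eigenvalues of [g^t* *m g] and [h^t* *m h]. Some [(i, j)] has
    [ln a_i + ln b_j] at least the sum of the two averages, while its leading block is too large for
    semistability and so carries mass at least [c]. On that block the eigenvalues are at least [a_i]
    and [b_j], so the squared norm is at least [a_i b_j c]. *)
Lemma semistable_logcap n m N (B : 'I_N -> 'M[C]_(n, m)) :
  (0 < n)%N -> (0 < m)%N -> semistable B ->
  exists c, forall g h, g \in unitmx -> h \in unitmx ->
    0 < tuple_normsq (tuple_act g h B) /\ c <= logcap B g h.
Proof.
move=> n0 m0 /semistable_blocks [c c0 cP]; exists (ln c) => g h gu hu.
have [s [a [su GE aS a0 aD]]] := posdef_spectral gu.
have [t [b [tu HE bS b0 bD]]] := posdef_spectral hu.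
have := tuple_normsq_gram B g h; rewrite GE HE rdiag_energy => /(@complexI R) TE.
have [i [j [ij avg]]] :=
  exists_above_average (fun i => ln (a 0 i)) (fun j => ln (b 0 j)) n0 m0.
have abc : 0 < a 0 i * b 0 j * c by rewrite !mulr_gt0.
have Tge : a 0 i * b 0 j * c <= tuple_normsq (tuple_act g h B).
  rewrite TE; apply: (@le_trans _ _ (\sum_(i' < n | (i' <= i)%N)
    \sum_(j' < m | (j' <= j)%N) a 0 i' * b 0 j' * wgt s t B i' j')).
    apply: (@le_trans _ _ (a 0 i * b 0 j * \sum_(i' < n | (i' <= i)%N)
      \sum_(j' < m | (j' <= j)%N) wgt s t B i' j')).
      by rewrite ler_pM2l ?mulr_gt0 //; exact: cP.
    rewrite mulr_sumr; apply: ler_sum => i' i'i; rewrite mulr_sumr.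
    apply: ler_sum => j' j'j; apply: ler_wpM2r; first exact: wgt_ge0.
    by apply: ler_pM; [exact/ltW|exact/ltW|exact: aS|exact: bS].
  rewrite [leRHS](bigID (fun i' : 'I_n => (i' <= i)%N)) /=.
  rewrite ler_wpDr //.
    by do 2!(apply: sumr_ge0 => ? _); rewrite !mulr_ge0 ?wgt_ge0 // ltW.
  apply: ler_sum => i' _; rewrite [leRHS](bigID (fun j' : 'I_m => (j' <= j)%N)) /=.
  by rewrite ler_wpDr // sumr_ge0 // => ? _; rewrite !mulr_ge0 ?wgt_ge0 // ltW.
have T0 := lt_le_trans abc Tge; split=> //.
rewrite /logcap -aD -bD.
move: Tge; rewrite -ler_ln ?posrE // !lnM ?posrE ?mulr_gt0 //.
lra.
Qed.

Lemma near_minimizer n m N (B : 'I_N -> 'M[C]_(n, m)) d :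
  (0 < n)%N -> (0 < m)%N -> semistable B -> 0 < d ->
  exists g h, [/\ g \in unitmx, h \in unitmx &
    forall g' h', g' \in unitmx -> h' \in unitmx -> logcap B g h <= logcap B g' h' + d].
Proof.
move=> n0 m0 /(semistable_logcap n0 m0) [c cP] d0.
pose E : set R := [set x | exists g h, [/\ g \in unitmx, h \in unitmx & x = logcap B g h]]%classic.
have lbE : has_lbound E.
  by exists c => _ [g [h [gu hu ->]]]; case: (cP g h gu hu).
have E0 : nonempty E by exists (logcap B 1%:M 1%:M), 1%:M, 1%:M; rewrite !unitmx1.
have [_ [g [h [gu hu ->]]] lt] := inf_adherent d0 (conj E0 lbE).
exists g, h; split => // g' h' g'u h'u; apply/ltW; apply: lt_le_trans lt _.
by rewrite lerD2r; apply: ge_inf => //; exists g', h'.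
Qed.

(* One Sinkhorn step normalises the row Gram matrix and lowers [logcap] by the
   AM-GM defect of its eigenvalues, which at a near-minimiser is at most [d]. *)
Lemma near_minimizer_row n m N (B : 'I_N -> 'M[C]_(n, m)) d g h :
  (0 < n)%N -> (0 < m)%N -> semistable B -> g \in unitmx -> h \in unitmx ->
  (forall g', g' \in unitmx -> logcap B g h <= logcap B g' h + d) ->
  fnormsq (row_gram (tuple_act g h B)) <=
    (tuple_normsq (tuple_act g h B)) ^+ 2 * (n%:R^-1 + 4 * d).
Proof.
move=> n0 m0 Bs gu hu gmin; set D := tuple_act g h B; set T := tuple_normsq D.
have [c cP] := semistable_logcap n0 m0 Bs.
have [T0 _] := cP g h gu hu; rewrite -/D -/T in T0.
have Dh : row_gram D \is hermsymmx by apply/hermsymmxP; exact: row_gram_adj.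
have [u [r [uu DE _]]] := herm_spectral (r := >=%O) ge_total ge_trans lexx Dh.
have rE i : r 0 i = \sum_j wgt u 1%:M D i j.
  apply: (@complexI R); rewrite -row_gram_diag row_gram_act; last first.
    by apply/unitarymxP; rewrite trmx1 map_mx1 mulmx1.
  rewrite DE !mulmxA (unitarymxP uu) mul1mx -mulmxA (unitarymxP uu) mulmx1.
  by rewrite rdiagE eqxx.
have r0 i : 0 < r 0 i.
  rewrite lt_neqAle rE sumr_ge0 => [|j _]; last exact: wgt_ge0.
  rewrite andbT eq_sym psumr_eq0 => [|j _]; last exact: wgt_ge0.
  (* A zero row would give an annihilated pair of ranks [1] and [m], and [1 * m + m * n] exceeds
     [n * m]. *)
  apply/negP => /allP w0.
  have rk1 : \rank (row i (u *m g)) = 1%N.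
    have ugu : u *m g \in unitmx by rewrite unitmx_mul gu andbT unitarymx_unit.
    rewrite rank_rV rowE; apply/eqP; rewrite eqb1; apply/eqP => ug0.
    have := congr1 (mulmx^~ (invmx (u *m g))) ug0; rewrite mulmxK // mul0mx.
    by move=> /matrixP /(_ 0 i); rewrite !mxE !eqxx => /eqP; rewrite oner_eq0.
  have := Bs 1%N m (row i (u *m g)) 1%:M.
  rewrite rk1 mxrank1 mul1n => H.
  suff /H : forall l, row i (u *m g) *m B l *m 1%:M^t* = 0 by lia.
  move=> l; rewrite trmx1 map_mx1 mulmx1.
  have hu' : h^t* \in unitmx by rewrite map_unitmx unitmx_tr.
  rewrite -[LHS](mulmxK hu'); apply/matrixP => a b; rewrite ord1 {a}.
  suff -> : row i (u *m g) *m B l *m h^t* = 0 by rewrite mul0mx.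
  apply/rowP => j; have /implyP/(_ isT)/wgt_eq0P/(_ l) := w0 j (mem_index_enum _).
  rewrite trmx1 map_mx1 mulmx1 /D /tuple_act !mulmxA => w00.
  by rewrite [RHS]mxE -[RHS]w00 -!row_mul [LHS]mxE.
have Tr : T = \sum_i r 0 i.
  by apply: (@complexI R); rewrite -row_gram_tr DE conj_rdiag_tr.
(* In the eigenbasis of the row Gram matrix, the Sinkhorn step divides row [i] by the square root of
   its mass: every row gets mass one, and the total becomes [n]. *)
pose e : 'rV[R]_n := \row_i (Num.sqrt (r 0 i))^-1.
have e2 i : e 0 i ^+ 2 = (r 0 i)^-1.
  by rewrite mxE exprVn sqr_sqrtr // ltW.
have e0 i : 0 < e 0 i by rewrite mxE invr_gt0 sqrtr_gt0.
have eu : rdiag e \in unitmx.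
  rewrite unitmxE unitfE det_rdiag; apply/eqP => /(@complexI R) /eqP.
  by rewrite gt_eqF // prodr_gt0.
have := gmin (rdiag e *m (u *m g)).
rewrite !unitmx_mul eu gu andbT unitarymx_unit // => /(_ isT).
rewrite /logcap.
have -> : tuple_act (rdiag e *m (u *m g)) h B = tuple_act (rdiag e *m u) 1%:M D.
  by rewrite tuple_actM mul1mx mulmxA.
have -> : tuple_normsq (tuple_act (rdiag e *m u) 1%:M D) = n%:R.
  rewrite tuple_normsqE (eq_bigr (fun=> 1)); last first.
    move=> i _; transitivity (e 0 i ^+ 2 * r 0 i); last by rewrite e2 mulVf // gt_eqF.
    rewrite rE mulr_sumr; apply: eq_bigr => j _; rewrite /wgt mulr_sumr.
    by apply: eq_bigr => l _; rewrite -!mulmxA rdiag_mulmx !mulmxA nsqM nsqR.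
  by rewrite sumr_const card_ord.
have -> : nsq (\det (rdiag e *m (u *m g))) = (\prod_i e 0 i ^+ 2) * nsq (\det g).
  by rewrite 2!det_mulmx 2!nsqM (nsq_det_unitary uu) mul1r det_rdiag nsqR prodrXl.
rewrite lnM ?posrE ?nsq_det_unit //; last by apply: prodr_gt0 => i _; rewrite exprn_gt0.
rewrite ln_prod => [|i _]; last by rewrite exprn_gt0.
under [X in _ <= _ - _ * (X + _) - _ + _]eq_bigr do rewrite e2 lnV ?posrE //.
rewrite sumrN -/D -/T => lnT.
have nR : 0 < n%:R :> R by rewrite ltr0n.
(* The eigenvalues are rescaled to sum to [n], as [amgm_stability] requires; the defect is [n d]
   because [logcap] carries the factor [1 / n]. *)
have [] : [/\ forall i, 0 < r 0 i * (n%:R / T), \sum_i r 0 i * (n%:R / T) = n%:R &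
   - (n%:R * d) <= \sum_i ln (r 0 i * (n%:R / T))].
  split.
  - by move=> i; rewrite mulr_gt0 // divr_gt0.
  - by rewrite -mulr_suml -Tr mulrC divfK // gt_eqF.
  - under eq_bigr do rewrite lnM ?posrE ?divr_gt0 //.
    rewrite big_split /= sumr_const card_ord ln_div ?posrE // -[(_ - _) *+ n]mulr_natl.
    have : n%:R * (n%:R^-1 * \sum_i ln (r 0 i)) = \sum_i ln (r 0 i).
      by rewrite mulVKf // gt_eqF.
    move: lnT; set a := ln T; set S := \sum_i _; set q := n%:R^-1 * S.
    rewrite mulrDr mulrN -/q => lnT <-.
    have : 0 <= n%:R * (ln n%:R + q + d - a).
      by apply: mulr_ge0; [exact: ltW|lra].
    lra.
move=> x0 xs xl; have := amgm_stability x0 xs xl.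
rewrite DE conj_rdiag_fnormsq //.
under eq_bigr do rewrite exprMn.
rewrite -mulr_suml => st.
have Tn : T != 0 by rewrite gt_eqF.
have nn : n%:R != 0 :> R by rewrite gt_eqF.
(* Undoing the rescaling turns [n + 4 n (n d)] into [T^2 (1/n + 4 d)]. *)
have := ler_wpM2r (sqr_ge0 (T / n%:R)) st.
have -> : (\sum_i r 0 i ^+ 2) * (n%:R / T) ^+ 2 * (T / n%:R) ^+ 2 = \sum_i r 0 i ^+ 2.
  by field; rewrite Tn nn.
move=> /le_trans; apply.
rewrite le_eqVlt; apply/orP; left; apply/eqP; field; exact: nn.
Qed.

End NearMinimizer.

(** * Approximation by block scaling *)

Section GramApproximation.
Context {R : realType}.
Local Notation C := R[i].

(** Divided by [tuple_normsq B ^+ 2], it exceeds the squared norm of the moment map by the constant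
    [1/n + 1/m]; see [pair_normsq_moment]. *)
Definition gram_normsq n m N (B : 'I_N -> 'M[C]_(n, m)) : R :=
  fnormsq (row_gram B) + fnormsq (col_gram B).

(* Along the orbit of [B], [gram_normsq / tuple_normsq ^ 2] comes arbitrarily
   close to [1 / c]; representatives are scaled so that both are close to [c]. *)
Definition approx_norm n m N (B : 'I_N -> 'M[C]_(n, m)) (c : R) : Prop :=
  forall e, 0 < e -> exists g h, [/\ g \in unitmx, h \in unitmx,
    c <= tuple_normsq (tuple_act g h B) & gram_normsq (tuple_act g h B) <= c + e].

Lemma adjmx0 n m : (0 : 'M[C]_(n, m))^t* = 0.
Proof. by apply/matrixP => i j; rewrite !mxE rmorph0. Qed.

(** Adjoints exchange rows and columns, so the row estimate also serves the columns, at the same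
    near-minimiser. *)
Definition adj_tuple n m N (B : 'I_N -> 'M[C]_(n, m)) : 'I_N -> 'M[C]_(m, n) :=
  fun l => (B l)^t*.

Lemma adj_tuple_act n m N (B : 'I_N -> 'M[C]_(n, m)) g h :
  tuple_act h g (adj_tuple B) = adj_tuple (tuple_act g h B).
Proof. by apply/funext => l; rewrite /tuple_act /adj_tuple !adjmxM trmxCK !mulmxA. Qed.

Lemma row_gram_adj_tuple n m N (B : 'I_N -> 'M[C]_(n, m)) :
  row_gram (adj_tuple B) = col_gram B.
Proof. by apply: eq_bigr => l _; rewrite /adj_tuple trmxCK. Qed.

Lemma fnormsq_adj n m (M : 'M[C]_(n, m)) : fnormsq (M^t*) = fnormsq M.
Proof.
rewrite !fnormsqE exchange_big; apply: eq_bigr => i _; apply: eq_bigr => j _.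
by rewrite adjmxE nsqJ.
Qed.

Lemma tuple_normsq_adj n m N (B : 'I_N -> 'M[C]_(n, m)) :
  tuple_normsq (adj_tuple B) = tuple_normsq B.
Proof. by apply: eq_bigr => l _; exact: fnormsq_adj. Qed.

Lemma semistable_adj n m N (B : 'I_N -> 'M[C]_(n, m)) :
  semistable B -> semistable (adj_tuple B).
Proof.
move=> Bs k r V W VW; have := Bs r k W V.
have H l : W *m B l *m V^t* = 0.
  transitivity ((V *m adj_tuple B l *m W^t*)^t*); last by rewrite VW adjmx0.
  by rewrite /adj_tuple !adjmxM !trmxCK mulmxA.
by move=> /(_ H); lia.
Qed.

Lemma logcap_adj n m N (B : 'I_N -> 'M[C]_(n, m)) g h :
  logcap (adj_tuple B) h g = logcap B g h.
Proof. by rewrite /logcap adj_tuple_act tuple_normsq_adj addrAC. Qed.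

Lemma near_minimizer_gram n m N (B : 'I_N -> 'M[C]_(n, m)) d :
  (0 < n)%N -> (0 < m)%N -> semistable B -> 0 < d ->
  exists g h, [/\ g \in unitmx, h \in unitmx, 0 < tuple_normsq (tuple_act g h B) &
    gram_normsq (tuple_act g h B) <=
    (tuple_normsq (tuple_act g h B)) ^+ 2 * (n%:R^-1 + m%:R^-1 + 8 * d)].
Proof.
move=> n0 m0 Bs d0; have [g [h [gu hu gh]]] := near_minimizer n0 m0 Bs d0.
have [c cP] := semistable_logcap n0 m0 Bs.
exists g, h; split => //; first by case: (cP g h gu hu).
have r1 : fnormsq (row_gram (tuple_act g h B)) <=
    (tuple_normsq (tuple_act g h B)) ^+ 2 * (n%:R^-1 + 4 * d).
  by apply: near_minimizer_row => // g' g'u; exact: gh.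
have r2 : fnormsq (row_gram (tuple_act h g (adj_tuple B))) <=
    (tuple_normsq (tuple_act h g (adj_tuple B))) ^+ 2 * (m%:R^-1 + 4 * d).
  apply: near_minimizer_row => //; first exact: semistable_adj.
  by move=> g' g'u; rewrite !logcap_adj; exact: gh.
rewrite adj_tuple_act row_gram_adj_tuple tuple_normsq_adj in r2.
rewrite /gram_normsq; move: r1 r2; lra.
Qed.

Lemma row_gramZ n m N (B : 'I_N -> 'M[C]_(n, m)) (z : C) g h :
  row_gram (tuple_act (z *: g) h B) = (nsq z)%:C *: row_gram (tuple_act g h B).
Proof.
rewrite /row_gram scaler_sumr; apply: eq_bigr => l _; rewrite /tuple_act.
by rewrite -!scalemxAl adjmxZ -scalemxAr scalerA mul_conjC_nsq.
Qed.

Lemma col_gramZ n m N (B : 'I_N -> 'M[C]_(n, m)) (z : C) g h :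
  col_gram (tuple_act (z *: g) h B) = (nsq z)%:C *: col_gram (tuple_act g h B).
Proof.
rewrite /col_gram scaler_sumr; apply: eq_bigr => l _; rewrite /tuple_act.
by rewrite -!scalemxAl adjmxZ -scalemxAl -scalemxAr scalerA mulrC mul_conjC_nsq.
Qed.

Lemma tuple_normsqZ n m N (B : 'I_N -> 'M[C]_(n, m)) (z : C) g h :
  tuple_normsq (tuple_act (z *: g) h B) = nsq z * tuple_normsq (tuple_act g h B).
Proof.
rewrite /tuple_normsq mulr_sumr; apply: eq_bigr => l _; rewrite /tuple_act.
by rewrite -!scalemxAl fnormsqZ.
Qed.

Lemma gram_normsqZ n m N (B : 'I_N -> 'M[C]_(n, m)) (z : C) g h :
  gram_normsq (tuple_act (z *: g) h B) = nsq z ^+ 2 * gram_normsq (tuple_act g h B).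
Proof. by rewrite /gram_normsq row_gramZ col_gramZ !fnormsqZ nsqR mulrDr. Qed.

Lemma scalar_unitmx n (z : C) (g : 'M[C]_n) : z != 0 -> g \in unitmx -> z *: g \in unitmx.
Proof. by move=> z0 gu; rewrite unitmxZ // unitfE. Qed.

(** The constant [c] is the inverse of [1/n + 1/m], the value of [gram_normsq / tuple_normsq ^ 2] at
    a doubly balanced tuple. Once the squared norm is scaled to [c], the bound [c^2 (1/c + 8 d)]
    equals [c + e] for [d = e / (8 c^2)]. *)
Lemma semistable_approx n m N (B : 'I_N -> 'M[C]_(n, m)) :
  (0 < n)%N -> (0 < m)%N -> semistable B ->
  approx_norm B ((n * m)%:R / (n + m)%:R).
Proof.
move=> n0 m0 Bs e e0; set c := _ / _.
have nR : 0 < n%:R :> R by rewrite ltr0n.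
have mR : 0 < m%:R :> R by rewrite ltr0n.
have cE : c = n%:R * m%:R / (n%:R + m%:R) by rewrite /c natrM natrD.
have c0 : 0 < c by rewrite cE divr_gt0 ?mulr_gt0 ?addr_gt0.
have d0 : 0 < e / (8 * c ^+ 2) by rewrite divr_gt0 // mulr_gt0 // exprn_gt0.
have [g [h [gu hu T0 gh]]] := near_minimizer_gram n0 m0 Bs d0.
set T := tuple_normsq _ in T0 gh.
pose z : C := (Num.sqrt (c / T))%:C.
have zE : nsq z = c / T by rewrite nsqR sqr_sqrtr // ltW // divr_gt0.
have z0 : z != 0 by rewrite -nsq_gt0 zE divr_gt0.
exists (z *: g), h; split; [exact: scalar_unitmx|exact: hu| |].
  by rewrite tuple_normsqZ -/T zE divfK // gt_eqF.
rewrite gram_normsqZ zE; apply: le_trans (ler_wpM2l (sqr_ge0 _) gh) _.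
rewrite le_eqVlt; apply/orP; left; apply/eqP.
have -> : (c / T) ^+ 2 * (T ^+ 2 * (n%:R^-1 + m%:R^-1 + 8 * (e / (8 * c ^+ 2)))) =
   c * (c * (n%:R^-1 + m%:R^-1)) + e.
  by field; rewrite !gt_eqF.
have -> : c * (n%:R^-1 + m%:R^-1) = 1.
  by rewrite cE; field; rewrite !gt_eqF // addr_gt0.
by rewrite mulr1.
Qed.

Lemma fnormsq_block n1 n2 m1 m2 (P : 'M[C]_(n1, m1)) (Q : 'M[C]_(n1, m2))
    (S : 'M[C]_(n2, m1)) (T : 'M[C]_(n2, m2)) :
  fnormsq (block_mx P Q S T) = fnormsq P + fnormsq Q + fnormsq S + fnormsq T.
Proof.
rewrite !fnormsqE big_split_ord /= -addrA; congr (_ + _); rewrite -big_split /=;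
  apply: eq_bigr => i _; rewrite big_split_ord /=; congr (_ + _);
  apply: eq_bigr => j _.
- by rewrite block_mxEul.
- by rewrite block_mxEur.
- by rewrite block_mxEdl.
- by rewrite block_mxEdr.
Qed.

Lemma sum_block_diag n1 n2 m1 m2 (I : Type) (r : seq I) (F : I -> 'M[C]_(n1, m1))
    (G : I -> 'M[C]_(n2, m2)) :
  \sum_(l <- r) block_mx (F l) 0 0 (G l) =
  block_mx (\sum_(l <- r) F l) 0 0 (\sum_(l <- r) G l).
Proof.
elim: r => [|l r IH]; first by rewrite !big_nil block_mx0.
by rewrite !big_cons IH add_block_mx !addr0.
Qed.

Lemma adj_block n1 n2 m1 m2 (P : 'M[C]_(n1, m1)) (Q : 'M[C]_(n1, m2))
    (S : 'M[C]_(n2, m1)) (T : 'M[C]_(n2, m2)) :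
  (block_mx P Q S T)^t* = block_mx (P^t*) (S^t*) (Q^t*) (T^t*).
Proof. by rewrite tr_block_mx map_block_mx. Qed.

Lemma gram_normsq_block_diag n1 n2 m1 m2 N (P : 'I_N -> 'M[C]_(n1, m1))
    (S : 'I_N -> 'M[C]_(n2, m2)) :
  gram_normsq (fun l => block_mx (P l) 0 0 (S l)) = gram_normsq P + gram_normsq S.
Proof.
rewrite /gram_normsq.
have -> : row_gram (fun l => block_mx (P l) 0 0 (S l)) = block_mx (row_gram P) 0 0 (row_gram S).
  rewrite /row_gram -sum_block_diag; apply: eq_bigr => l _.
  by rewrite adj_block !adjmx0 mulmx_block !mulmx0 !mul0mx !addr0 !add0r.
have -> : col_gram (fun l => block_mx (P l) 0 0 (S l)) = block_mx (col_gram P) 0 0 (col_gram S).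
  rewrite /col_gram -sum_block_diag; apply: eq_bigr => l _.
  by rewrite adj_block !adjmx0 mulmx_block !mulmx0 !mul0mx !addr0 !add0r.
by rewrite !fnormsq_block !fnormsq0; ring.
Qed.

Lemma gram_normsq_continuous (T : topologicalType) n m N (F : 'I_N -> T -> 'M[C]_(n, m)) :
  (forall l, mcont (F l)) -> continuous (fun x => gram_normsq (fun l => F l x)).
Proof.
move=> Fc; apply: continuous_addR; apply: fnormsq_continuous; apply: mcont_sum => l.
  by apply: mcontM => //; exact: mcontJ.
by apply: mcontM => //; exact: mcontJ.
Qed.

Lemma mcontZR n m (M : 'M[C]_(n, m)) : mcont (fun x : R => x%:C *: M).
Proof.
move=> i j; under eq_fun do rewrite mxE; apply: ccontM; last exact: ccont_cst.
by split => x; [exact: cvg_id|exact: cvg_cst].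
Qed.

(* Conjugating by the one-parameter group acting with weights on the two
   diagonal blocks scales the off-diagonal block by an arbitrarily small [x]. *)
Lemma approx_norm_block n1 n2 m1 m2 N (P : 'I_N -> 'M[C]_(n1, m1))
    (Q : 'I_N -> 'M[C]_(n1, m2)) (S : 'I_N -> 'M[C]_(n2, m2)) c1 c2 :
  approx_norm P c1 -> approx_norm S c2 ->
  approx_norm (fun l => block_mx (P l) (Q l) 0 (S l)) (c1 + c2).
Proof.
move=> Pa Sa e e0; have e3 : 0 < e / 3 by rewrite divr_gt0.
have [g1 [h1 [g1u h1u T1 G1]]] := Pa _ e3.
have [g2 [h2 [g2u h2u T2 G2]]] := Sa _ e3.
pose D x l := block_mx (tuple_act g1 h1 P l) (x%:C *: (g1 *m Q l *m h2^t*))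
                       0 (tuple_act g2 h2 S l).
have Dc l : mcont (fun x => D x l).
  rewrite (_ : (fun x => D x l) = fun x => D 0 l + x%:C *: block_mx 0 (g1 *m Q l *m h2^t*) 0 0).
    by apply: mcontD; [exact: mcont_cst|exact: mcontZR].
  by apply/funext => x; rewrite /D scale_block_mx add_block_mx !scaler0 !addr0 scale0r add0r.
have Gc := gram_normsq_continuous Dc.
have G0 : gram_normsq (D 0) = gram_normsq (tuple_act g1 h1 P) + gram_normsq (tuple_act g2 h2 S).
  rewrite -gram_normsq_block_diag; congr (gram_normsq _).
  by apply/funext => l; rewrite /D scale0r.
(* At [x = 0] the tuple is block diagonal, but invertibility of the acting matrices asks for
   [x > 0]; continuity at zero supplies one. *)
have [x x0 Gx] : exists2 x : R, 0 < x & gram_normsq (D x) <= gram_normsq (D 0) + e / 3.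
  have /cvgrPdist_le /(_ _ e3) /nbhs_ballP [r /= r0 rP] := Gc 0.
  exists (r / 2); first by rewrite divr_gt0.
  have := rP (r / 2); rewrite /ball /= sub0r normrN gtr0_norm ?divr_gt0 //.
  have -> : r / 2 < r by rewrite ltr_pdivrMr // ltr_pMr // ltr1n.
  by move=> /(_ isT); rewrite ler_distlC => /andP[].
(* The weights [(1, 1/x)] on the left and [(1, x)] on the right cancel on the lower diagonal block
   and leave the factor [x] on the upper right one. *)
exists (block_mx g1 0 0 ((x^-1)%:C *: g2)), (block_mx h1 0 0 (x%:C *: h2)).
have xC : (x%:C : C) != 0 by apply/eqP => /(@complexI R) /eqP; rewrite gt_eqF.
have xVC : ((x^-1)%:C : C) != 0.
  by apply/eqP => /(@complexI R) /eqP; rewrite gt_eqF // invr_gt0.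
have -> : tuple_act (block_mx g1 0 0 ((x^-1)%:C *: g2)) (block_mx h1 0 0 (x%:C *: h2))
   (fun l => block_mx (P l) (Q l) 0 (S l)) = D x.
  apply/funext => l; rewrite /tuple_act adj_block !adjmx0 adjmxZ conjC_RC !mulmx_block.
  rewrite !(mulmx0, mul0mx, addr0, add0r) -!scalemxAl -!scalemxAr.
  by rewrite scalerA -rmorphM /= mulVf ?gt_eqF // scale1r.
split.
- by rewrite unitmxE det_ublock unitrM -!unitmxE g1u; apply: scalar_unitmx.
- by rewrite unitmxE det_ublock unitrM -!unitmxE h1u; apply: scalar_unitmx.
- apply: le_trans (lerD T1 T2) _; rewrite /tuple_normsq -big_split /=.
  apply: ler_sum => l _; rewrite /D fnormsq_block fnormsq0 addr0 lerD2r.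
  by rewrite lerDl fnormsq_ge0.
apply: le_trans Gx _; rewrite G0; apply: le_trans (lerD (lerD G1 G2) (lexx _)) _.
by clear; move: c1 c2 e => c1 c2 e; lra.
Qed.

End GramApproximation.

(** * The Kempf-Ness function at infinity *)

Section KempfNessAtInfinity.
Context {R : realType}.
Local Notation C := R[i].
Local Notation Re := complex.Re.
Local Notation Im := complex.Im.

Lemma exp_combination_cvg n (r a : 'I_n -> R) :
  limn (series (fun k => \sum_(c < n) r c * (a c ^+ k) / k`!%:R)) =
  \sum_(c < n) r c * expR (a c).
Proof.
have -> : series (fun k => \sum_(c < n) r c * (a c ^+ k) / k`!%:R) =
    fun N => \sum_(c < n) r c * series (exp_coeff (a c)) N.
  apply/funext => N; rewrite /series /= exchange_big /=; apply: eq_bigr => c _.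
  by rewrite mulr_sumr; apply: eq_bigr => k _; rewrite mulrA.
apply: cvg_lim => //.
elim: (index_enum _) => [|c l IH].
  by under eq_fun do rewrite big_nil; rewrite big_nil; exact: cvg_cst.
under eq_fun do rewrite big_cons; rewrite big_cons; apply: cvgD; last exact: IH.
by apply: cvgM; [exact: cvg_cst|exact: is_cvg_series_exp_coeff].
Qed.

Lemma conj_rdiagX n (s : 'M[C]_n) (a : 'rV[R]_n) k : s \is unitarymx ->
  (s^t* *m rdiag a *m s) ^+ k = s^t* *m rdiag (map_mx (fun x => x ^+ k) a) *m s.
Proof.
move=> su; elim: k => [|k IH].
  rewrite expr0 (_ : rdiag _ = 1%:M) ?mulmx1 ?unitary_adjK //.
  by apply/matrixP => i j; rewrite rdiagE !mxE expr0.
rewrite exprS IH -[_ * _]/(_ *m _) !mulmxA; congr (_ *m s).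
rewrite -(mulmxA _ s) (unitarymxP su) mulmx1 -mulmxA; congr (_ *m _).
apply/matrixP => i j; rewrite rdiag_mulmx !rdiagE !mxE exprS.
by case: eqP => _; rewrite ?mulr1n ?mulr0n ?mulr0 // rmorphM.
Qed.

Lemma conj_rdiag_entry n (s : 'M[C]_n) (a : 'rV[R]_n) i j :
  (s^t* *m rdiag a *m s) i j = \sum_c (a 0 c)%:C * (conjc (s c i) * s c j).
Proof.
by rewrite mxE; apply: eq_bigr => c _; rewrite mulmx_rdiag adjmxE mulrAC mulrC.
Qed.

(** Each entry of the [k]-th power is a fixed combination of the [k]-th powers of the eigenvalues,
    so the entrywise series of [expmx] are combinations of scalar exponential series. *)
Lemma expmx_conj_rdiag n (s : 'M[C]_n) (a : 'rV[R]_n) : s \is unitarymx ->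
  expmx (s^t* *m rdiag a *m s) = s^t* *m rdiag (map_mx expR a) *m s.
Proof.
move=> su; apply/matrixP => i j; rewrite conj_rdiag_entry mxE.
pose u c := conjc (s c i) * s c j.
apply/eqP; rewrite eq_complex; apply/andP; split; apply/eqP.
  rewrite [RHS]Re_sum /=; under [RHS]eq_bigr do rewrite ReZ mxE mulrC.
  rewrite -exp_combination_cvg; congr (limn (series _)); apply/funext => k.
  rewrite conj_rdiagX // conj_rdiag_entry Re_sum mulr_suml; apply: eq_bigr => c _.
  by rewrite ReZ mxE [X in X / _]mulrC.
rewrite [RHS]Im_sum /=; under [RHS]eq_bigr do rewrite RC_mulE mxE /= mulrC.
rewrite -exp_combination_cvg; congr (limn (series _)); apply/funext => k.
rewrite conj_rdiagX // conj_rdiag_entry Im_sum mulr_suml; apply: eq_bigr => c _.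
by rewrite RC_mulE mxE /= [X in X / _]mulrC.
Qed.

Lemma scale_conj_diag n (s : 'M[C]_n) (p : 'rV[R]_n) (t : R) :
  t%:C *: conj_diag s p = conj_diag s (t *: p).
Proof.
rewrite !conj_diagE.
have -> : rdiag (- (t *: p)) = t%:C *: rdiag (- p).
  apply/matrixP => i j; rewrite [RHS]mxE !rdiagE !mxE mulrnAr -rmorphM /=.
  by rewrite mulrN.
by rewrite -scalemxAr -scalemxAl.
Qed.

Lemma kempf_ness_conj_diag n m N (A : 'I_N -> 'M[C]_(n, m)) s t
    (p : 'rV[R]_n) (q : 'rV[R]_m) (x : R) :
  s \is unitarymx -> t \is unitarymx ->
  kempf_ness A (expmx (x%:C *: conj_diag s p)) (expmx (x%:C *: conj_diag t q)) =
  ln (\sum_i \sum_j expR (- x * (p 0 i + q 0 j)) * wgt s t A i j).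
Proof.
move=> su tu; rewrite /kempf_ness !scale_conj_diag !conj_diagE.
rewrite !expmx_conj_rdiag // rdiag_energy /=; congr ln.
apply: eq_bigr => i _; apply: eq_bigr => j _; congr (_ * _).
by rewrite !mxE -expRD; congr expR; ring.
Qed.

(** A log-sum-exp limit: the sum lies between [w exp (- x c)] and [W exp (- x c)], with [w] the
    weight at a minimising position and [W] the total weight, so its logarithm is [- x c] up to the
    bounded error [K]. *)
Lemma kempf_ness_ooE n m N (A : 'I_N -> 'M[C]_(n, m)) s t
    (p : 'rV[R]_n) (q : 'rV[R]_m) (c : R) i0 j0 :
  s \is unitarymx -> t \is unitarymx ->
  (forall i j, wgt s t A i j != 0 -> c <= p 0 i + q 0 j) ->
  wgt s t A i0 j0 != 0 -> p 0 i0 + q 0 j0 = c ->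
  kempf_ness_oo A (conj_diag s p, conj_diag t q) = - c.
Proof.
move=> su tu cmin w0 cE; rewrite /kempf_ness_oo /=.
pose W := \sum_i \sum_j wgt s t A i j.
set w := wgt s t A i0 j0 in w0.
have w0' : 0 < w by rewrite lt_neqAle eq_sym w0 wgt_ge0.
have wW : w <= W.
  rewrite /W (bigD1 i0) //= (bigD1 j0) //= -addrA lerDl addr_ge0 //.
    by apply: sumr_ge0 => j _; exact: wgt_ge0.
  by do 2!(apply: sumr_ge0 => ? _); exact: wgt_ge0.
have W0 := lt_le_trans w0' wW.
pose K := `|ln w| + `|ln W|.
apply: cvg_lim => //; apply/cvgrPdist_le => e e0; near=> x.
have x0 : 0 < x by near: x; apply: nbhs_pinfty_gt; exact: num_real.
have xK : K / e <= x by near: x; apply: nbhs_pinfty_ge; exact: num_real.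
rewrite kempf_ness_conj_diag //.
set S := \sum_i _.
have Slo : expR (- x * c) * w <= S.
  rewrite /S (bigD1 i0) //= (bigD1 j0) //= cE -addrA lerDl addr_ge0 //.
    by apply: sumr_ge0 => j _; rewrite mulr_ge0 ?wgt_ge0 ?expR_ge0.
  by do 2!(apply: sumr_ge0 => ? _); rewrite mulr_ge0 ?wgt_ge0 ?expR_ge0.
have Sup : S <= expR (- x * c) * W.
  rewrite /S /W mulr_sumr; apply: ler_sum => i _; rewrite mulr_sumr.
  apply: ler_sum => j _; have [->|wij] := eqVneq (wgt s t A i j) 0; first by rewrite !mulr0.
  apply: ler_wpM2r; first exact: wgt_ge0.
  rewrite ler_expR !mulNr lerN2 ler_pM2l //; exact: cmin.
have S0 : 0 < S by apply: lt_le_trans Slo; rewrite mulr_gt0 ?expR_gt0.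
move: Slo Sup; rewrite -ler_ln ?posrE ?mulr_gt0 ?expR_gt0 //.
rewrite lnM ?posrE ?expR_gt0 // expRK => Slo.
rewrite -ler_ln ?posrE ?mulr_gt0 ?expR_gt0 // lnM ?posrE ?expR_gt0 // expRK => Sup.
have Ke : K <= x * e by rewrite -ler_pdivrMr.
have -> : - c - ln S / x = - ((ln S + x * c) / x) by field; rewrite gt_eqF.
rewrite normrN normrM normfV (gtr0_norm x0) ler_pdivrMr // [e * x]mulrC.
apply: le_trans Ke; rewrite /K ler_norml.
have := ler_norm (- ln w); have := ler_norm (ln W); rewrite normrN.
have := normr_ge0 (ln w); have := normr_ge0 (ln W).
move: Slo Sup; clear; move: (ln S) (ln w) (ln W) => a b d; lra.
Unshelve. all: by end_near. Qed.

End KempfNessAtInfinity.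

(** * Geometry of the coarse DM-flag *)

Section RowSpaces.
Context {F : fieldType}.

(** Bridge from the matrices of the estimates to the [vspace] language of the flag. *)
Lemma row_space_vs k n (K : 'M[F]_(k, n)) :
  exists V : {vspace 'rV[F]_n}, \dim V = \rank K /\
    forall u, u \in V <-> exists w, u = w *m K.
Proof.
pose Rb := row_base K; pose s := [tuple row i Rb | i < \rank K].
have sum_s (c : 'I_(\rank K) -> F) :
    \sum_i c i *: s`_i = (\row_i c i) *m Rb.
  rewrite mulmx_sum_row; apply: eq_bigr => i _.
  by rewrite mxE -tnth_nth tnth_mktuple.
exists (span s); split.
  apply/eqP; rewrite -[X in _ == X](size_tuple s) -/(free s).
  apply/freeP => c; rewrite sum_s => c0 i.
  have /row_freeP [D RD] := row_base_free K.
  have := congr1 (mulmx^~ D) c0; rewrite -mulmxA RD mulmx1 mul0mx.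
  by move=> /rowP /(_ i); rewrite !mxE.
move=> u; split => [/coord_span ->|[w ->]].
  rewrite sum_s; have /submxP [D ->] : (Rb <= K)%MS by rewrite eq_row_base.
  by eexists; rewrite mulmxA.
have /submxP [D KE] : (K <= Rb)%MS by rewrite eq_row_base.
have -> : w *m K = w *m D *m Rb by rewrite -mulmxA -KE.
rewrite mulmx_sum_row; apply: memv_suml => i _; apply: memvZ.
by apply: memv_span; apply/tnthP; exists i; rewrite tnth_mktuple.
Qed.

End RowSpaces.

Section ConvexHull.
Context {R : realType} {M : lmodType R}.

Lemma conv_hull_segment (S : set M) (y z : M) (t : R) :
  conv_hull S y -> conv_hull S z -> 0 < t < 1 ->
  conv_hull S (t *: y + (1 - t) *: z).
Proof.
move=> Sy Sz /andP [t0 t1] A [Acv SA].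
have := Acv y z (Itv01 (ltW t0) (ltW t1)); rewrite !inE.
by apply; [exact: Sy|exact: Sz].
Qed.

Lemma conv_hull_sub (S A : set M) :
  (forall y z (t : R), A y -> A z -> 0 < t < 1 -> A (t *: y + (1 - t) *: z)) ->
  (forall x, S x -> A x) -> forall x, conv_hull S x -> A x.
Proof.
move=> Acv SA; apply: smallest_sub => //.
apply/convex_setW => x y; rewrite !inE => Ax Ay t t0 t1.
by rewrite !inE; apply: Acv => //; rewrite t0 t1.
Qed.

Lemma conv_hull_mem (S : set M) x : S x -> conv_hull S x.
Proof. exact: sub_gen_smallest. Qed.

End ConvexHull.

Section FlagGeometry.
Context {R : realType} {n m N : nat}.
Local Notation C := R[i].
Variable A : 'I_N -> 'M[C]_(n, m).
Variables (theta : nat) (X : nat -> {vspace 'rV[C]_n}) (Y : nat -> {vspace 'rV[C]_m}).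
Hypothesis flag : is_coarse_DM_flag A theta X Y.

Local Notation dx a := (\dim (X a)).
Local Notation dy a := (\dim (Y a)).

Lemma flag_SA a : (a <= theta)%N -> SA A (X a, Y a).
Proof.
case: flag => EE _ _ _ _ ath.
suff [] : EA A (X a, Y a) by [].
by rewrite EE; exists a.
Qed.

Lemma flag_extreme a : (a <= theta)%N ->
  is_extreme_point (conv_hull (@dim_pair R n m @` SA A)) (dim_pair (X a, Y a)).
Proof.
case: flag => EE _ _ _ _ ath.
suff [] : EA A (X a, Y a) by [].
by rewrite EE; exists a.
Qed.

Lemma flag_endpoints : [/\ dx 0 = n, dx theta = 0%N, dy 0 = 0%N & dy theta = m].
Proof.
case: flag => _ [-> ->] [-> ->] _ _.
by rewrite !dimv0 !dimvf /dim /= !mul1n.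
Qed.

Lemma flag_dimX_lt a b : (a < b)%N -> (b <= theta)%N -> (dx b < dx a)%N.
Proof.
case: flag => _ _ _ XS _; elim: b => // b IH; rewrite ltnS leq_eqVlt => ab bth.
have [sub ne] := XS b bth.
have step : (dx b.+1 < dx b)%N.
  rewrite ltn_neqAle dimvS // andbT; apply/eqP => dE; apply: ne.
  by apply/eqP; rewrite eqEdim sub dE /=.
case/orP: ab => [/eqP ->//|ab]; exact: ltn_trans step (IH ab (ltnW bth)).
Qed.

Lemma flag_dimY_lt a b : (a < b)%N -> (b <= theta)%N -> (dy a < dy b)%N.
Proof.
case: flag => _ _ _ _ YS; elim: b => // b IH; rewrite ltnS leq_eqVlt => ab bth.
have [sub ne] := YS b bth.
have step : (dy b < dy b.+1)%N.
  rewrite ltn_neqAle dimvS // andbT; apply/eqP => dE; apply: ne.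
  by apply/eqP; rewrite eqEdim sub dE /=.
case/orP: ab => [/eqP ->//|ab]; exact: ltn_trans (IH ab (ltnW bth)) step.
Qed.

Lemma flag_dimX_le a b : (a <= b)%N -> (b <= theta)%N -> (dx b <= dx a)%N.
Proof. by rewrite leq_eqVlt => /orP [/eqP ->|] // ab /(flag_dimX_lt ab) /ltnW. Qed.

Lemma flag_dimY_le a b : (a <= b)%N -> (b <= theta)%N -> (dy a <= dy b)%N.
Proof. by rewrite leq_eqVlt => /orP [/eqP ->|] // ab /(flag_dimY_lt ab) /ltnW. Qed.

Lemma flag_theta_gt0 : (0 < n)%N -> (0 < theta)%N.
Proof.
move=> n_gt0.
have [x0 xt _ _] := flag_endpoints; rewrite lt0n; apply/eqP => t0.
by move: xt; rewrite t0 x0 => nE; have := n_gt0; rewrite {1}nE.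
Qed.

Let S := (@dim_pair R n m @` SA A)%classic.

Lemma SA_down (V : {vspace 'rV[C]_n}) (W : {vspace 'rV[C]_m}) :
  SA A (V, W) -> SA A (V, 0%VS).
Proof.
move=> _ u v l _; rewrite memv0 => /eqP ->.
by rewrite (_ : 0^t* = 0) ?mulmx0 //; apply/matrixP => i j; rewrite !mxE rmorph0.
Qed.

(* Otherwise the middle point would lie on a vertical segment from the
   horizontal axis up to the chord. *)
Lemma flag_strictly_concave i j k : (i < j)%N -> (j < k)%N -> (k <= theta)%N ->
  ((dy k)%:R - (dy i)%:R) * ((dx i)%:R - (dx j)%:R) <
  ((dy j)%:R - (dy i)%:R) * ((dx i)%:R - (dx k)%:R) :> R.
Proof.
move=> ij jk kth; have jth := ltnW (leq_trans jk kth).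
have ith := ltnW (leq_trans ij jth).
have xij := flag_dimX_lt ij jth; have xjk := flag_dimX_lt jk kth.
have yij := flag_dimY_lt ij jth; have yjk := flag_dimY_lt jk kth.
rewrite ltNge; apply/negP => le.
have [_ ext] := flag_extreme jth.
have Si : conv_hull S (dim_pair (X i, Y i)).
  by apply: conv_hull_mem; exists (X i, Y i) => //; exact: flag_SA.
have Sk : conv_hull S (dim_pair (X k, Y k)).
  by apply: conv_hull_mem; exists (X k, Y k) => //; exact: flag_SA.
have Sf : conv_hull S (dim_pair (X j, 0%VS : {vspace 'rV[C]_m})).
  apply: conv_hull_mem; exists (X j, 0%VS) => //; apply: SA_down; exact: flag_SA jth.
move: (ltr_nat R (dx j) (dx i)) (ltr_nat R (dx k) (dx j)); rewrite xij xjk.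
move: (ltr_nat R (dy i) (dy j)) (ltr_nat R (dy j) (dy k)); rewrite yij yjk.
move: (ler0n R (dy i)); move: le ext Si Sk Sf; rewrite /dim_pair /= dimv0.
set xi := (dx i)%:R; set xj := (dx j)%:R; set xk := (dx k)%:R.
set yi := (dy i)%:R; set yj := (dy j)%:R; set yk := (dy k)%:R.
move=> le ext Si Sk Sf yi0 yij' yjk' xij' xjk'.
(* The weight at which the chord from the [i]-th to the [k]-th point has abscissa [xj]. *)
pose l := (xj - xk) / (xi - xk).
have xik : 0 < xi - xk by lra.
have l01 : 0 < l < 1.
  by rewrite divr_gt0 /=; [rewrite ltr_pdivrMr //; lra|lra|].
have Sw := conv_hull_segment Si Sk l01.
have wE : l *: ((xi, yi) : R^o * R^o) + (1 - l) *: (xk, yk) = (xj, l * yi + (1 - l) * yk).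
  congr pair => /=; rewrite /GRing.scale /= /l; field; lra.
rewrite wE in Sw; set y' := l * yi + _ in wE Sw.
have yy : yj <= y'.
  rewrite -(ler_pM2r xik).
  have -> : y' * (xi - xk) = (xj - xk) * yi + (xi - xj) * yk.
    rewrite /y' /l; field; lra.
  lra.
move: yy; rewrite le_eqVlt => /orP [/eqP yE|yy].
  have [] := ext _ _ l Si Sk l01; first by rewrite wE -yE.
  by move=> [] /eqP; rewrite gt_eqF.
have t01 : 0 < yj / y' < 1.
  by rewrite divr_gt0 /=; [rewrite ltr_pdivrMr; lra|lra|lra].
have [] := ext _ _ (yj / y') Sw Sf t01.
  have y'0 : y' != 0 by rewrite gt_eqF //; lra.
  congr pair; rewrite /GRing.scale /=; first by rewrite -mulrDl addrC subrK mul1r.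
  by rewrite -[RHS]/((yj / y' : R) * y' + (1 - yj / y' : R) * 0) divfK // mulr0 addr0.
by move=> [] E; move: yy; rewrite E ltxx.
Qed.

Lemma dim_le_n k (V : {vspace 'rV[C]_k}) : (\dim V <= k)%N.
Proof. by have := dimvS (subvf V); rewrite dimvf /dim /= mul1n. Qed.

(* The lexicographic maximiser of (a linear form, first coordinate) over
   [phi (S_A)] is an extreme point. *)
Lemma exists_extreme_maximizer (p q : nat) : (0 < p)%N -> (0 < q)%N ->
  exists V W, [/\ SA A (V, W),
    is_extreme_point (conv_hull S) (dim_pair (V, W)) &
    forall V' W', SA A (V', W') -> (p * \dim V' + q * \dim W' <= p * \dim V + q * \dim W)%N].
Proof.
move=> p0 q0.
(* One natural number encoding the lexicographic order: since [\dim V <= n], the factor [n.+1] lets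
   the linear form dominate. *)
pose key (V : {vspace 'rV[C]_n}) (W : {vspace 'rV[C]_m}) :=
  (n.+1 * (p * \dim V + q * \dim W) + \dim V)%N.
pose P k := `[< exists V W, SA A (V, W) /\ key V W = k >].
have exP : exists k, P k.
  exists (key 0%VS 0%VS); apply/asboolP; exists 0%VS, 0%VS; split => //.
  by move=> u v l; rewrite memv0 => /eqP -> _; rewrite !mul0mx.
have ubP k : P k -> (k <= n.+1 * (p * n + q * m) + n)%N.
  move=> /asboolP [V [W [_ <-]]]; have := dim_le_n V; have := dim_le_n W.
  by rewrite /key => ? ?; rewrite leq_add // leq_mul // leq_add // leq_mul.
case: (ex_maxnP exP ubP) => k /asboolP [V [W [VW kE]]] kmax.
have keymax V' W' : SA A (V', W') -> (key V' W' <= key V W)%N.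
  by move=> VW'; rewrite kE; apply: kmax; apply/asboolP; exists V', W'.
have lex V' W' : SA A (V', W') ->
    (p * \dim V' + q * \dim W' < p * \dim V + q * \dim W)%N \/
    (p * \dim V' + q * \dim W' = p * \dim V + q * \dim W)%N /\ (\dim V' <= \dim V)%N.
  move=> /keymax; rewrite /key; have := dim_le_n V.
  move: (p * \dim V' + q * \dim W')%N (p * \dim V + q * \dim W)%N => l L Vn le.
  case: (ltngtP l L) => [lt|lt|lL]; first by left.
    exfalso; have := leq_mul (leqnn n.+1) lt; rewrite mulnS => le'.
    have := leq_trans (leq_add le' (leqnn (\dim V'))) le.
    by rewrite addnAC [leqRHS]addnC leq_add2r leqNgt addSn ltnS (leq_trans Vn) ?leq_addr.
  by right; split => //; move: le; rewrite lL leq_add2l.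
exists V, W; split => //; last by move=> V' W' /lex [/ltnW|[->]].
have pR : 0 < p%:R :> R by rewrite ltr0n.
have qR : 0 < q%:R :> R by rewrite ltr0n.
set v : R := (\dim V)%:R; set w : R := (\dim W)%:R.
(* The points lexicographically at most the maximiser form a convex set, which therefore contains
   the hull. *)
pose A' : set (R^o * R^o) := [set z | p%:R * z.1 + q%:R * z.2 < p%:R * v + q%:R * w \/
   p%:R * z.1 + q%:R * z.2 = p%:R * v + q%:R * w /\ z.1 <= v]%classic.
have SA' : forall z, conv_hull S z -> A' z.
  apply: conv_hull_sub; last first.
    move=> _ [[V' W'] /lex VW' <-]; rewrite /A' /dim_pair /= /v /w -!natrM -!natrD.
    by case: VW' => [lt|[-> le]]; [left; rewrite ltr_nat|right; rewrite ler_nat].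
  move=> [y1 y2] [z1 z2] t; rewrite /A' /= /GRing.scale /=.
  set M := p%:R * v + q%:R * w.
  have -> : p%:R * (t * y1 + (1 - t) * z1) + q%:R * (t * y2 + (1 - t) * z2) =
    t * (p%:R * y1 + q%:R * y2) + (1 - t) * (p%:R * z1 + q%:R * z2) by ring.
  move: (p%:R * y1 + q%:R * y2) (p%:R * z1 + q%:R * z2) => ly lz.
  clearbody M v; clear => Hy Hz /andP [t0 t1].
  case: Hy => [Hy|[-> Hy]]; case: Hz => [Hz|[-> Hz]]; try (left; nra).
  by right; split; nra.
split; first by apply: conv_hull_mem; exists (V, W).
move=> [y1 y2] [z1 z2] t /SA' Hy /SA' Hz; move: Hy Hz; rewrite /A' /dim_pair /= -/v -/w.
move=> Hy Hz /andP [t0 t1] [E1 E2]; move: E1 E2; rewrite /GRing.scale /= => E1 E2.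
have LE : p%:R * v + q%:R * w =
  t * (p%:R * y1 + q%:R * y2) + (1 - t) * (p%:R * z1 + q%:R * z2) by rewrite E1 E2; ring.
have [yL zL] : p%:R * y1 + q%:R * y2 = p%:R * v + q%:R * w /\
               p%:R * z1 + q%:R * z2 = p%:R * v + q%:R * w.
  move: LE Hy Hz; set M := _ + _.
  move: (p%:R * y1 + q%:R * y2) (p%:R * z1 + q%:R * z2) => ly lz.
  move: t0 t1; clear => t0 t1 LE [Hy|[Hy _]] [Hz|[Hz _]]; split; nra.
have [y1v z1v] : y1 = v /\ z1 = v.
  have {}Hy : y1 <= v by case: Hy => [|[]//]; rewrite yL ltxx.
  have {}Hz : z1 <= v by case: Hz => [|[]//]; rewrite zL ltxx.
  by move: t0 t1 E1 Hy Hz; clear => t0 t1 E1 Hy Hz; split; nra.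
have q_neq0 : q%:R != 0 :> R by rewrite gt_eqF.
split; congr pair => //; apply: (mulfI q_neq0); apply: (addrI (p%:R * v)).
  by rewrite -yL y1v.
by rewrite -zL z1v.
Qed.

(** Within [SA], membership in [EA] depends on dimensions alone, and dimensions determine the index
    in the flag. This rigidity is the source of the uniqueness of the minimiser. *)
Lemma flag_EA V W a : SA A (V, W) -> (a <= theta)%N ->
  \dim V = dx a -> \dim W = dy a -> V = X a /\ W = Y a.
Proof.
move=> VW ath dV dW; case: flag => EE _ _ _ _.
have dE : @dim_pair R n m (V, W) = dim_pair (X a, Y a) by rewrite /dim_pair /= dV dW.
have : EA A (V, W).
  split => //; first by rewrite dE; exact: flag_extreme.
  rewrite dE; have : EA A (X a, Y a) by rewrite EE; exists a.
  by case.
rewrite EE => -[b bth [XE YE]].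
suff -> : a = b by [].
case: (ltngtP a b) => // ab.
  by have := flag_dimX_lt ab bth; rewrite XE dV ltnn.
by have := flag_dimX_lt ab ath; rewrite XE dV ltnn.
Qed.

(** The form with coefficients [mblock Y a] and [nblock X a] is constant along the edge joining the
    flag points [a.-1] and [a]. Its maximum over phi (S_A) is attained at an extreme point, which is
    a flag point, and strict concavity keeps every flag point on or below the line of that edge. *)
Lemma flag_support a (V : {vspace 'rV[C]_n}) (W : {vspace 'rV[C]_m}) :
  (0 < a <= theta)%N -> SA A (V, W) ->
  (mblock Y a * \dim V + nblock X a * \dim W <=
   mblock Y a * dx a + nblock X a * dy a)%N.
Proof.
case: a => // a /= ath; rewrite /mblock /nblock /=.
have xa := flag_dimX_lt (ltnSn a) ath; have ya := flag_dimY_lt (ltnSn a) ath.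
have [||V' [W' [VW' ext le]]] := @exists_extreme_maximizer (dy a.+1 - dy a) (dx a - dx a.+1).
- by rewrite subn_gt0.
- by rewrite subn_gt0.
move=> /le /leq_trans; apply.
have [b bth [XE YE]] : exists2 b, (b <= theta)%N & (X b, Y b) = (V', W').
  suff : EA A (V', W') by case: flag => -> _ _ _ _ [b]; exists b.
  (* [EA] excludes the origin, which is not the maximiser because the form is positive at the flag
     point [a.+1]. *)
  split => //; rewrite /dim_pair /= => -[/eqP + /eqP +].
  rewrite !pnatr_eq0 => /eqP V0 /eqP W0.
  have := le _ _ (flag_SA ath); rewrite V0 W0 !muln0 leqn0 addn_eq0 !muln_eq0 !subn_eq0.
  rewrite (leqNgt (dx a)) xa (leqNgt (dy a.+1)) ya /= => /andP [_ /eqP y0].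
  by move: ya; rewrite y0.
rewrite -XE -YE -(ler_nat R) !natrD !natrM !natrB ?(ltnW xa) ?(ltnW ya) //.
have [ba|ab] := leqP b a.
  move: ba; rewrite leq_eqVlt => /orP [/eqP ->|ba]; first by lra.
  by have := flag_strictly_concave ba (ltnSn a) ath; nra.
move: ab; rewrite leq_eqVlt => /orP [/eqP <-|ab]; first by lra.
by have := flag_strictly_concave (ltnSn a) ab bth; nra.
Qed.

Local Notation ratio a := ((mblock Y a)%:R / (nblock X a + mblock Y a)%:R : R).

Lemma nblock_gt0 a : (0 < a <= theta)%N -> (0 < nblock X a)%N.
Proof. by case: a => // a /= ath; rewrite subn_gt0 flag_dimX_lt. Qed.

Lemma mblock_gt0 a : (0 < a <= theta)%N -> (0 < mblock Y a)%N.
Proof. by case: a => // a /= ath; rewrite subn_gt0 flag_dimY_lt. Qed.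

(** [ratio] increases with the slope [mblock / nblock] of an edge, and consecutive slopes decrease
    by strict concavity. *)
Lemma ratio_lt a b : (0 < a)%N -> (a < b)%N -> (b <= theta)%N -> ratio b < ratio a.
Proof.
move=> a0; elim: b => // b IH; rewrite ltnS => ab bth.
have b0 : (0 < b)%N := leq_trans a0 ab.
have step : ratio b.+1 < ratio b.
  have nb := nblock_gt0 (a := b); have mb := mblock_gt0 (a := b).
  rewrite b0 (ltnW bth) in nb mb.
  have nb1 := nblock_gt0 (a := b.+1) bth; have mb1 := mblock_gt0 (a := b.+1) bth.
  have := flag_strictly_concave (i := b.-1) (j := b) (k := b.+1).
  rewrite prednK // => /(_ (leqnn _) (leqnn _) bth).
  have := nb isT; have := mb isT; move: nb1 mb1.
  have h1 : (dx b <= dx b.-1)%N by rewrite flag_dimX_le ?leq_pred // ltnW.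
  have h2 : (dx b.+1 <= dx b)%N by rewrite flag_dimX_le.
  have h3 : (dy b.-1 <= dy b)%N by rewrite flag_dimY_le ?leq_pred // ltnW.
  have h4 : (dy b <= dy b.+1)%N by rewrite flag_dimY_le.
  have : (nblock X b)%:R = (dx b.-1)%:R - (dx b)%:R :> R by rewrite /nblock natrB.
  have : (nblock X b.+1)%:R = (dx b)%:R - (dx b.+1)%:R :> R by rewrite /nblock natrB.
  have : (mblock Y b)%:R = (dy b)%:R - (dy b.-1)%:R :> R by rewrite /mblock natrB.
  have : (mblock Y b.+1)%:R = (dy b.+1)%:R - (dy b)%:R :> R by rewrite /mblock natrB.
  rewrite -!(ltr0n R) !natrD.
  move: (nblock X b)%:R (nblock X b.+1)%:R (mblock Y b)%:R (mblock Y b.+1)%:R => p p' q q'.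
  clear => qE' qE pE' pE p0' q0' q0 p0 conc.
  rewrite ltr_pdivrMr ?addr_gt0 // mulrAC ltr_pdivlMr ?addr_gt0 //.
  nra.
move: ab; rewrite leq_eqVlt => /orP [/eqP ->//|ab].
exact: lt_trans step (IH ab (ltnW bth)).
Qed.

Lemma ratio_le a b : (0 < a)%N -> (a <= b)%N -> (b <= theta)%N -> ratio b <= ratio a.
Proof.
by move=> a0; rewrite leq_eqVlt => /orP [/eqP -> //|ab] bth; apply/ltW/ratio_lt.
Qed.

Lemma ratio_compl a : (0 < a <= theta)%N ->
  (nblock X a)%:R / (nblock X a + mblock Y a)%:R = 1 - ratio a.
Proof.
move=> ath; have := nblock_gt0 ath; have := mblock_gt0 ath.
rewrite -!(ltr0n R) natrD => ? ?; field; rewrite gt_eqF // addr_gt0 //.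
Qed.

End FlagGeometry.

(** * Consecutive intervals of indices and the coordinates of x* *)

Section Blocks.
Context {R : realType}.
Variables (d : nat -> nat) (theta : nat).

Local Notation bnd a := (\sum_(1 <= b < a.+1) d b)%N.

Lemma bnd_le a b : (a <= b)%N -> (bnd a <= bnd b)%N.
Proof.
move=> ab; rewrite [leqRHS](@big_cat_nat _ _ _ a.+1) //=.
exact: leq_addr.
Qed.

Lemma in_blockE a k : (0 < a)%N -> in_block d a k = (bnd a.-1 <= k < bnd a)%N.
Proof. by case: a. Qed.

Lemma in_block_exists k : (k < bnd theta)%N ->
  exists a, (0 < a <= theta)%N /\ in_block d a k.
Proof.
move=> kt; have ex : exists a, (k < bnd a)%N by exists theta.
case: (ex_minnP ex) => a ka amin; exists a.
have a0 : (0 < a)%N by rewrite lt0n; apply/eqP => a0; move: ka; rewrite a0 big_geq.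
rewrite a0 (amin _ kt) in_blockE // ka !andbT; split => //.
by rewrite leqNgt; apply/negP => h; have := amin _ h; rewrite leqNgt prednK // leqnn.
Qed.

Lemma in_block_le a b k l : (0 < a)%N -> (0 < b)%N -> (k <= l)%N ->
  in_block d a k -> in_block d b l -> (a <= b)%N.
Proof.
move=> a0 b0 kl; rewrite !in_blockE // => /andP [ak _] /andP [_ lb].
rewrite leqNgt; apply/negP => ba.
have : (bnd b <= bnd a.-1)%N by apply: bnd_le; rewrite -ltnS prednK.
by move/(leq_trans lb); rewrite ltnNge (leq_trans ak kl).
Qed.

(** This is how the cuts of the flag become ranges of matrix indices: [bnd b] is the right end of
    block [b]. *)
Lemma in_block_bnd a b k : (0 < a)%N -> in_block d a k -> (b < a)%N = (bnd b <= k)%N.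
Proof.
move=> a0; rewrite in_blockE // => /andP [ak ka]; apply/idP/idP => h.
  by apply: leq_trans ak; apply: bnd_le; rewrite -ltnS prednK.
rewrite ltnNge; apply/negP => /bnd_le /(leq_trans ka); by rewrite ltnNge h.
Qed.

Lemma in_block_inj a b k : (0 < a)%N -> (0 < b)%N ->
  in_block d a k -> in_block d b k -> a = b.
Proof.
move=> a0 b0 ka kb; apply/eqP.
by rewrite eqn_leq (in_block_le a0 b0 (leqnn k)) // (in_block_le b0 a0 (leqnn k)).
Qed.

Lemma sum_in_block (F : nat -> R) a k : (0 < a <= theta)%N -> in_block d a k ->
  \sum_(1 <= b < theta.+1 | in_block d b k) F b = F a.
Proof.
move=> /andP [a0 ath] ka.
rewrite big_mkcond (bigD1_seq a) ?iota_uniq ?mem_index_iota ?a0 //= ka.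
rewrite big1_seq ?addr0 // => b; rewrite mem_index_iota => /andP [ba /andP [b0 _]].
case: ifP => // kb; by move: ba; rewrite (in_block_inj b0 a0 kb ka) eqxx.
Qed.

Lemma sum_blocks (F : nat -> R) n : n = bnd theta ->
  \sum_(i < n) \sum_(1 <= b < theta.+1 | in_block d b i) F b =
  \sum_(1 <= b < theta.+1) (d b)%:R * F b.
Proof.
move=> ->; transitivity (\sum_(i < bnd theta) \sum_(1 <= b < theta.+1)
    (if in_block d b i then F b else 0)).
  by apply: eq_bigr => i _; rewrite big_mkcond.
rewrite exchange_big /=; apply: eq_big_nat => b /andP [b0 bth].
rewrite -big_mkcond -(big_mkord (fun i => in_block d b i) (fun=> F b)) /=.
rewrite (eq_bigl (fun i => (true && (bnd b.-1 <= i)) && (i < bnd b))%N); last first.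
  by move=> i; rewrite in_blockE.
rewrite -big_nat_widen ?bnd_le // -big_nat_widenl //.
rewrite sumr_const_nat mulr_natl; congr (_ *+ _).
by case: b b0 {bth} => // b _ /=; rewrite [X in (X - _)%N]big_nat_recr //= addKn.
Qed.

End Blocks.

Section FlagCoordinates.
Context {R : realType} {n m N : nat}.
Local Notation C := R[i].
Variable A : 'I_N -> 'M[C]_(n, m).
Variables (theta : nat) (X : nat -> {vspace 'rV[C]_n}) (Y : nat -> {vspace 'rV[C]_m}).
Hypothesis flag : is_coarse_DM_flag A theta X Y.

Local Notation dx a := (\dim (X a)).
Local Notation dy a := (\dim (Y a)).
Local Notation C_ := (@C_A R n m theta X Y).
Local Notation ratio a := ((mblock Y a)%:R / (nblock X a + mblock Y a)%:R : R).

Lemma nblock_bnd a : (a <= theta)%N -> (\sum_(1 <= b < a.+1) nblock X b = n - dx a)%N.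
Proof.
elim: a => [|a IH] ath.
  by have [-> _ _ _] := flag_endpoints flag; rewrite big_geq // subnn.
rewrite big_nat_recr //= (IH (ltnW ath)) /nblock /=.
have := flag_dimX_le flag (leqnSn a) ath; have := dim_le_n (X a); lia.
Qed.

Lemma mblock_bnd a : (a <= theta)%N -> (\sum_(1 <= b < a.+1) mblock Y b = dy a)%N.
Proof.
elim: a => [|a IH] ath.
  by have [_ _ -> _] := flag_endpoints flag; rewrite big_geq.
rewrite big_nat_recr //= (IH (ltnW ath)) /mblock /=.
have := flag_dimY_le flag (leqnSn a) ath; lia.
Qed.

Lemma nblock_total : n = (\sum_(1 <= b < theta.+1) nblock X b)%N.
Proof. by rewrite nblock_bnd //; have [_ -> _ _] := flag_endpoints flag; rewrite subn0. Qed.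

Lemma mblock_total : m = (\sum_(1 <= b < theta.+1) mblock Y b)%N.
Proof. by rewrite mblock_bnd //; have [_ _ _ ->] := flag_endpoints flag. Qed.

Lemma row_block (i : 'I_n) : exists a, (0 < a <= theta)%N /\ in_block (nblock X) a i.
Proof. by apply: in_block_exists; rewrite -nblock_total. Qed.

Lemma col_block (j : 'I_m) : exists a, (0 < a <= theta)%N /\ in_block (mblock Y) a j.
Proof. by apply: in_block_exists; rewrite -mblock_total. Qed.

Lemma C_A_sum : C_ = \sum_(1 <= a < theta.+1) (nblock X a)%:R * ratio a.
Proof. by apply: eq_bigr => a _; rewrite natrM mulrA. Qed.

Hypothesis n_gt0 : (0 < n)%N.

Lemma C_A_gt0 : 0 < C_.
Proof.
rewrite C_A_sum big_nat_recl ?flag_theta_gt0 //; last exact: flag_theta_gt0 flag n_gt0.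
have th := flag_theta_gt0 flag n_gt0.
have n1 := nblock_gt0 flag (a := 1) th; have m1 := mblock_gt0 flag (a := 1) th.
apply: ltr_pwDl; first by rewrite mulr_gt0 ?divr_gt0 ?ltr0n ?addn_gt0 ?n1.
by apply: sumr_ge0 => a _; rewrite mulr_ge0 ?divr_ge0.
Qed.

Lemma pstarE (i : 'I_n) a : (0 < a <= theta)%N -> in_block (nblock X) a i ->
  (pstar theta X Y : 'rV[R]_n) 0 i = - n%:R^-1 + C_^-1 * ratio a.
Proof. by move=> ath ia; rewrite mxE (sum_in_block _ ath). Qed.

Lemma qstarE (j : 'I_m) a : (0 < a <= theta)%N -> in_block (mblock Y) a j ->
  (qstar theta X Y : 'rV[R]_m) 0 j = - m%:R^-1 + C_^-1 * (1 - ratio a).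
Proof. by move=> ath ja; rewrite mxE (sum_in_block _ ath) // (ratio_compl flag). Qed.

Lemma pstar_noninc (i i' : 'I_n) : (i <= i')%N ->
  (pstar theta X Y : 'rV[R]_n) 0 i' <= (pstar theta X Y : 'rV[R]_n) 0 i.
Proof.
move=> ii'; have [a [ath ia]] := row_block i; have [b [bth ib]] := row_block i'.
rewrite (pstarE ath ia) (pstarE bth ib) lerD2l ler_pM2l ?invr_gt0 ?C_A_gt0 //.
case/andP: ath => a0 ath; case/andP: bth => b0 bth.
by apply: (ratio_le flag) => //; apply: in_block_le ia ib.
Qed.

Lemma qstar_nondec (j j' : 'I_m) : (j <= j')%N ->
  (qstar theta X Y : 'rV[R]_m) 0 j <= (qstar theta X Y : 'rV[R]_m) 0 j'.
Proof.
move=> jj'; have [a [ath ja]] := col_block j; have [b [bth jb]] := col_block j'.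
rewrite (qstarE ath ja) (qstarE bth jb) lerD2l ler_pM2l ?invr_gt0 ?C_A_gt0 //.
case/andP: ath => a0 ath; case/andP: bth => b0 bth.
by rewrite lerD2l lerN2; apply: (ratio_le flag) => //; apply: in_block_le ja jb.
Qed.

Local Notation cstar := (C_^-1 - n%:R^-1 - m%:R^-1).

(** As [nblock / (nblock + mblock)] is [1 - ratio], the sum of the two coordinates is
    [cstar + (ratio a - ratio b) / C_A], and [ratio] is strictly decreasing along the flag. *)
Lemma pqstar_ge (i : 'I_n) (j : 'I_m) a b :
  (0 < a <= theta)%N -> in_block (nblock X) a i ->
  (0 < b <= theta)%N -> in_block (mblock Y) b j ->
  (cstar <= (pstar theta X Y : 'rV[R]_n) 0 i + (qstar theta X Y : 'rV[R]_m) 0 j) = (a <= b)%N.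
Proof.
move=> ath ia bth jb; rewrite (pstarE ath ia) (qstarE bth jb).
have Ci : 0 < C_^-1 by rewrite invr_gt0 C_A_gt0.
have -> : - n%:R^-1 + C_^-1 * ratio a + (- m%:R^-1 + C_^-1 * (1 - ratio b)) =
  cstar + C_^-1 * (ratio a - ratio b) by ring.
rewrite lerDl pmulr_rge0 // subr_ge0.
case/andP: ath => a0 ath; case/andP: bth => b0 bth.
case: leqP => ab; first exact: (ratio_le flag).
by apply/negbTE; rewrite -ltNge; apply: (ratio_lt flag).
Qed.

Lemma sum_pstar : \sum_i (pstar theta X Y : 'rV[R]_n) 0 i = 0.
Proof.
under eq_bigr do rewrite mxE.
rewrite big_split /= sumr_const card_ord -mulr_sumr (sum_blocks _ nblock_total) -C_A_sum.
by rewrite mulVf ?gt_eqF ?C_A_gt0 // -[X in X + _]mulr_natr mulNr mulVf ?addNr // pnatr_eq0 -lt0n.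
Qed.

Hypothesis m_gt0 : (0 < m)%N.

Lemma C_A_sum_col : C_ = \sum_(1 <= a < theta.+1)
  (mblock Y a)%:R * ((nblock X a)%:R / (nblock X a + mblock Y a)%:R).
Proof. by apply: eq_bigr => a _; rewrite mulrA -natrM mulnC. Qed.

Lemma sum_qstar : \sum_j (qstar theta X Y : 'rV[R]_m) 0 j = 0.
Proof.
under eq_bigr do rewrite mxE.
rewrite big_split /= sumr_const card_ord -mulr_sumr (sum_blocks _ mblock_total) -C_A_sum_col.
by rewrite mulVf ?gt_eqF ?C_A_gt0 // -[X in X + _]mulr_natr mulNr mulVf ?addNr // pnatr_eq0 -lt0n.
Qed.

Lemma sum_sqr_affine k (f : 'I_k -> R) (u v : R) :
  \sum_i (u + v * f i) ^+ 2 = k%:R * u ^+ 2 + 2 * u * v * (\sum_i f i) + v ^+ 2 * \sum_i f i ^+ 2.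
Proof.
rewrite !mulr_sumr -[k in k%:R]card_ord mulr_natl -sumr_const -!big_split /=.
by apply: eq_bigr => i _; ring.
Qed.

(** After expansion all reduces to [n_a r^2 + m_a (1 - r)^2 = n_a m_a / (n_a + m_a)] for
    [r = m_a / (n_a + m_a)], whose sum over the blocks is [C_A] again. *)
Lemma vec_normsq_star :
  vec_normsq (pstar theta X Y, qstar theta X Y) = cstar.
Proof.
rewrite /vec_normsq /=.
under eq_bigr do rewrite mxE; under [X in _ + X]eq_bigr do rewrite mxE.
rewrite !sum_sqr_affine (sum_blocks _ nblock_total) -C_A_sum.
rewrite (sum_blocks _ mblock_total) -C_A_sum_col.
(* Each inner sum has exactly one term, so squaring passes through it. *)
have rowsq (i : 'I_n) :
    (\sum_(1 <= a < theta.+1 | in_block (nblock X) a i) ratio a) ^+ 2 =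
     \sum_(1 <= a < theta.+1 | in_block (nblock X) a i) ratio a ^+ 2.
  by have [a [ath ia]] := row_block i; rewrite !(sum_in_block _ ath).
have colsq (j : 'I_m) :
    (\sum_(1 <= a < theta.+1 | in_block (mblock Y) a j)
       (nblock X a)%:R / (nblock X a + mblock Y a)%:R) ^+ 2 =
     \sum_(1 <= a < theta.+1 | in_block (mblock Y) a j)
       ((nblock X a)%:R / (nblock X a + mblock Y a)%:R) ^+ 2 :> R.
  by have [a [ath ja]] := col_block j; rewrite !(sum_in_block _ ath).
rewrite (eq_bigr _ (fun i _ => rowsq i)) (eq_bigr _ (fun j _ => colsq j)).
rewrite (sum_blocks _ nblock_total) (sum_blocks _ mblock_total).
have CE : \sum_(1 <= b < theta.+1) (nblock X b)%:R * ratio b ^+ 2 +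
   \sum_(1 <= b < theta.+1) (mblock Y b)%:R * ((nblock X b)%:R / (nblock X b + mblock Y b)%:R) ^+ 2
   = C_.
  rewrite -big_split /=; apply: eq_big_nat => b bth.
  have := nblock_gt0 flag bth; have := mblock_gt0 flag bth.
  rewrite -!(ltr0n R) natrD natrM => m0 n0; field.
  by rewrite gt_eqF // addr_gt0.
have C0 : C_ != 0 by rewrite gt_eqF // C_A_gt0.
have n0 : n%:R != 0 :> R by rewrite pnatr_eq0 -lt0n.
have m0 : m%:R != 0 :> R by rewrite pnatr_eq0 -lt0n.
move: CE; set s1 := \sum_(1 <= b < _) _; set s2 := \sum_(1 <= b < _) _ => CE.
have -> : n%:R * (- n%:R^-1) ^+ 2 + 2 * - n%:R^-1 * C_^-1 * C_ + C_^-1 ^+ 2 * s1 +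
  (m%:R * (- m%:R^-1) ^+ 2 + 2 * - m%:R^-1 * C_^-1 * C_ + C_^-1 ^+ 2 * s2) =
  - n%:R^-1 - m%:R^-1 + C_^-1 ^+ 2 * (s1 + s2).
  by move: s1 s2 C_ C0 {CE} => s1 s2 c c0; field; rewrite n0 m0 c0.
rewrite CE; move: C_ C0 {CE} => c c0; field; rewrite n0 m0 c0 //.
Qed.

End FlagCoordinates.

Section Selection.
Context {F : fieldType}.

(** Right multiplication by the transposes of the two selections turns the stacked matrix into the
    block diagonal matrix of [V] and an identity. *)
Lemma rank_select n k p q (f : 'I_p -> 'I_n) (g : 'I_q -> 'I_n) (V : 'M[F]_(k, p)) :
  injective f -> injective g -> (forall i j, f i != g j) ->
  (\rank V + q <= \rank (col_mx (V *m rowsub f 1%:M) (rowsub g 1%:M)))%N.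
Proof.
move=> fI gI fg.
have sel r s (u : 'I_r -> 'I_n) (v : 'I_s -> 'I_n) :
    rowsub u 1%:M *m (rowsub v 1%:M)^T = \matrix_(i, j) (u i == v j)%:R :> 'M[F]_(r, s).
  rewrite mul_rowsub_mx mul1mx; apply/matrixP => i j; rewrite !mxE eq_sym //.
have selI r (u : 'I_r -> 'I_n) : injective u ->
    rowsub u 1%:M *m (rowsub u 1%:M)^T = 1%:M :> 'M[F]_r.
  by move=> uI; rewrite sel; apply/matrixP => i j; rewrite !mxE (inj_eq uI).
set K := col_mx _ _.
have := mxrankM_maxl K (row_mx (rowsub f 1%:M)^T (rowsub g 1%:M)^T).
rewrite mul_col_row -!mulmxA !selI // mulmx1 !sel.
have -> : (\matrix_(i, j) (f i == g j)%:R : 'M[F]_(p, q)) = 0.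
  by apply/matrixP => i j; rewrite !mxE (negPf (fg i j)).
have -> : (\matrix_(i, j) (g i == f j)%:R : 'M[F]_(q, p)) = 0.
  by apply/matrixP => i j; rewrite !mxE eq_sym (negPf (fg j i)).
by rewrite mulmx0 rank_diag_block_mx mxrank1.
Qed.

End Selection.

(** * Semistability of the diagonal blocks and assembly along the flag *)

Section FlagApproximation.
Context {R : realType} {n m N : nat}.
Local Notation C := R[i].
Variable A : 'I_N -> 'M[C]_(n, m).
Variables (theta : nat) (X : nat -> {vspace 'rV[C]_n}) (Y : nat -> {vspace 'rV[C]_m}).
Hypothesis flag : is_coarse_DM_flag A theta X Y.
Variables (sigma : 'M[C]_n) (tau : 'M[C]_m).
Hypotheses (sigmaP : adapted_left theta X sigma) (tauP : adapted_right theta Y tau).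

Local Notation dx a := (\dim (X a)).
Local Notation dy a := (\dim (Y a)).

Lemma adapted_row a (i : 'I_n) : (a <= theta)%N -> (n - dx a <= i)%N ->
  row i sigma \in X a.
Proof.
move=> ath ia; have [_ /(_ a ath) bas] := sigmaP.
apply: (basis_mem bas); apply/mapP; exists i => //.
by rewrite mem_filter ia mem_enum.
Qed.

Lemma adapted_col a (j : 'I_m) : (a <= theta)%N -> (j < dy a)%N -> row j tau \in Y a.
Proof.
move=> ath ja; have [_ /(_ a ath) bas] := tauP.
apply: (basis_mem bas); apply/mapP; exists j => //.
by rewrite mem_filter ja mem_enum.
Qed.

Lemma mul_row_entry k r (K : 'M[C]_(k, n)) (L : 'M[C]_(r, m)) (M : 'M[C]_(n, m)) i j :
  row i K *m M *m (row j L)^t* = ((K *m M *m L^t*) i j)%:M.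
Proof.
apply/matrixP => a b; rewrite !ord1 [RHS]mxE eqxx mulr1n -row_mul !mxE.
by apply: eq_bigr => c _; rewrite !mxE.
Qed.

Lemma adapted_zero a (i : 'I_n) (j : 'I_m) l : (a <= theta)%N ->
  (n - dx a <= i)%N -> (j < dy a)%N -> (sigma *m A l *m tau^t*) i j = 0.
Proof.
move=> ath ia ja.
have := flag_SA flag ath; move=> /(_ _ _ l (adapted_row ath ia) (adapted_col ath ja)).
by rewrite mul_row_entry => /matrixP /(_ 0 0); rewrite !mxE eqxx mulr1n.
Qed.

Lemma SA_of_matrices k r (K : 'M[C]_(k, n)) (L : 'M[C]_(r, m)) :
  (forall l, K *m A l *m L^t* = 0) ->
  exists V W, [/\ SA A (V, W), \dim V = \rank K, \dim W = \rank L,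
    forall u, u \in V <-> exists w, u = w *m K &
    forall v, v \in W <-> exists w, v = w *m L].
Proof.
move=> KL; have [V [dV VP]] := row_space_vs K; have [W [dW WP]] := row_space_vs L.
exists V, W; split; [|exact: dV|exact: dW|exact: VP|exact: WP] => u v l /= /VP [w ->] /WP [z ->].
by rewrite adjmxM !mulmxA -(mulmxA w) -(mulmxA w) KL mulmx0 mul0mx.
Qed.

Lemma flag_rank_support a k r (K : 'M[C]_(k, n)) (L : 'M[C]_(r, m)) :
  (0 < a <= theta)%N -> (forall l, K *m A l *m L^t* = 0) ->
  (mblock Y a * \rank K + nblock X a * \rank L <=
   mblock Y a * dx a + nblock X a * dy a)%N.
Proof.
move=> ath /SA_of_matrices [V [W [VW <- <- _ _]]].
exact: flag_support ath VW.
Qed.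

Hypotheses (n_gt0 : (0 < n)%N) (m_gt0 : (0 < m)%N).
Let i0 : 'I_n := Ordinal n_gt0.
Let j0 : 'I_m := Ordinal m_gt0.
Let B l : 'M[C]_(n, m) := sigma *m A l *m tau^t*.
(** Natural indices let blocks of all sizes be cut from one function and glued by index arithmetic;
    the defaults [i0], [j0] only serve indices out of range. *)
Let F l (i j : nat) : C := B l (insubd i0 i) (insubd j0 j).

(** A pair annihilated by the block is enlarged by all rows of [X a.+1] and all columns of [Y a],
    which gives an element of [SA] of dimensions at least [\rank V + dx a.+1] and [\rank W + dy a].
    The edge inequality [flag_support] for this element is then semistability of the block. *)
Lemma flag_block_semistable a : (a < theta)%N ->
  semistable (fun l => \matrix_(i < nblock X a.+1, j < mblock Y a.+1)
    F l (n - dx a + i) (dy a + j)).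
Proof.
move=> ath k r V W VW.
have dxa := dim_le_n (X a); have dya := dim_le_n (Y a.+1).
have lx := flag_dimX_le flag (leqnSn a) ath; have ly := flag_dimY_le flag (leqnSn a) ath.
have nbE : nblock X a.+1 = (dx a - dx a.+1)%N by [].
have mbE : mblock Y a.+1 = (dy a.+1 - dy a)%N by [].
pose f1 (i : 'I_(nblock X a.+1)) : 'I_n := insubd i0 (n - dx a + i)%N.
pose f2 (i : 'I_(dx a.+1)) : 'I_n := insubd i0 (n - dx a.+1 + i)%N.
pose g1 (j : 'I_(mblock Y a.+1)) : 'I_m := insubd j0 (dy a + j)%N.
pose g2 (j : 'I_(dy a)) : 'I_m := insubd j0 j.
have f1E i : f1 i = (n - dx a + i)%N :> nat.
  by rewrite val_insubd; case: ifP => //; have := ltn_ord i; lia.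
have f2E i : f2 i = (n - dx a.+1 + i)%N :> nat.
  by rewrite val_insubd; case: ifP => //; have := ltn_ord i; lia.
have g1E j : g1 j = (dy a + j)%N :> nat.
  by rewrite val_insubd; case: ifP => //; have := ltn_ord j; lia.
have g2E j : g2 j = j :> nat.
  by rewrite val_insubd; case: ifP => //; have := ltn_ord j; lia.
pose K := col_mx (V *m rowsub f1 1%:M) (rowsub f2 1%:M : 'M[C]_(_, n)).
pose L := col_mx (W *m rowsub g1 1%:M) (rowsub g2 1%:M : 'M[C]_(_, m)).
have rK : (\rank V + dx a.+1 <= \rank K)%N.
  apply: rank_select => [i j /(congr1 val)|i j /(congr1 val)|i j].
  - by rewrite /= !f1E => /addnI /val_inj.
  - by rewrite /= !f2E => /addnI /val_inj.
  - by rewrite -val_eqE /= f1E f2E; have := ltn_ord i; lia.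
have rL : (\rank W + dy a <= \rank L)%N.
  apply: rank_select => [i j /(congr1 val)|i j /(congr1 val)|i j].
  - by rewrite /= !g1E => /addnI /val_inj.
  - by rewrite /= !g2E => /val_inj.
  - by rewrite -val_eqE /= g1E g2E; have := ltn_ord j; lia.
have sel p q (u : 'I_p -> 'I_n) (v : 'I_q -> 'I_m) (M : 'M[C]_(n, m)) :
    rowsub u 1%:M *m M *m (rowsub v 1%:M)^t* = \matrix_(i, j) M (u i) (v j).
  rewrite mul_rowsub_mx mul1mx; apply/matrixP => i j.
  rewrite !mxE (bigD1 (v j)) //= big1 ?addr0.
    by rewrite !mxE eqxx rmorph1 mulr1.
  by move=> c cv; rewrite !mxE eq_sym (negPf cv) rmorph0 mulr0.
have zero : forall l, (K *m sigma) *m A l *m (L *m tau)^t* = 0.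
  move=> l; have -> : (K *m sigma) *m A l *m (L *m tau)^t* = K *m B l *m L^t*.
    by rewrite adjmxM /B !mulmxA.
  rewrite /K /L tr_col_mx map_row_mx mul_col_mx mul_col_row -[RHS]block_mx0.
  (* The hypothesis on [V] and [W] kills the product over this block; the other three fall in the
     zero pattern of [B]. *)
  have e11 : rowsub f1 1%:M *m B l *m (rowsub g1 1%:M)^t* =
      \matrix_(i < nblock X a.+1, j < mblock Y a.+1) F l (n - dx a + i) (dy a + j).
    by rewrite sel.
  have e12 : rowsub f1 1%:M *m B l *m (rowsub g2 1%:M)^t* = 0.
    rewrite sel; apply/matrixP => i j; rewrite [LHS]mxE [RHS]mxE.
    by apply: (adapted_zero l (ltnW ath)); rewrite ?f1E ?leq_addr // g2E.
  have e21 : rowsub f2 1%:M *m B l *m (rowsub g1 1%:M)^t* = 0.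
    rewrite sel; apply/matrixP => i j; rewrite [LHS]mxE [RHS]mxE.
    apply: (adapted_zero l ath); rewrite ?f2E ?leq_addr // g1E.
    by have := ltn_ord j; lia.
  have e22 : rowsub f2 1%:M *m B l *m (rowsub g2 1%:M)^t* = 0.
    rewrite sel; apply/matrixP => i j; rewrite [LHS]mxE [RHS]mxE.
    apply: (adapted_zero l ath); rewrite ?f2E ?leq_addr // g2E.
    by apply: leq_trans ly.
  congr block_mx.
  - by rewrite adjmxM mulmxA -!(mulmxA V) e11 mulmxA VW.
  - by rewrite -!(mulmxA V) e12 mulmx0.
  - by rewrite adjmxM mulmxA e21 mul0mx.
  - exact: e22.
have su : sigma \in unitmx by case: sigmaP => /unitarymx_unit.
have tu : tau \in unitmx by case: tauP => /unitarymx_unit.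
have ath' : (0 < a.+1 <= theta)%N by [].
have := flag_rank_support ath' zero.
rewrite !mxrankMfree ?row_free_unit // => H.
have h1 := leq_mul (leqnn (mblock Y a.+1)) rK.
have h2 := leq_mul (leqnn (nblock X a.+1)) rL.
have := leq_trans (leq_add h1 h2) H.
have -> : (dy a.+1 = dy a + mblock Y a.+1)%N by rewrite mbE subnKC.
move: (nblock X a.+1) (mblock Y a.+1) (\rank V) (\rank W) (dx a.+1) (dy a).
clear => nb mb rV rW x y; rewrite !mulnDr; nia.
Qed.

(** Induction over the leading corners with [n - dx a] rows and [dy a] columns: passing to [a.+1]
    adds one semistable diagonal block, to the left of which the tuple vanishes. *)
Lemma flag_approx_norm : approx_norm A (@C_A R n m theta X Y).
Proof.
suff H : approx_norm (tuple_act sigma tau A) (@C_A R n m theta X Y).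
  move=> e e0; have [g [h [gu hu]]] := H e e0; rewrite tuple_actM => T G.
  exists (g *m sigma), (h *m tau); split => //.
    by rewrite unitmx_mul gu; case: sigmaP => /unitarymx_unit.
  by rewrite unitmx_mul hu; case: tauP => /unitarymx_unit.
pose c b : R := (nblock X b * mblock Y b)%:R / (nblock X b + mblock Y b)%:R.
have step a : (a <= theta)%N ->
   approx_norm (fun l => \matrix_(i < n - dx a, j < dy a) F l i j) (\sum_(1 <= b < a.+1) c b).
  elim: a => [|a IH] ath.
    have [-> _ -> _] := flag_endpoints flag; rewrite subnn big_geq // => e e0.
    exists 1%:M, 1%:M; rewrite !unitmx1; split => //; first exact: tuple_normsq_ge0.
    by rewrite /gram_normsq [row_gram _]flatmx0 [col_gram _]flatmx0 !fnormsq0 !add0r ltW.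
  have lx := flag_dimX_le flag (leqnSn a) ath; have ly := flag_dimY_le flag (leqnSn a) ath.
  have -> : (n - dx a.+1 = (n - dx a) + nblock X a.+1)%N.
    by rewrite /nblock /=; have := dim_le_n (X a); lia.
  have -> : (dy a.+1 = dy a + mblock Y a.+1)%N by rewrite /mblock /= subnKC.
  rewrite big_nat_recr //=.
  have ath' : (0 < a.+1 <= theta)%N by [].
  have blk := semistable_approx (nblock_gt0 flag ath') (mblock_gt0 flag ath')
    (flag_block_semistable ath).
  pose Q l : 'M[C]_(_, _) := \matrix_(i < n - dx a, j < mblock Y a.+1) F l i (dy a + j).
  have H := approx_norm_block Q (IH (ltnW ath)) blk.
  set G := fun l => block_mx _ _ _ _ in H.
  suff -> : (fun l => \matrix_(i < n - dx a + nblock X a.+1, j < dy a + mblock Y a.+1) F l i j) = G.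
    exact: H.
  apply/funext => l; apply/matrixP => i j; rewrite /G /Q.
  case: (split_ordP i) => i' ->; case: (split_ordP j) => j' ->.
  - by rewrite block_mxEul [LHS]mxE [RHS]mxE.
  - by rewrite block_mxEur [LHS]mxE [RHS]mxE.
  - rewrite block_mxEdl [LHS]mxE [RHS]mxE; apply: (adapted_zero l (ltnW ath)).
      rewrite val_insubd /=; case: ifP => [_|]; first exact: leq_addr.
      have := ltn_ord i'; rewrite /nblock /=; have := dim_le_n (X a); lia.
    rewrite val_insubd /=; case: ifP => //; have := ltn_ord j'; have := dim_le_n (Y a); lia.
  - by rewrite block_mxEdr [LHS]mxE [RHS]mxE.
have := step theta (leqnn _).
have [_ -> _ ->] := flag_endpoints flag; rewrite subn0.
suff -> : (fun l => \matrix_(i < n, j < m) F l i j) = tuple_act sigma tau A by [].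
by apply/funext => l; apply/matrixP => i j; rewrite mxE /F !valKd.
Qed.

End FlagApproximation.

(** * The minimum-norm point and the unique minimiser *)

Section MomentMap.
Context {R : realType}.
Local Notation C := R[i].
Local Notation Re := complex.Re.

Lemma fnormsq_subr_scalar n (M : 'M[C]_n) (b : R) :
  fnormsq (M - (b%:C)%:M) = fnormsq M - 2 * b * Re (\tr M) + b ^+ 2 * n%:R.
Proof.
have -> : b ^+ 2 * n%:R = \sum_(i < n) b ^+ 2 by rewrite sumr_const card_ord mulr_natr.
rewrite !fnormsqE /mxtrace Re_sum mulr_sumr -sumrB -big_split /=; apply: eq_bigr => i _.
rewrite (bigD1 i) //= [in RHS](bigD1 i) //= 3!mxE eqxx mulr1n.
rewrite (eq_bigr (fun j => nsq (M i j))) => [|j ji]; last first.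
  by rewrite 3!mxE eq_sym (negPf ji) mulr0n subr0.
by case: (M i i) => x y; rewrite /nsq /=; ring.
Qed.

(** Both Gram matrices have trace [tuple_normsq B], so subtracting the scalar parts contributes
    [- 2/n + 1/n] and [- 2/m + 1/m]. *)
Lemma pair_normsq_moment n m N (B : 'I_N -> 'M[C]_(n, m)) :
  (0 < n)%N -> (0 < m)%N -> 0 < tuple_normsq B ->
  pair_normsq (moment_map B) =
  gram_normsq B / tuple_normsq B ^+ 2 - n%:R^-1 - m%:R^-1.
Proof.
move=> n0 m0 T0; rewrite /pair_normsq /moment_map /= !natC_inv !fnormsq_subr_scalar.
rewrite !fnormsqZ !mxtraceZ row_gram_tr col_gram_tr !nsqR -!rmorphM /= /gram_normsq.
move: (tuple_normsq B) (fnormsq _) (fnormsq _) T0 => T r c T0.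
by field; rewrite !pnatr_eq0 -!lt0n n0 m0 gt_eqF.
Qed.

Lemma tuple_act_scaler n m N (B : 'I_N -> 'M[C]_(n, m)) z g h :
  tuple_act g (z *: h) B = tuple_act (conjc z *: g) h B.
Proof.
by apply/funext => l; rewrite /tuple_act adjmxZ -scalemxAr -!scalemxAl.
Qed.

Lemma moment_map_scalel n m N (B : 'I_N -> 'M[C]_(n, m)) z g h : z != 0 ->
  moment_map (tuple_act (z *: g) h B) = moment_map (tuple_act g h B).
Proof.
move=> z0; have nz : nsq z != 0 by rewrite nsq_eq0.
rewrite /moment_map row_gramZ col_gramZ tuple_normsqZ !scalerA.
suff -> : ((nsq z * tuple_normsq (tuple_act g h B))^-1)%:C * (nsq z)%:C =
          ((tuple_normsq (tuple_act g h B))^-1)%:C :> C by [].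
by rewrite -rmorphM /= invfM mulrAC (mulVf nz) mul1r.
Qed.

Lemma moment_map_scaler n m N (B : 'I_N -> 'M[C]_(n, m)) z g h : z != 0 ->
  moment_map (tuple_act g (z *: h) B) = moment_map (tuple_act g h B).
Proof.
by move=> z0; rewrite tuple_act_scaler moment_map_scalel // conjc_eq0.
Qed.

(** The polytope asks for determinant one while the approximations come from invertible matrices;
    the moment map ignores scalars, so a root of the determinant bridges the two. *)
Lemma exists_det_one n (g : 'M[C]_n) : (0 < n)%N -> g \in unitmx ->
  exists2 z, z != 0 & \det (z *: g) = 1.
Proof.
move=> n0; rewrite unitmxE unitfE => g0.
have zE : (n.-root (\det g)^-1) ^+ n = (\det g)^-1 by exact: rootCK.
exists (n.-root (\det g)^-1); last by rewrite detZ zE mulVf.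
apply/eqP => z0; move: zE; rewrite z0 expr0n gtn_eqF //= => /esym/eqP.
by rewrite invr_eq0 (negPf g0).
Qed.

Lemma moment_spec_exists n m N (B : 'I_N -> 'M[C]_(n, m)) :
  exists2 x : 'rV[R]_n * 'rV[R]_m, is_spec (moment_map B) x &
    vec_normsq x = pair_normsq (moment_map B).
Proof.
have [s [a [su GE aS]]] := herm_spectral (r := >=%O) ge_total ge_trans lexx (row_moment_herm B).
have [t [b [tu HE bS]]] := herm_spectral (r := <=%O) le_total le_trans lexx (col_moment_herm B).
exists (a, b).
  by split; [rewrite GE char_poly_conj_rdiag|rewrite HE char_poly_conj_rdiag|exact: aS|exact: bS].
by rewrite /pair_normsq GE HE !conj_rdiag_fnormsq.
Qed.

(** The change of frame [s *m s'^t*] mixes only coordinates with equal value of [p], hence commutes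
    with the diagonal matrix. *)
Lemma same_flag_conj_diag n (s s' : 'M[C]_n) (p : 'rV[R]_n) :
  s \is unitarymx -> s' \is unitarymx ->
  (forall i j, p 0 i != p 0 j -> (s *m s'^t*) i j = 0) ->
  conj_diag s' p = conj_diag s p.
Proof.
move=> su s'u sp; rewrite !conj_diagE.
have comm : (s *m s'^t*) *m rdiag (- p) = rdiag (- p) *m (s *m s'^t*).
  apply/matrixP => i j; rewrite mulmx_rdiag rdiag_mulmx ![(- p) _ _]mxE.
  have [<-|pij] := eqVneq (p 0 i) (p 0 j); first by rewrite mulrC.
  by rewrite (sp i j pij) mul0r mulr0.
have := congr1 (fun M => s^t* *m M *m s') comm; rewrite !mulmxA.
rewrite (unitary_adjK su) mul1mx => ->.
by rewrite -!mulmxA (unitary_adjK s'u) mulmx1.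
Qed.

Lemma span_mulmx0 n k (s : seq 'rV[C]_n) (M : 'M[C]_(n, k)) u :
  (forall x, x \in s -> x *m M = 0) -> u \in span s -> u *m M = 0.
Proof.
move=> sM; rewrite -[s]/(val (in_tuple s)) => /coord_span ->.
rewrite mulmx_suml big1 // => i _.
by rewrite -scalemxAl sM ?scaler0 // mem_nth.
Qed.

(** [f] enumerates [P], so [U] is spanned by the [P]-rows of [s] and also by those of [s']. In each
    orthonormal frame the other rows are orthogonal to [U], so the change of frame respects [P]. *)
Lemma common_span_orth n k (s s' : 'M[C]_n) (U : {vspace 'rV[C]_n}) (P : pred 'I_n)
    (f : 'I_k -> 'I_n) :
  s \is unitarymx -> s' \is unitarymx ->
  basis_of U [seq row i s | i : 'I_n <- enum 'I_n & P i] ->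
  (forall u, u \in U <-> exists w, u = w *m rowsub f s') ->
  (forall a, P (f a)) -> (forall j, P j -> exists a, f a = j) ->
  forall i j, P i != P j -> (s *m s'^t*) i j = 0.
Proof.
move=> s_u s'_u bas UP fP Pf i j.
have orth (u : 'M[C]_n) a b : u \is unitarymx -> a != b -> row a u *m (row b u)^t* = 0.
  move=> u_u ab; apply/matrixP => x y; rewrite !ord1.
  have /unitarymxP/matrixP/(_ a b) := u_u; rewrite !mxE (negPf ab) => E.
  by rewrite -[RHS]E; apply: eq_bigr => c _; rewrite !mxE.
have entry : row i s *m (row j s')^t* = ((s *m s'^t*) i j)%:M.
  apply/matrixP => x y; rewrite !ord1 [RHS]mxE eqxx mulr1n !mxE.
  by apply: eq_bigr => c _; rewrite !mxE.
suff E0 : P i != P j -> row i s *m (row j s')^t* = 0.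
  by move=> /E0; rewrite entry => /matrixP /(_ 0 0); rewrite !mxE eqxx mulr1n.
case Pi : (P i); case Pj : (P j) => // _.
  have /UP [w ->] : row i s \in U.
    apply: (basis_mem bas); apply/mapP; exists i => //.
    by rewrite mem_filter Pi mem_enum.
  rewrite -mulmxA (_ : rowsub f s' *m _ = 0) ?mulmx0 //.
  apply/row_matrixP => a; rewrite row_mul row0.
  have -> : row a (rowsub f s') = row (f a) s' by apply/rowP => c; rewrite !mxE.
  by apply: orth => //; apply/eqP => fa; move: (fP a); rewrite fa Pj.
have s'U : row j s' \in U.
  have [a fa] := Pf j Pj; apply/UP; exists (delta_mx 0 a).
  by rewrite -rowE; apply/rowP => c; rewrite !mxE fa.
rewrite -(span_basis bas) in s'U.
have E : row j s' *m (row i s)^t* = 0.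
  apply: span_mulmx0 s'U => x /mapP [b]; rewrite mem_filter => /andP [Pb _] ->.
  by apply: orth => //; apply/eqP => bi; move: Pb; rewrite bi Pi.
by rewrite -[LHS]trmxCK adjmxM trmxCK E adjmx0.
Qed.

End MomentMap.

Section Polytope.
Context {R : realType}.
Local Notation C := R[i].

Definition vec_dot n m (x y : 'rV[R]_n * 'rV[R]_m) : R :=
  \sum_i x.1 0 i * y.1 0 i + \sum_j x.2 0 j * y.2 0 j.

Lemma vec_dot_continuous n m (x : 'rV[R]_n * 'rV[R]_m) : continuous (vec_dot x).
Proof.
have c1 i : continuous ((fun v : 'rV[R]_n => v 0 i) \o @fst 'rV[R]_n 'rV[R]_m).
  by move=> y; apply: continuous_comp; [exact: cvg_fst|exact: coord_continuous].
have c2 i : continuous ((fun v : 'rV[R]_m => v 0 i) \o @snd 'rV[R]_n 'rV[R]_m).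
  by move=> y; apply: continuous_comp; [exact: cvg_snd|exact: coord_continuous].
apply: continuous_addR; apply: continuous_sumR => i y.
  by apply: cvgM; [exact: cvg_cst|exact: c1].
by apply: cvgM; [exact: cvg_cst|exact: c2].
Qed.

Lemma vec_dot_le_closure n m (S : set ('rV[R]_n * 'rV[R]_m)) x c :
  (forall y, S y -> c <= vec_dot x y) -> forall y, closure S y -> c <= vec_dot x y.
Proof.
move=> Sc.
have cl : closed [set y | c <= vec_dot x y]%classic.
  apply: (@closed_comp _ _ (vec_dot x) [set r | c <= r]%classic).
    by move=> y _; exact: vec_dot_continuous.
  exact: closed_ge.
move=> y /(closureS Sc); rewrite -(closure_id _).1 //.
Qed.

Lemma vec_normsq_sub n m (x y : 'rV[R]_n * 'rV[R]_m) :
  vec_normsq (y - x) = vec_normsq y - 2 * vec_dot x y + vec_normsq x.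
Proof.
rewrite /vec_normsq /vec_dot.
have E k (u v : 'rV[R]_k) : \sum_i (v - u) 0 i ^+ 2 =
    \sum_i v 0 i ^+ 2 - 2 * (\sum_i u 0 i * v 0 i) + \sum_i u 0 i ^+ 2.
  by rewrite mulr_sumr -sumrB -big_split /=; apply: eq_bigr => i _; rewrite !mxE; ring.
by rewrite !E; ring.
Qed.

Lemma vec_dotZ n m (k : R) (x y : 'rV[R]_n * 'rV[R]_m) :
  vec_dot x (k *: y) = k * vec_dot x y.
Proof.
by rewrite /vec_dot mulrDr !mulr_sumr; congr (_ + _); apply: eq_bigr => i _;
  rewrite mxE mulrCA.
Qed.

Lemma vec_dotC n m (x y : 'rV[R]_n * 'rV[R]_m) : vec_dot x y = vec_dot y x.
Proof. by congr (_ + _); apply: eq_bigr => i _; rewrite mulrC. Qed.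

Lemma vec_normsqZ n m (k : R) (x : 'rV[R]_n * 'rV[R]_m) :
  vec_normsq (k *: x) = k ^+ 2 * vec_normsq x.
Proof.
by rewrite /vec_normsq mulrDr !mulr_sumr; congr (_ + _); apply: eq_bigr => i _;
  rewrite mxE exprMn.
Qed.

Lemma vec_normsq_ge0 n m (x : 'rV[R]_n * 'rV[R]_m) : 0 <= vec_normsq x.
Proof. by rewrite addr_ge0 // sumr_ge0 // => i _; exact: sqr_ge0. Qed.

Lemma vec_normsq_eq0 n m (x : 'rV[R]_n * 'rV[R]_m) : vec_normsq x <= 0 -> x = 0.
Proof.
move=> x0; have /eqP : vec_normsq x = 0 by apply/eqP; rewrite eq_le x0 vec_normsq_ge0.
rewrite paddr_eq0; try by apply: sumr_ge0 => i _; exact: sqr_ge0.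
rewrite !psumr_eq0; try by move=> i _; exact: sqr_ge0.
case: x {x0} => x y /= /andP [/allP x0 /allP y0].
congr pair; apply/rowP => i; rewrite mxE; apply/eqP; rewrite -sqrf_eq0.
  by have := x0 i (mem_index_enum _).
by have := y0 i (mem_index_enum _).
Qed.

Lemma vec_ball n m (x y : 'rV[R]_n * 'rV[R]_m) r :
  0 < r -> vec_normsq (y - x) < r ^+ 2 -> ball x r y.
Proof.
move=> r0 xy.
have coord k (u v : 'rV[R]_k) i : \sum_i (v - u) 0 i ^+ 2 < r ^+ 2 -> ball (u 0 i) r (v 0 i).
  move=> lt; rewrite /ball /= distrC -(ltr_pXn2r (n := 2)) ?nnegrE ?normr_ge0 ?ltW //.
  rewrite real_normK ?num_real //; apply: le_lt_trans lt.
  rewrite (bigD1 i) //= !mxE lerDl sumr_ge0 // => j _; exact: sqr_ge0.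
have s1 : 0 <= \sum_i (y.1 - x.1) 0 i ^+ 2 by apply: sumr_ge0 => i _; exact: sqr_ge0.
have s2 : 0 <= \sum_i (y.2 - x.2) 0 i ^+ 2 by apply: sumr_ge0 => i _; exact: sqr_ge0.
split => /=; split => // i j; rewrite !ord1; apply: coord; apply: le_lt_trans xy.
  by rewrite /vec_normsq lerDl.
by rewrite /vec_normsq lerDr.
Qed.

End Polytope.

Section Duality.
Context {R : realType} {n m N : nat}.
Local Notation C := R[i].
Variable A : 'I_N -> 'M[C]_(n, m).
Hypothesis A_orbit_gt0 : forall g h, g \in unitmx -> h \in unitmx ->
  0 < tuple_normsq (tuple_act g h A).

(** The frames are transported to each point of the orbit, where weak duality applies; a closed
    half-space then contains the closure too. *)
Lemma polytope_dot_ge (s : 'M[C]_n) (t : 'M[C]_m) (p : 'rV[R]_n) (q : 'rV[R]_m) c :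
  s \is unitarymx -> t \is unitarymx ->
  (forall i j : 'I_n, (i <= j)%N -> p 0 j <= p 0 i) ->
  (forall i j : 'I_m, (i <= j)%N -> q 0 i <= q 0 j) ->
  \sum_i p 0 i = 0 -> \sum_j q 0 j = 0 ->
  (forall i j, wgt s t A i j != 0 -> c <= p 0 i + q 0 j) ->
  forall y, moment_polytope A y -> c <= vec_dot (p, q) y.
Proof.
move=> su tu pS qS p0 q0 supp; apply: vec_dot_le_closure => y [g [h [g1 h1 sp]]].
have gu : g \in unitmx by rewrite unitmxE g1 unitr1.
have hu : h \in unitmx by rewrite unitmxE h1 unitr1.
have [s' [t' [s'u t'u supp']]] := support_transport su tu gu hu pS qS supp.
exact: weak_duality s'u t'u pS qS p0 q0 supp' (A_orbit_gt0 gu hu) sp.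
Qed.

Lemma support_min (s : 'M[C]_n) (t : 'M[C]_m) (p : 'rV[R]_n) (q : 'rV[R]_m) :
  s \is unitarymx -> t \is unitarymx ->
  exists i0 j0, wgt s t A i0 j0 != 0 /\
    forall i j, wgt s t A i j != 0 -> p 0 i0 + q 0 j0 <= p 0 i + q 0 j.
Proof.
move=> su tu.
have [i [j wij]] : exists i j, wgt s t A i j != 0.
  apply: contrapT => H.
  have := A_orbit_gt0 (unitarymx_unit su) (unitarymx_unit tu).
  rewrite tuple_normsqE big1 ?ltxx // => i _; rewrite big1 // => j _.
  by apply/eqP; apply: contrapT => /negP w; apply: H; exists i, j.
pose P (ij : 'I_n * 'I_m) := wgt s t A ij.1 ij.2 != 0.
pose F (ij : 'I_n * 'I_m) := p 0 ij.1 + q 0 ij.2.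
have Pij : P (i, j) by [].
case: (arg_minP F Pij) => [[i0 j0]] w0 Fmin.
by exists i0, j0; split=> // i' j' w; exact: (Fmin (i', j')).
Qed.

End Duality.

Lemma trivial_kernel_orbit (R : realType) n m N (A : 'I_N -> 'M[R[i]]_(n, m)) :
  (0 < m)%N -> (forall v : 'cV[R[i]]_m, (forall l, A l *m v = 0) -> v = 0) ->
  forall g h, g \in unitmx -> h \in unitmx -> 0 < tuple_normsq (tuple_act g h A).
Proof.
move=> m0 ker g h gu hu; rewrite lt_neqAle tuple_normsq_ge0 andbT eq_sym.
apply/negP; rewrite psumr_eq0 => [/allP A0|l _]; last exact: fnormsq_ge0.
pose v : 'cV[R[i]]_m := delta_mx (Ordinal m0) 0.
have : v = 0.
  apply: ker => l; have /implyP /(_ isT) /eqP /fnormsq_eq0 := A0 l (mem_index_enum _).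
  have hu' : h^t* \in unitmx by rewrite map_unitmx unitmx_tr.
  move=> /(congr1 (mulmx^~ (invmx (h^t*)))); rewrite mulmxK // mul0mx.
  by move=> /(congr1 (mulmx (invmx g))); rewrite mulKmx // mulmx0 => ->; rewrite mul0mx.
by move=> /matrixP /(_ (Ordinal m0) 0); rewrite !mxE !eqxx => /eqP; rewrite oner_eq0.
Qed.

Lemma rowZE (F : pzRingType) n (k : F) (u : 'rV[F]_n) i : (k *: u) 0 i = k * u 0 i.
Proof. by rewrite mxE. Qed.

(** * Optimality of x* and of its Hermitian pair *)

Section MainTheorem.
Context {R : realType} {n m N : nat}.
Local Notation C := R[i].
Variable A : 'I_N -> 'M[C]_(n, m).
Variables (theta : nat) (X : nat -> {vspace 'rV[C]_n}) (Y : nat -> {vspace 'rV[C]_m}).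
Variables (sigma : 'M[C]_n) (tau : 'M[C]_m).
Hypotheses (n_gt0 : (0 < n)%N) (m_gt0 : (0 < m)%N).
Hypothesis A_orbit_gt0 : forall g h, g \in unitmx -> h \in unitmx ->
  0 < tuple_normsq (tuple_act g h A).
Hypothesis flag : is_coarse_DM_flag A theta X Y.
Hypotheses (sigmaP : adapted_left theta X sigma) (tauP : adapted_right theta Y tau).

Local Notation dx a := (\dim (X a)).
Local Notation dy a := (\dim (Y a)).
Local Notation pst := (pstar theta X Y : 'rV[R]_n).
Local Notation qst := (qstar theta X Y : 'rV[R]_m).
Local Notation xst := (pst, qst).
Local Notation cstar := (vec_normsq xst).

Let su : sigma \is unitarymx. Proof. by case: sigmaP. Qed.
Let tu : tau \is unitarymx. Proof. by case: tauP. Qed.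
Let cE : cstar = (@C_A R n m theta X Y)^-1 - n%:R^-1 - m%:R^-1.
Proof. exact: vec_normsq_star flag n_gt0 m_gt0. Qed.

(** In adapted frames, a nonzero entry in row block [a] and column block [b] has [a <= b], which is
    the condition of [pqstar_ge]. *)
Lemma star_support i j : wgt sigma tau A i j != 0 -> cstar <= pst 0 i + qst 0 j.
Proof.
have [a [ath ia]] := row_block flag i; have [b [bth jb]] := col_block flag j.
rewrite cE (pqstar_ge flag n_gt0 ath ia bth jb); apply: contraNT; rewrite -ltnNge => ba.
have [[a0 ath'] [b0 bth']] := (andP ath, andP bth).
apply/wgt_eq0P => l; apply: (adapted_zero flag sigmaP tauP l bth').
  by rewrite -(nblock_bnd flag bth') -(in_block_bnd _ a0 ia).
by move: jb; rewrite in_blockE // (mblock_bnd flag bth') => /andP [].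
Qed.

Lemma star_dot_ge y : moment_polytope A y -> cstar <= vec_dot xst y.
Proof.
apply: (polytope_dot_ge A_orbit_gt0 su tu); [exact: pstar_noninc flag n_gt0|
  exact: qstar_nondec flag n_gt0|exact: sum_pstar flag n_gt0|
  exact: sum_qstar flag n_gt0 m_gt0|exact: star_support].
Qed.

(** With tolerance [e c^2], the bounds [T >= c] and [gram <= c + e c^2] give
    [gram / T^2 <= 1/c + e]. With squared norm one, the moment map is literally the pair of defects
    in [is_scalable]. *)
Lemma orbit_moment_approx e : 0 < e ->
  exists g h, [/\ g \in unitmx, h \in unitmx, tuple_normsq (tuple_act g h A) = 1 &
    pair_normsq (moment_map (tuple_act g h A)) <= cstar + e].
Proof.
move=> e0; have cE' := cE; set c := @C_A R n m theta X Y in cE'.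
have c0 : 0 < c := C_A_gt0 flag n_gt0.
have ec0 : 0 < e * c ^+ 2 by rewrite mulr_gt0 // exprn_gt0.
have [g [h [gu hu cT G]]] := flag_approx_norm flag sigmaP tauP n_gt0 m_gt0 ec0.
set T := tuple_normsq _ in cT; have T0 : 0 < T := lt_le_trans c0 cT.
pose z : C := (Num.sqrt T^-1)%:C.
have zE : nsq z = T^-1 by rewrite nsqR sqr_sqrtr // invr_ge0 ltW.
have z0 : z != 0 by rewrite -nsq_gt0 zE invr_gt0.
exists (z *: g), h; split; [exact: scalar_unitmx|exact: hu| |].
  by rewrite tuple_normsqZ zE mulVf // gt_eqF.
rewrite moment_map_scalel // pair_normsq_moment // -/T cE' !lerBlDr.
have -> : c^-1 - n%:R^-1 - m%:R^-1 + e + m%:R^-1 + n%:R^-1 = c^-1 + e by ring.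
rewrite ler_pdivrMr ?exprn_gt0 //; apply: le_trans G _; rewrite -/c.
have -> : c + e * c ^+ 2 = (c^-1 + e) * c ^+ 2 by field; rewrite gt_eqF.
apply: ler_wpM2l; first by rewrite addr_ge0 ?invr_ge0 ?ltW.
by rewrite ler_pXn2r // nnegrE ltW.
Qed.

Lemma star_in_polytope : moment_polytope A xst.
Proof.
move=> U /nbhs_ballP [r /= r0 rU].
(* A tolerance for which [|x - x*|^2 <= |x|^2 - |x*|^2] stays below the squared radius. *)
have e0 : 0 < r ^+ 2 / 2 by rewrite divr_gt0 // exprn_gt0.
have [g [h [gu hu _ le]]] := orbit_moment_approx e0.
have [z z0 gz] := exists_det_one n_gt0 gu; have [w w0 hw] := exists_det_one m_gt0 hu.
rewrite -(moment_map_scalel A g h z0) -(moment_map_scaler A (z *: g) h w0) in le.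
have [x xs xn] := moment_spec_exists (tuple_act (z *: g) (w *: h) A).
exists x; split; first by exists (z *: g), (w *: h).
apply: rU; apply: vec_ball => //; rewrite vec_normsq_sub.
have := star_dot_ge (y := x); rewrite xn.
have memx : moment_polytope A x by apply: subset_closure; exists (z *: g), (w *: h).
move=> /(_ memx); move: le; have : 0 < r ^+ 2 by rewrite exprn_gt0.
lra.
Qed.

Lemma star_min_norm : is_min_norm_point (moment_polytope A) xst.
Proof.
split; first exact: star_in_polytope.
move=> y yA yx; have := star_dot_ge yA.
have : 0 < vec_normsq (y - xst).
  rewrite lt_neqAle vec_normsq_ge0 andbT; apply/eqP => y0; apply: yx.
  by apply/eqP; rewrite -subr_eq0; apply/eqP/vec_normsq_eq0; rewrite -y0.
rewrite vec_normsq_sub; lra.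
Qed.

(** If [x*] were zero, the normalised orbit points of [orbit_moment_approx] would have arbitrarily
    small moment map, which is scalability. *)
Lemma star_normsq_gt0 : ~ is_scalable A -> 0 < cstar.
Proof.
move=> nsc; rewrite lt_neqAle vec_normsq_ge0 andbT; apply/eqP => c0; apply: nsc => e e0.
have e20 : 0 < e ^+ 2 by rewrite exprn_gt0.
have [g [h [gu hu T1 le]]] := orbit_moment_approx e20.
exists g, h; split => //; move: le; rewrite -c0 add0r /moment_map T1 invr1.
by rewrite !scale1r.
Qed.

Lemma vec_dotxx (x : 'rV[R]_n * 'rV[R]_m) : vec_dot x x = vec_normsq x.
Proof. by rewrite /vec_dot /vec_normsq. Qed.

(** The best lower bound over the support is at most [<x*, x*>], by duality evaluated at [x*] in the
    polytope; [star_support] gives the converse. *)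
Lemma star_tight : exists i0 j0, wgt sigma tau A i0 j0 != 0 /\ pst 0 i0 + qst 0 j0 = cstar.
Proof.
have [i [j [wij cmin]]] := support_min A_orbit_gt0 pst qst su tu.
exists i, j; split => //; apply/eqP; rewrite eq_le star_support // andbT.
rewrite -vec_dotxx; apply: (polytope_dot_ge A_orbit_gt0 su tu) star_in_polytope;
  [exact: pstar_noninc flag n_gt0| exact: qstar_nondec flag n_gt0|
   exact: sum_pstar flag n_gt0| exact: sum_qstar flag n_gt0 m_gt0|exact: cmin].
Qed.

(** The factor [k] covers both the pair itself, [k = 1], and its normalisation, [k = 1 / |x*|]. *)
Lemma kempf_ness_oo_star k : 0 <= k ->
  kempf_ness_oo A (conj_diag sigma (k *: pst), conj_diag tau (k *: qst)) = - (k * cstar).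
Proof.
move=> k0; have [i [j [wij cij]]] := star_tight.
apply: (kempf_ness_ooE su tu _ wij) => [i' j' w|]; rewrite !rowZE -mulrDr ?cij //.
by apply: ler_wpM2l => //; exact: star_support.
Qed.

Lemma pair_norm_conj_diag (s : 'M[C]_n) (t : 'M[C]_m) (p : 'rV[R]_n) (q : 'rV[R]_m) :
  s \is unitarymx -> t \is unitarymx ->
  pair_normsq (conj_diag s p, conj_diag t q) = vec_normsq (p, q).
Proof.
move=> s_u t_u; rewrite /pair_normsq !conj_diagE !conj_rdiag_fnormsq //.
by congr (_ + _); apply: eq_bigr => i _; rewrite mxE sqrrN.
Qed.

Lemma conj_diag_traceless k (s : 'M[C]_k) (p : 'rV[R]_k) : s \is unitarymx ->
  \sum_i p 0 i = 0 -> traceless_herm (conj_diag s p).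
Proof.
move=> s_u p0; rewrite conj_diagE; split; first exact: conj_rdiag_herm.
rewrite conj_rdiag_tr //; under eq_bigr do rewrite mxE.
by rewrite sumrN p0 oppr0.
Qed.

(** [conj_diag] carries a minus sign, hence the order on [- p]: choosing [<=] for [r] makes [p]
    nonincreasing. *)
Lemma traceless_herm_spectral k (r : rel R) (G : 'M[C]_k) :
  total r -> transitive r -> reflexive r -> traceless_herm G ->
  exists (s : 'M[C]_k) (p : 'rV[R]_k), [/\ s \is unitarymx, G = conj_diag s p,
    \sum_i p 0 i = 0 & forall i j : 'I_k, (i <= j)%N -> r (- p 0 i) (- p 0 j)].
Proof.
move=> rtot rtr rrefl [Gh Gtr]; have [s [a [s_u GE aS]]] := herm_spectral rtot rtr rrefl Gh.
exists s, (- a); split; first exact: s_u.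
- by rewrite conj_diagE opprK.
- move: Gtr; rewrite GE conj_rdiag_tr // => /(@complexI R) a0.
  by under eq_bigr do rewrite mxE; rewrite sumrN a0 oppr0.
- by move=> i j ij; rewrite !mxE !opprK; exact: aS.
Qed.

Lemma pair_normalize_star : pair_normalize (conj_diag sigma pst, conj_diag tau qst) =
  (conj_diag sigma ((Num.sqrt cstar)^-1 *: pst), conj_diag tau ((Num.sqrt cstar)^-1 *: qst)).
Proof. by rewrite /pair_normalize /pair_norm pair_norm_conj_diag // !scale_conj_diag. Qed.

Let i0 : 'I_n := Ordinal n_gt0.
Let j0 : 'I_m := Ordinal m_gt0.

Lemma rowsub_unitary_rank k r (s : 'M[C]_r) (f : 'I_k -> 'I_r) :
  s \is unitarymx -> injective f -> \rank (rowsub f s) = k.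
Proof.
move=> /unitarymxP s_u fI; apply: mxrank_unitary; apply/unitarymxP/matrixP => i j.
have /matrixP /(_ (f i) (f j)) := s_u; rewrite !mxE (inj_eq fI) => E.
by rewrite -[RHS]E; apply: eq_bigr => c _; rewrite !mxE.
Qed.

(* If the support of [s A t^t*] lies above the diagonal blocks of the flag, the
   trailing rows of [s] and the leading rows of [t] span the flag itself. *)
Lemma support_flag (s : 'M[C]_n) (t : 'M[C]_m) a :
  s \is unitarymx -> t \is unitarymx ->
  (forall i j, wgt s t A i j != 0 -> cstar <= pst 0 i + qst 0 j) ->
  (a <= theta)%N ->
  (forall i j : 'I_n, (n - dx a <= i)%N != (n - dx a <= j)%N -> (sigma *m s^t*) i j = 0) /\
  (forall i j : 'I_m, (i < dy a)%N != (j < dy a)%N -> (tau *m t^t*) i j = 0).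
Proof.
move=> s_u t_u supp ath.
have dxa := dim_le_n (X a); have dya := dim_le_n (Y a).
pose f (i : 'I_(dx a)) : 'I_n := insubd i0 (n - dx a + i)%N.
pose g (j : 'I_(dy a)) : 'I_m := insubd j0 j.
have fE i : f i = (n - dx a + i)%N :> nat.
  by rewrite val_insubd; case: ifP => //; have := ltn_ord i; lia.
have gE j : g j = j :> nat.
  by rewrite val_insubd; case: ifP => //; have := ltn_ord j; lia.
have fI : injective f by move=> i j /(congr1 val); rewrite /= !fE => /addnI /val_inj.
have gI : injective g by move=> i j /(congr1 val); rewrite /= !gE => /val_inj.
have zero l : rowsub f s *m A l *m (rowsub g t)^t* = 0.
  apply/matrixP => i j; rewrite [RHS]mxE.
  have -> : (rowsub f s *m A l *m (rowsub g t)^t*) i j = (s *m A l *m t^t*) (f i) (g j).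
    rewrite mul_rowsub_mx !mxE; apply: eq_bigr => c _; rewrite !mxE; congr (_ * _).
  apply/wgt_eq0P: l; apply: contraT => /supp.
  have [b [bth ib]] := row_block flag (f i); have [c [cth jc]] := col_block flag (g j).
  have [[b0 _] [c0 _]] := (andP bth, andP cth).
  rewrite cE (pqstar_ge flag n_gt0 bth ib cth jc) leqNgt => /negP []; apply: (@leq_ltn_trans a).
    by rewrite leqNgt (in_block_bnd _ c0 jc) (mblock_bnd flag ath) gE -ltnNge.
  by rewrite (in_block_bnd _ b0 ib) (nblock_bnd flag ath) fE leq_addr.
have [V [W [VW dV dW VP WP]]] := SA_of_matrices zero.
rewrite rowsub_unitary_rank // in dV; rewrite rowsub_unitary_rank // in dW.
have [VX WY] := flag_EA flag VW ath dV dW; rewrite VX in VP; rewrite WY in WP.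
split.
  apply: (common_span_orth su s_u (proj2 sigmaP a ath) VP) => [i|j ja].
    by rewrite fE leq_addr.
  have jl : (j - (n - dx a) < dx a)%N by rewrite -(ltn_add2r (n - dx a)) subnK // subnKC.
  by exists (Ordinal jl); apply: val_inj; rewrite /= fE /= subnKC.
apply: (common_span_orth tu t_u (proj2 tauP a ath) WP) => [i|j ja].
  by rewrite gE ltn_ord.
by exists (Ordinal ja); apply: val_inj; rewrite /= gE.
Qed.

(** Positions with distinct values of [p*] (or of [q*]) lie in distinct blocks, which a member of
    the flag separates; [support_flag] then kills that entry of the change of frame. *)
Lemma star_unique (s : 'M[C]_n) (t : 'M[C]_m) k :
  s \is unitarymx -> t \is unitarymx ->
  (forall i j, wgt s t A i j != 0 -> cstar <= pst 0 i + qst 0 j) ->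
  conj_diag s (k *: pst) = conj_diag sigma (k *: pst) /\
  conj_diag t (k *: qst) = conj_diag tau (k *: qst).
Proof.
move=> s_u t_u supp.
(* The cut at the smaller of two distinct block indices separates them: exactly one of the two
   exceeds the minimum. *)
have min_neq (a b : nat) : a != b -> (minn a b < a)%N != (minn a b < b)%N.
  by rewrite /minn; case: (ltngtP a b); rewrite ?ltnn // => ->.
split; apply: same_flag_conj_diag => // i j; rewrite !rowZE => pij.
  have [a [ath ia]] := row_block flag i; have [b [bth jb]] := row_block flag j.
  have [[a0 ath'] [b0 bth']] := (andP ath, andP bth).
  have mth : (minn a b <= theta)%N by rewrite geq_min ath'.
  have [+ _] := support_flag s_u t_u supp mth; apply.
  rewrite -(nblock_bnd flag mth) -(in_block_bnd _ a0 ia) -(in_block_bnd _ b0 jb).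
  apply: min_neq; apply: contraNneq pij => ab.
  by rewrite (pstarE Y ath ia) (pstarE Y bth jb) ab.
have [a [ath ia]] := col_block flag i; have [b [bth jb]] := col_block flag j.
have [[a0 ath'] [b0 bth']] := (andP ath, andP bth).
have mth : (minn a b <= theta)%N by rewrite geq_min ath'.
have [_] := support_flag s_u t_u supp mth; apply.
rewrite !ltnNge -(mblock_bnd flag mth) -(in_block_bnd _ a0 ia) -(in_block_bnd _ b0 jb).
rewrite (inj_eq negb_inj); apply: min_neq; apply: contraNneq pij => ab.
by rewrite (qstarE flag ath ia) (qstarE flag bth jb) ab.
Qed.

Lemma star_unique_minimizer : 0 < cstar ->
  is_unique_minimizer (kempf_ness_oo A) (@unit_sphere R n m)
    (pair_normalize (conj_diag sigma pst, conj_diag tau qst)).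
Proof.
move=> c0; rewrite pair_normalize_star.
set r := Num.sqrt cstar.
have r0 : 0 < r by rewrite sqrtr_gt0.
have rr : r ^+ 2 = cstar by rewrite sqr_sqrtr // ltW.
have p0 := sum_pstar flag n_gt0; have q0 := sum_qstar flag n_gt0 m_gt0.
have kp0 : \sum_i (r^-1 *: pst) 0 i = 0.
  by under eq_bigr do rewrite mxE; rewrite -mulr_sumr p0 mulr0.
have kq0 : \sum_i (r^-1 *: qst) 0 i = 0.
  by under eq_bigr do rewrite mxE; rewrite -mulr_sumr q0 mulr0.
have nk : vec_normsq (r^-1 *: xst) = 1.
  by rewrite vec_normsqZ -rr -exprMn mulVf ?expr1n // gt_eqF.
split.
  split; [exact: conj_diag_traceless|exact: conj_diag_traceless|].
  by rewrite /pair_norm pair_norm_conj_diag // -[X in vec_normsq X]/(r^-1 *: xst) nk sqrtr1.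
move=> [G H] [/= Gt Ht GHn] ne.
rewrite kempf_ness_oo_star ?invr_ge0 ?ltW // -rr expr2 mulKf ?gt_eqF //.
have [s [p [s_u GE ps pS]]] := traceless_herm_spectral (r := <=%O) le_total le_trans lexx Gt.
have [t [q [t_u HE qs qS]]] := traceless_herm_spectral (r := >=%O) ge_total ge_trans lexx Ht.
have [i [j [wij cmin]]] := support_min A_orbit_gt0 p q s_u t_u.
set c' := p 0 i + q 0 j in cmin.
(* The value at this pair is [- c']; suppose, for a contradiction, that [r <= c']. *)
rewrite GE HE (kempf_ness_ooE s_u t_u cmin wij (erefl _)) ltrN2 ltNge; apply/negP => rc'.
have nz : vec_normsq (p, q) = 1.
  move: GHn; rewrite GE HE /pair_norm pair_norm_conj_diag // => E.
  by rewrite -[LHS]sqr_sqrtr ?vec_normsq_ge0 // E expr1n.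
have dotge : c' <= vec_dot (p, q) xst.
  apply: (polytope_dot_ge A_orbit_gt0 s_u t_u _ _ ps qs cmin) star_in_polytope.
    by move=> i' j' /pS; rewrite /= lerN2.
  by move=> i' j' /qS; rewrite /= lerN2.
(* Equality case of Cauchy-Schwarz: [(p, q)] and [x* / r] have norm one and their pairing is at
   least one, so their distance vanishes. *)
have zE : (p, q) = r^-1 *: xst.
  apply/eqP; rewrite -subr_eq0; apply/eqP/vec_normsq_eq0.
  have -> : vec_normsq ((p, q) - r^-1 *: xst) = 2 - 2 * (r^-1 * vec_dot (p, q) xst).
    rewrite vec_normsq_sub nz nk.
    rewrite vec_dotC vec_dotZ.
    by ring.
  rewrite subr_le0 -{1}[2]mulr1 ler_pM2l // -(mulVf (lt0r_neq0 r0)) ler_pM2l ?invr_gt0 //.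
  exact: le_trans rc' dotge.
have [pE qE] : p = r^-1 *: pst /\ q = r^-1 *: qst by case: zE.
apply: ne; rewrite GE HE pE qE.
(* For [(p, q) = x* / r], the bound [r <= c'] reads [p* + q* >= r^2] on the support in the frames
   [s], [t]. *)
have supp i' j' : wgt s t A i' j' != 0 -> cstar <= pst 0 i' + qst 0 j'.
  move=> w; have := le_trans rc' (cmin _ _ w); rewrite pE qE !rowZE -mulrDr.
  by rewrite ler_pdivlMl // -expr2 rr.
by have [-> ->] := star_unique r^-1 s_u t_u supp.
Qed.

End MainTheorem.

Theorem theorem4p24 (R : realType) (n m N : nat)
    (A : 'I_N -> 'M[R[i]]_(n, m))
    (theta : nat)
    (X : nat -> {vspace 'rV[R[i]]_n}) (Y : nat -> {vspace 'rV[R[i]]_m})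
    (sigma : 'M[R[i]]_n) (tau : 'M[R[i]]_m) :
  (0 < n)%N -> (0 < m)%N -> (0 < N)%N ->
  (forall v : 'cV[R[i]]_m, (forall l, A l *m v = 0) -> v = 0) ->
  (forall u : 'cV[R[i]]_n, (forall l, (A l)^t* *m u = 0) -> u = 0) ->
  ~ is_scalable A ->
  is_coarse_DM_flag A theta X Y ->
  adapted_left theta X sigma ->
  adapted_right theta Y tau ->
  let xstar := (pstar theta X Y, qstar theta X Y) in
  let Zstar := (conj_diag sigma xstar.1, conj_diag tau xstar.2) in
  [/\ is_min_norm_point (moment_polytope A) xstar,
      is_unique_minimizer (kempf_ness_oo A) (@unit_sphere R n m)
        (pair_normalize Zstar),
      vec_normsq xstar = - kempf_ness_oo A Zstar &
      vec_normsq xstar = (C_A theta X Y)^-1 - n%:R^-1 - m%:R^-1].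
Proof.
move=> n0 m0 _ ker _ nsc flag sP tP xstar Zstar.
have orb := trivial_kernel_orbit m0 ker.
split.
- exact: (star_min_norm n0 m0 orb flag sP tP).
- exact: (star_unique_minimizer n0 m0 orb flag sP tP (star_normsq_gt0 n0 m0 flag sP tP nsc)).
- have := kempf_ness_oo_star n0 m0 orb flag sP tP ler01.
  by rewrite !scale1r mul1r => ->; rewrite opprK.
- exact: (vec_normsq_star flag n0 m0).
Qed.
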